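(* Let $\Omega\subset\mathbb{R}^d$, $d\in\{2,3\}$, be an open connected bounded domain with smooth boundary, and let $1\le p<\infty$. For global smooth solutions $(c_1,c_2,\Phi,u)$ of the Nernst-Planck-Navier-Stokes system (with any $\epsilon>0$), with nonnegative initial concentrations $c_1(0),c_2(0)\ge0$, subject to the electroneutral boundary conditions $$c_1|_{\partial\Omega}=c_2|_{\partial\Omega},\qquad n\cdot\nabla(c_1+c_2)|_{\partial\Omega}=0,$$ there exist constants $\lambda_p>0$, depending only on $\Omega$, $D_1,D_2$ and $p$, and $C_p>0$, depending additionally only on the initial conditions, such that $\rho=c_1-c_2$ satisfies $$\|\rho(t)\|_{L^p(\Omega)}\le C_pe^{-\lambda_pt},\qquad t\ge0.$$
   Context: The Nernst-Planck-Navier-Stokes (NPNS) system for two ionic species with valences $z_1=1$, $z_2=-1$, with parameter $\epsilon>0$, is $$\partial_tc_i+u\cdot\nabla c_i=D_i\operatorname{div}(\nabla c_i+z_ic_i\nabla\Phi),\quad i=1,2,$$ $$-\epsilon\Delta\Phi=\rho,\qquad \rho=c_1-c_2,$$ $$\partial_tu+u\cdot\nabla u-\nu\Delta u+\nabla p=-\kappa\rho\nabla\Phi,\qquad \nabla\cdot u=0,$$ in $\Omega\times(0,\infty)$ (in the last equation $p$ denotes the pressure, not the Lebesgue exponent), with constants $D_1,D_2,\nu,\kappa>0$ ($D_1\ne D_2$ is allowed). The boundary conditions for $\Phi$ and $u$ are $\Phi(x,t)|_{\partial\Omega}=W(x)$, where $W$ is a given smooth time-independent function on $\partial\Omega$,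 and $u|_{\partial\Omega}=0$. Here $n$ is the outward unit normal along $\partial\Omega$. ''Smooth'' means smooth on $\overline\Omega\times[0,\infty)$. *)

(* Defs.v *)
From HB Require Import structures.
From mathcomp Require Import all_boot all_order all_algebra.
From mathcomp Require Import all_classical all_reals all_analysis.

Set Implicit Arguments.
Unset Strict Implicit.
Unset Printing Implicit Defensive.

Import Order.TTheory GRing.Theory Num.Theory.
Import numFieldNormedType.Exports.

Local Open Scope classical_set_scope.
Local Open Scope ring_scope.

(* The measure on R^(n+1), seen as (n+1)-tuples, is the image under
   (a, s) |-> a :: s of the product of the Lebesgue measure on R and the
   measure on R^n; sigma-finiteness is needed to iterate the product. *)
Section lebesgue_tuple.
Variable R : realType.
Notation T := (measurableTypeR R).

Definition tuple_cons n (z : T * n.-tuple T) : n.+1.-tuple T :=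
  [tuple of z.1 :: z.2].

Lemma measurable_tuple_cons n : measurable_fun setT (@tuple_cons n).
Proof. exact: measurable_cons. Qed.

Section succ.
Variables (n : nat) (mu : {sigma_finite_measure set (n.-tuple T) -> \bar R}).

Definition lebesgue_tuple_succ : set (n.+1.-tuple T) -> \bar R :=
  pushforward ((@lebesgue_measure R) \x mu)%E (@tuple_cons n).

Let lebesgue_tuple_succ0 : lebesgue_tuple_succ set0 = 0%E.
Proof. by rewrite /lebesgue_tuple_succ /pushforward preimage_set0 measure0. Qed.

Let lebesgue_tuple_succ_ge0 A : (0 <= lebesgue_tuple_succ A)%E.
Proof. by rewrite /lebesgue_tuple_succ /pushforward measure_ge0. Qed.

Let lebesgue_tuple_succ_sigma_additive :
  semi_sigma_additive lebesgue_tuple_succ.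
Proof.
move=> F mF tF mUF; rewrite /lebesgue_tuple_succ /pushforward preimage_bigcup.
apply: measure_semi_sigma_additive.
- by move=> k; rewrite -[X in measurable X]setTI; exact: measurable_tuple_cons.
- apply/trivIsetP => i j _ _ ij; rewrite -preimage_setI.
  by move/trivIsetP : tF => /(_ _ _ _ _ ij) ->//; rewrite preimage_set0.
- rewrite -preimage_bigcup -[X in measurable X]setTI.
  exact: measurable_tuple_cons.
Qed.

HB.instance Definition _ := isMeasure.Build _ _ _ lebesgue_tuple_succ
  lebesgue_tuple_succ0 lebesgue_tuple_succ_ge0
  lebesgue_tuple_succ_sigma_additive.

Let lebesgue_tuple_succ_sigma_finite : sigma_finite setT lebesgue_tuple_succ.
Proof.
have /sigma_finiteP[F [FT ndF Foo]] := sigma_finiteT (@lebesgue_measure R).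
have /sigma_finiteP[G [GT ndG Goo]] := sigma_finiteT mu.
pose g (s : n.+1.-tuple T) : T * n.-tuple T := (thead s, [tuple of behead s]).
have mg : measurable_fun setT g.
  apply/measurable_fun_pairP; split; first exact: measurable_tnth.
  exact: measurable_behead.
have gK z : g (tuple_cons z) = z.
  by case: z => a s; rewrite /g theadE; congr pair; exact: val_inj.
have FGT : \bigcup_k (F k `*` G k) = setT.
  rewrite -subTset => -[a s] _.
  have [i _ Fia] : (\bigcup_k F k) a by rewrite -FT.
  have [j _ Gjs] : (\bigcup_k G k) s by rewrite -GT.
  exists (maxn i j) => //; split => /=.
  - by move: a Fia; exact/subsetPset/ndF/leq_maxl.
  - by move: s Gjs; exact/subsetPset/ndG/leq_maxr.
exists (fun k => g @^-1` (F k `*` G k)).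
  by rewrite -preimage_bigcup FGT preimage_setT.
move=> k; have [mFk Fkoo] := Foo k; have [mGk Gkoo] := Goo k; split.
  by rewrite -[X in measurable X]setTI; apply: mg => //; exact: measurableX.
rewrite /lebesgue_tuple_succ /pushforward -comp_preimage.
rewrite (_ : g \o _ = id) ?preimage_id; last exact/funext.
by rewrite product_measure1E// lte_mul_pinfty// ge0_fin_numE.
Qed.

HB.instance Definition _ := Measure_isSigmaFinite.Build _ _ _
  lebesgue_tuple_succ lebesgue_tuple_succ_sigma_finite.

End succ.

Fixpoint lebesgue_tuple n : {sigma_finite_measure set (n.-tuple T) -> \bar R} :=
  match n with
  | 0 => dirac [tuple]
  | n'.+1 => lebesgue_tuple_succ (lebesgue_tuple n')
  end.

End lebesgue_tuple.

Section euclidean.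
Variables (R : realType) (d : nat).
Implicit Types (Omega : set 'rV[R]_d) (x n : 'rV[R]_d).

(* Lnorm integrates over the whole space, hence the extension by 0 outside
   Omega; a tuple is identified with the row vector of its entries. *)
Definition Lp_norm Omega (p : R) (f : 'rV[R]_d -> R) : \bar R :=
  Lnorm (lebesgue_tuple R d) p%:E
    (fun s => ((f \_ Omega) (\row_i tnth s i))%:E).

Definition dot (v w : 'rV[R]_d) : R := \sum_i v 0 i * w 0 i.

Definition grad (f : 'rV[R]_d -> R) x : 'rV[R]_d :=
  \row_i derive f x (delta_mx 0 i).

Definition divergence (F : 'rV[R]_d -> 'rV[R]_d) x : R :=
  \sum_i derive (fun y => F y 0 i) x (delta_mx 0 i).

Definition laplacian (f : 'rV[R]_d -> R) : 'rV[R]_d -> R :=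
  divergence (grad f).

End euclidean.

Section smoothness.
Variables (R : realType) (V W : normedModType R).
Implicit Types (U A : set V) (f : V -> W).

(* Only meaningful for open U. *)
Fixpoint continuously_differentiable (k : nat) U f : Prop :=
  match k with
  | 0 => forall x, U x -> {for x, continuous f}
  | k'.+1 => (forall x, U x -> differentiable f x) /\
      forall v, continuously_differentiable k' U (fun x => derive f x v)
  end.

Definition smooth_open U f := forall k, continuously_differentiable k U f.

(* Smoothness on an arbitrary set, such as the closure of a domain, means
   smoothness on an open neighbourhood. Functions being total, f stands for
   its restriction to A together with a smooth extension. *)
Definition smooth_on A f :=
  exists U, [/\ open U, A `<=` U & smooth_open U f].

End smoothness.

Section domains.
Variables (R : realType) (d : nat).
Implicit Types (Omega : set 'rV[R]_d) (x n : 'rV[R]_d).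

Definition boundary Omega := closure Omega `\` Omega°.

(* Near x, Omega is the strict sublevel set {phi < 0} of a smooth function
   without critical points; grad phi then points out of Omega. *)
Definition local_defining_function Omega x (phi : 'rV[R]_d -> R) :=
  exists U : set 'rV[R]_d, [/\ open U, U x, smooth_open U phi,
    (forall y, U y -> grad phi y != 0) &
    Omega `&` U = [set y | U y /\ phi y < 0]].

(* Equivalently, the boundary is a smooth hypersurface with Omega locally on
   one side of it. *)
Definition smooth_boundary Omega :=
  forall x, boundary Omega x -> exists phi, local_defining_function Omega x phi.

(* For Omega open and x on its boundary, the value of n does not depend on
   phi. *)
Definition outward_unit_normal Omega x n :=
  exists2 phi, local_defining_function Omega x phi &
    n = (Num.sqrt (dot (grad phi x) (grad phi x)))^-1 *: grad phi x.

End domains.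

Section npns.
Variables (R : realType) (d : nat).

(* A space-time function has type 'rV[R]_d * R -> _; its slice at time t. *)
Definition at_time (T : Type) (f : 'rV[R]_d * R -> T) (t : R) : 'rV[R]_d -> T :=
  fun x => f (x, t).

Definition dt (f : 'rV[R]_d * R -> R) x t : R := derive1 (fun s => f (x, s)) t.

Definition space_time (Omega : set 'rV[R]_d) : set ('rV[R]_d * R) :=
  closure Omega `*` [set t | 0 <= t].

Definition nernst_planck (D z : R) (c Phi : 'rV[R]_d * R -> R)
    (u : 'rV[R]_d * R -> 'rV[R]_d) x t :=
  dt c x t + dot (u (x, t)) (grad (at_time c t) x) =
  D * divergence (fun y => grad (at_time c t) y
                           + (z * c (y, t)) *: grad (at_time Phi t) y) x.

Definition poisson (eps : R) (rho Phi : 'rV[R]_d * R -> R) x t :=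
  - (eps * laplacian (at_time Phi t) x) = rho (x, t).

Definition navier_stokes (nu kappa : R) (rho Phi : 'rV[R]_d * R -> R)
    (u : 'rV[R]_d * R -> 'rV[R]_d) (pr : 'rV[R]_d * R -> R) x t :=
  forall i : 'I_d,
    let ui := fun z => u z 0 i in
    dt ui x t + dot (u (x, t)) (grad (at_time ui t) x)
      - nu * laplacian (at_time ui t) x + grad (at_time pr t) x 0 i
    = - (kappa * rho (x, t) * grad (at_time Phi t) x 0 i).

Definition charge_density (c1 c2 : 'rV[R]_d * R -> R) : 'rV[R]_d * R -> R :=
  fun z => c1 z - c2 z.

(* The pressure is not part of the solution: some smooth pressure exists.
   W is used on the boundary only. *)
Record global_smooth_NPNS_solution (Omega : set 'rV[R]_d)
    (D1 D2 eps nu kappa : R) (W : 'rV[R]_d -> R)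
    (c1 c2 Phi : 'rV[R]_d * R -> R) (u : 'rV[R]_d * R -> 'rV[R]_d) : Prop := {
  c1_smooth : smooth_on (space_time Omega) c1;
  c2_smooth : smooth_on (space_time Omega) c2;
  Phi_smooth : smooth_on (space_time Omega) Phi;
  u_smooth : smooth_on (space_time Omega) u;
  c1_eq : forall x t, Omega x -> 0 < t -> nernst_planck D1 1 c1 Phi u x t;
  c2_eq : forall x t, Omega x -> 0 < t -> nernst_planck D2 (-1) c2 Phi u x t;
  Phi_eq : forall x t, Omega x -> 0 < t ->
    poisson eps (charge_density c1 c2) Phi x t;
  u_eq : exists2 pr : 'rV[R]_d * R -> R, smooth_on (space_time Omega) pr &
    forall x t, Omega x -> 0 < t ->
      navier_stokes nu kappa (charge_density c1 c2) Phi u pr x t;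
  u_div : forall x t, Omega x -> 0 < t -> divergence (at_time u t) x = 0;
  Phi_bc : forall x t, boundary Omega x -> 0 <= t -> Phi (x, t) = W x;
  u_bc : forall x t, boundary Omega x -> 0 <= t -> u (x, t) = 0
}.

Definition electroneutral_bc (Omega : set 'rV[R]_d)
    (c1 c2 : 'rV[R]_d * R -> R) : Prop :=
  forall x t, boundary Omega x -> 0 <= t ->
    c1 (x, t) = c2 (x, t) /\
    forall n, outward_unit_normal Omega x n ->
      dot n (grad (at_time (fun z => c1 z + c2 z) t) x) = 0.

(* Only the values of f0 on the closure of Omega matter. *)
Definition initial_value (Omega : set 'rV[R]_d) (T : Type)
    (f : 'rV[R]_d * R -> T) (f0 : 'rV[R]_d -> T) : Prop :=
  forall x, closure Omega x -> f (x, 0) = f0 x.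

End npns.

(* Main.v *)
Require Import Defs.
From HB Require Import structures.
From mathcomp Require Import all_boot all_order all_algebra.
From mathcomp Require Import all_classical all_reals all_analysis.
From mathcomp Require Import measurable_realfun.
From mathcomp Require Import ring lra.
Import Order.TTheory GRing.Theory Num.Theory.
Import numFieldNormedType.Exports.
Set Implicit Arguments.
Unset Strict Implicit.
Unset Printing Implicit Defensive.
Local Open Scope classical_set_scope.
Local Open Scope ring_scope.

(** The decay is a consequence of one family of entropy identities. For a
    C^2 function [F] of one variable put
    [E(t) = integral over Omega of F(c1)/D1 + F(c2)/D2].
    Multiplying the two concentration equations by [F'(c1)/D1] and
    [F'(c2)/D2] produces the divergence of a vector field whose normal
    component on the boundary is [F'(c1)] times the normal derivative of
    [c1 + c2]: there [c1 = c2], so that the terms with [grad Phi] cancel, and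
    [u = 0]. Hence this component vanishes, and by the Poisson equation
    [- E'(t)] is the integral of
    [F''(c1) |grad c1|^2 + F''(c2) |grad c2|^2
     + (G(c1) - G(c2)) (c1 - c2) / eps], where [G(s) = s F'(s) - F(s)]
    ([energy_dissipation], [entropy_law]).
    Neither [W] nor the pressure is left, and the parameter [eps] only
    multiplies a term that has a sign in the cases that matter.

    Three choices of [F] give the theorem. With [F(s) = s] nothing is
    dissipated and the mass [c1/D1 + c2/D2] is conserved ([mass_conserved]).
    With [F] the cube of the distance to [[0, M]] the entropy satisfies a
    linear differential inequality and vanishes initially, so that
    concentrations starting in [[0, M]] stay there ([concentration_bounds]).
    With [F(s) = (s - m)^2], [m] being determined by the mass, the coupling
    term is [(c1 + c2) (c1 - c2)^2 / eps >= 0], and the gradients control the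
    entropy: the entropy density is a combination of the squares of
    [c1/D1 + c2/D2 - m (1/D1 + 1/D2)], which has mean zero, and of
    [c1 - c2], which vanishes on the boundary, so the two Poincare
    inequalities apply ([poincare_spread]). This yields exponential decay of
    the L^2 norm of [c1 - c2], at a rate that depends on [Omega], [D1] and
    [D2] ([spread_decay]). Since [|c1 - c2| <= M], interpolation
    gives every L^p norm ([Lp_norm_bound]).

    The analytic tools rest on the invariance of Lebesgue measure under
    translations. Differentiating the translates of a function that vanishes
    near the boundary shows that its partial derivatives have integral zero;
    cut-off functions adapted to the defining functions of the boundary
    extend this to the divergence of any C^1 field tangent to the boundary
    ([integ_divergence_eq0]), without surface measure. The Poincare
    inequality for functions vanishing on the boundary follows by applying
    this to [f^2 x_0 e_0] ([poincare_dirichlet]). For functions of mean zero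
    ([poincare_mean]), the inequality holds on small balls by averaging
    differences [f(x + v) - f(x)], is carried to neighbourhoods of boundary
    points by translation along the normal, and is glued together by
    compactness and connectedness. *)

(** * Translation invariance of Lebesgue measure *)

Section translation.
Variable R : realType.
Notation T := (measurableTypeR R).

(** Uniqueness theorems and change of variables expect a measure structure,
    not only a set function. *)
Definition push_measure d d' (T1 : measurableType d) (T2 : measurableType d')
    (m : {measure set T1 -> \bar R}) (f : T1 -> T2)
    (mf : measurable_fun setT f) : {measure set T2 -> \bar R} :=
  measure_function_pushforward__canonical__measure_function_Measure m mf.

Lemma measurable_preimageT d d' (T1 : measurableType d) (T2 : measurableType d')
    (f : T1 -> T2) (A : set T2) :
  measurable_fun setT f -> measurable A -> measurable (f @^-1` A).
Proof. by move=> mf mA; rewrite -[X in measurable X]setTI; exact: mf. Qed.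

Lemma lebesgue_measure_translate (a : R) (A : set T) : measurable A ->
  lebesgue_measure ((fun x : T => x + a) @^-1` A) = lebesgue_measure A.
Proof.
move=> mA.
have mf : measurable_fun [set: T] (fun x : T => x + a : T).
  exact: measurable_funD.
pose nu : {measure set T -> \bar R} := push_measure (@lebesgue_measure R) mf.
apply/esym; apply: (@lebesgue_measure_unique R nu) => // _ [[x y] _ <-] /=.
rewrite /nu /=.
rewrite /pushforward /=.
rewrite (_ : _ @^-1` _ = `]x - a, y - a]%classic).
  rewrite !lebesgue_measure_itv /= !lte_fin ltrD2r.
  by case: ifP => // _; rewrite -!EFinD; congr EFin; lra.
by apply/seteqP; split => z /=; rewrite !in_itv /= lerBrDr ltrBlDr.
Qed.

Definition tuple_translate d (v : 'rV[R]_d) (s : d.-tuple T) : d.-tuple T :=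
  [tuple (tnth s i + v 0 i : R) | i < d].

Lemma measurable_tuple_translate d (v : 'rV[R]_d) :
  measurable_fun setT (tuple_translate v).
Proof.
apply/measurable_fun_tnthP => i.
rewrite (_ : _ \o _ = fun s => tnth s i + v 0 i); last first.
  by apply/funext => s /=; rewrite tnth_mktuple.
by apply: measurable_funD => //; exact: measurable_tnth.
Qed.

(** A translation acts separately on the first coordinate and on the others,
    so uniqueness of the product measure reduces the claim to dimension one. *)
Lemma lebesgue_tuple_translate d (v : 'rV[R]_d) (A : set (d.-tuple T)) :
  measurable A ->
  lebesgue_tuple R d (tuple_translate v @^-1` A) = lebesgue_tuple R d A.
Proof.
elim: d v A => [|d IH] v A mA.
  congr (lebesgue_tuple R 0 _); apply/seteqP.
  by split=> s /=; rewrite (tuple0 (tuple_translate v s)) (tuple0 s).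
rewrite /= /lebesgue_tuple_succ /pushforward.
pose w : 'rV[R]_d := \row_i v 0 (lift ord0 i).
pose f (z : T * d.-tuple T) : T * d.-tuple T :=
  (z.1 + v 0 ord0 : R, tuple_translate w z.2).
have mf : measurable_fun setT f.
  apply/measurable_fun_pairP; split.
    by apply: measurable_funD => //.
  exact: (measurableT_comp (measurable_tuple_translate w)).
rewrite (_ : tuple_cons (n:=d) @^-1` (tuple_translate v @^-1` A) =
             f @^-1` (tuple_cons (n:=d) @^-1` A)).
  apply/esym; apply: (@product_measure_unique _ _ _ _ R
    (@lebesgue_measure R) (lebesgue_tuple R d)
    (push_measure ((@lebesgue_measure R) \x lebesgue_tuple R d)%E mf)).
    move=> A1 A2 mA1 mA2; rewrite /= /pushforward.
    rewrite (_ : f @^-1` _ = ((fun x : T => x + v 0 ord0) @^-1` A1) `*`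
       (tuple_translate w @^-1` A2)) //.
    rewrite product_measure1E /=; first by rewrite lebesgue_measure_translate // IH.
      rewrite -[X in measurable X]setTI; exact: measurable_funD.
    rewrite -[X in measurable X]setTI; exact: measurable_tuple_translate.
  rewrite -[X in measurable X]setTI; exact: measurable_tuple_cons.
rewrite -[LHS]/((tuple_translate v \o tuple_cons (n:=d)) @^-1` A).
rewrite -[RHS]/((tuple_cons (n:=d) \o f) @^-1` A).
congr (_ @^-1` A); apply/funext => -[a s].
apply/eq_from_tnth => i /=; rewrite tnth_mktuple.
have [j ->|->] := unliftP ord0 i; last by rewrite !tnth0.
by rewrite !tnthS tnth_mktuple mxE.
Qed.

(** The measure lives on tuples, the calculus on row vectors. *)
Definition rV_of_tuple d (s : d.-tuple T) : 'rV[R]_d := \row_i tnth s i.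

Lemma preimage_rV_ball d (c : 'rV[R]_d) (r : R) : 0 < r ->
  @rV_of_tuple d @^-1` ball c r =
  \bigcap_(i in [set: 'I_d]) ((fun s => tnth s i) @^-1` (ball (c 0 i) r)).
Proof.
move=> r0; apply/seteqP; split => s /=.
  by move=> [_ H] i _; have := H 0 i; rewrite mxE.
by move=> H; split=> // i j; rewrite (ord1 i) !mxE; exact: H.
Qed.

Lemma measurable_rV_ball d (c : 'rV[R]_d) (r : R) :
  measurable (@rV_of_tuple d @^-1` ball c r).
Proof.
have [r0|r0] := ltP 0 r; last first.
  rewrite (_ : _ @^-1` _ = set0); first exact: measurable0.
  by rewrite -subset0 => s [] /=; rewrite ltNge r0.
rewrite preimage_rV_ball//; apply: fin_bigcap_measurable.
  exact: finite_finset.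
move=> i _; apply: measurable_preimageT (measurable_tnth i) _.
exact: measurable_ball.
Qed.

(** Balls with rational centres and radii 1/(n+1) form a countable base, and
    balls are products of intervals. *)
Lemma measurable_rV_open d (U : set 'rV[R]_d) : open U ->
  measurable (@rV_of_tuple d @^-1` U).
Proof.
move=> oU.
pose B (p : 'rV[rat]_d * nat) : set 'rV[R]_d :=
  ball (\row_i (ratr (p.1 0 i) : R)) (p.2.+1%:R^-1).
pose F k : set 'rV[R]_d := if unpickle k is Some p then
  (if `[< B p `<=` U >] then B p else set0) else set0.
have -> : U = \bigcup_k F k.
  apply/seteqP; split => [x Ux|x [k _]]; last first.
    rewrite /F; case: unpickle => // p; case: asboolP => // h; exact: h.
  have /nbhs_ballP[e /= e0 xeU] : nbhs x U by exact: open_nbhs_nbhs.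
  have [n ne] : exists n, (n.+1%:R^-1 : R) < e / 2.
    have [m _ /(_ _ (leqnn m)) hm] := near_infty_natSinv_lt (PosNum (divr_gt0 e0 (ltr0n _ 2))).
    by exists m.
  have n0 : 0 < n.+1%:R^-1 :> R by [].
  have H i : exists q : rat, ball (x 0 i) n.+1%:R^-1 (ratr q : R).
    have [|q] := @rat_in_itvoo R (x 0 i - n.+1%:R^-1) (x 0 i + n.+1%:R^-1).
      by rewrite ltrBlDr -addrA ltrDl addr_gt0.
    by move=> hq; exists q; rewrite ball_itv.
  have [q hq] := choice H.
  pose p : 'rV[rat]_d * nat := (\row_i q i, n).
  have xBp : ball x n.+1%:R^-1 (\row_i (ratr (p.1 0 i) : R)).
    by split=> // i j; rewrite (ord1 i) !mxE; exact: hq.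
  exists (pickle p) => //; rewrite /F pickleK; case: asboolP => [_|[]].
    exact: ball_sym.
  move=> y By; apply: xeU.
  have : ball x (n.+1%:R^-1 + n.+1%:R^-1) y by apply: ball_triangle xBp By.
  by apply: le_ball; rewrite [leRHS](splitr e) ltW // ltrD.
rewrite preimage_bigcup; apply: bigcupT_measurable => k.
rewrite /F; case: unpickle => [p|]; last by rewrite preimage_set0; exact: measurable0.
case: asboolP => _; first exact: measurable_rV_ball.
by rewrite preimage_set0; exact: measurable0.
Qed.

(** The norm of row vectors is the sup norm, so balls are cubes. *)
Lemma lebesgue_tuple_ball d (c : 'rV[R]_d) (r : R) : 0 < r ->
  lebesgue_tuple R d (@rV_of_tuple d @^-1` ball c r) = ((r *+ 2) ^+ d)%:E.
Proof.
move=> r0; elim: d c => [|d IH] c.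
  rewrite (_ : _ @^-1` _ = setT).
    by rewrite /= diracT expr0.
  by rewrite -subTset => s _; split=> // i [].
rewrite /= /lebesgue_tuple_succ /pushforward.
pose w : 'rV[R]_d := \row_i c 0 (lift ord0 i).
rewrite (_ : _ @^-1` _ = (ball (c 0 ord0) r) `*` (@rV_of_tuple d @^-1` ball w r)).
  rewrite product_measure1E; last 2 first.
  - exact: measurable_ball.
  - exact: measurable_rV_ball.
  by rewrite exprS EFinM IH; congr (_ * _)%E; exact: lebesgue_measure_ball (ltW r0).
apply/seteqP; split => -[a s] /=.
  move=> [_ H]; split.
    by have := H 0 ord0; rewrite mxE tnth0.
  by split=> // i j; have := H 0 (lift ord0 j); rewrite (ord1 i) !mxE tnthS.
move=> [Ha [_ Hs]]; split => // i j; rewrite (ord1 i) !mxE.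
have [k ->|->] := unliftP ord0 j; last by rewrite tnth0.
by have := Hs 0 k; rewrite !mxE tnthS.
Qed.

End translation.

(** * Integrals of bounded continuous functions *)

Section integral.
Variables (R : realType) (d : nat).
Implicit Types (A B : set 'rV[R]_d) (f g : 'rV[R]_d -> R) (x v : 'rV[R]_d).
Local Notation mu := (lebesgue_tuple R d).
Local Notation pre A := (@rV_of_tuple R d @^-1` A).

Definition integ A f : R := \int[mu]_(s in pre A) f (rV_of_tuple s).

Definition vol A : R := fine (mu (pre A)).

Definition bounded_open A := open A /\ exists r, A `<=` ball 0 r.

(** This class of functions is stable under all the operations needed below
    and, on bounded open sets, contained in the integrable functions, which
    keeps measurability out of the later arguments. *)
Definition integrand A f :=
  (forall x, A x -> {for x, continuous f}) /\
  exists M, forall x, A x -> `|f x| <= M.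

Lemma integrandS A B f : A `<=` B -> integrand B f -> integrand A f.
Proof.
move=> AB [cf [M fM]]; split; first by move=> x /AB /cf.
by exists M => x /AB /fM.
Qed.

Lemma integrand_cst A k : integrand A (fun=> k).
Proof. by split; [move=> x _; exact: cst_continuous|exists `|k|]. Qed.

Lemma integrandD A f g :
  integrand A f -> integrand A g -> integrand A (fun x => f x + g x).
Proof.
move=> [cf [M fM]] [cg [N gN]]; split.
  by move=> x Ax; apply: continuousD; [exact: cf|exact: cg].
exists (M + N) => x Ax; apply: le_trans (ler_normD _ _) _.
by rewrite lerD ?fM ?gN.
Qed.

Lemma integrandM A f g :
  integrand A f -> integrand A g -> integrand A (fun x => f x * g x).
Proof.
move=> [cf [M fM]] [cg [N gN]]; split.
  by move=> x Ax; apply: continuousM; [exact: cf|exact: cg].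
by exists (M * N) => x Ax; rewrite normrM ler_pM ?fM ?gN.
Qed.

Lemma integrandZ A k f : integrand A f -> integrand A (fun x => k * f x).
Proof. by apply: integrandM; exact: integrand_cst. Qed.

Lemma integrandN A f : integrand A f -> integrand A (fun x => - f x).
Proof.
move=> /(integrandZ (-1)); congr integrand; apply/funext => x.
by rewrite mulN1r.
Qed.

Lemma integrandB A f g :
  integrand A f -> integrand A g -> integrand A (fun x => f x - g x).
Proof. by move=> hf hg; apply: integrandD => //; exact: integrandN. Qed.

Lemma integrandX A f n : integrand A f -> integrand A (fun x => f x ^+ n).
Proof.
move=> hf; elim: n => [|n IH].
  rewrite (_ : (fun x => _) = fun=> 1); first exact: integrand_cst.
  by apply/funext => x; rewrite expr0.
rewrite (_ : (fun x => _) = fun x => f x * f x ^+ n); first exact: integrandM.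
by apply/funext => x; rewrite exprS.
Qed.

Lemma integrand_sum A n (F : 'I_n -> 'rV[R]_d -> R) :
  (forall i, integrand A (F i)) -> integrand A (fun x => \sum_i F i x).
Proof.
elim: n F => [|n IH] F hF.
  rewrite (_ : (fun x => _) = fun=> 0); first exact: integrand_cst.
  by apply/funext => x; rewrite big_ord0.
rewrite (_ : (fun x => _) = fun x => F ord0 x + \sum_i F (lift ord0 i) x).
  by apply: integrandD; [exact: hF|exact: IH].
by apply/funext => x; rewrite big_ord_recl.
Qed.

Lemma vol_ball x r : 0 < r -> vol (ball x r) = (r *+ 2) ^+ d.
Proof. by move=> r0; rewrite /vol lebesgue_tuple_ball. Qed.

Lemma bounded_open_finite A : bounded_open A -> (mu (pre A) < +oo)%E.
Proof.
move=> [oA [r Ar]]; apply: (@le_lt_trans _ _ (mu (pre (ball 0 (Num.max r 1))))).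
  apply: le_measure; rewrite ?inE; [exact: measurable_rV_open|exact: measurable_rV_ball|].
  by move=> s /Ar; apply: le_ball; rewrite le_max lexx.
by rewrite lebesgue_tuple_ball ?ltry // lt_max ltr01 orbT.
Qed.

Lemma integrand_measurable A f : open A ->
  (forall x, A x -> {for x, continuous f}) ->
  measurable_fun (pre A) (fun s => f (rV_of_tuple s)).
Proof.
move=> oA cf; apply: (measurability _ (RGenOInfty.measurableE R)).
move=> _ [_ [a ->] <-].
rewrite (_ : _ `&` _ = pre (A `&` f @^-1` `]a, +oo[)); last first.
  by apply/seteqP; split => s.
apply: measurable_rV_open; rewrite openE => x [Ax fx].
apply: filterI; first exact: open_nbhs_nbhs.
apply: (cf _ Ax); apply: open_nbhs_nbhs; split=> //.
Qed.

Lemma integrand_integrable A f : bounded_open A -> integrand A f ->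
  mu.-integrable (pre A) (EFin \o (fun s => f (rV_of_tuple s))).
Proof.
move=> bA [cf [M fM]]; apply: measurable_bounded_integrable.
- by apply: measurable_rV_open; case: bA.
- exact: bounded_open_finite.
- by apply: integrand_measurable => //; case: bA.
- exists M; split; first exact: num_real.
  by move=> y My s /= As; apply: le_trans (fM _ As) (ltW My).
Qed.

Let mpre A : bounded_open A -> measurable (pre A).
Proof. by move=> [oA _]; exact: measurable_rV_open. Qed.

Lemma eq_integ A f g : (forall x, A x -> f x = g x) -> integ A f = integ A g.
Proof.
by move=> fg; apply: eq_Rintegral => s; rewrite inE => /fg.
Qed.

Lemma integD A f g : bounded_open A -> integrand A f -> integrand A g ->
  integ A (fun x => f x + g x) = integ A f + integ A g.
Proof.
by move=> bA hf hg; apply: RintegralD; [exact: mpre|exact: integrand_integrable..].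
Qed.

Lemma integZ A k f : bounded_open A -> integrand A f ->
  integ A (fun x => k * f x) = k * integ A f.
Proof.
by move=> bA hf; apply: RintegralZl; [exact: mpre|exact: integrand_integrable].
Qed.

Lemma integN A f : bounded_open A -> integrand A f ->
  integ A (fun x => - f x) = - integ A f.
Proof.
move=> bA hf; rewrite -mulN1r -integZ //; apply: eq_integ => x _.
by rewrite mulN1r.
Qed.

Lemma integB A f g : bounded_open A -> integrand A f -> integrand A g ->
  integ A (fun x => f x - g x) = integ A f - integ A g.
Proof. by move=> bA hf hg; rewrite integD ?integN //; exact: integrandN. Qed.

Lemma integ_sum A n (F : 'I_n -> 'rV[R]_d -> R) : bounded_open A ->
  (forall i, integrand A (F i)) ->
  integ A (fun x => \sum_i F i x) = \sum_i integ A (F i).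
Proof.
move=> bA; elim: n F => [|n IH] F hF.
  rewrite big_ord0 -[RHS](mul0r (integ A (fun=> 0))) -integZ //.
    by apply: eq_integ => x _; rewrite big_ord0 mul0r.
  exact: integrand_cst.
rewrite big_ord_recl -IH // -integD //; last exact: integrand_sum.
by apply: eq_integ => x _; rewrite big_ord_recl.
Qed.

Lemma integ_cst A k : bounded_open A -> integ A (fun=> k) = k * vol A.
Proof. by move=> bA; apply: Rintegral_cst; exact: mpre. Qed.

Lemma integ_le A f g : bounded_open A -> integrand A f -> integrand A g ->
  (forall x, A x -> f x <= g x) -> integ A f <= integ A g.
Proof.
move=> bA hf hg fg; apply: le_Rintegral; [exact: mpre|exact: integrand_integrable..|].
by move=> s /fg.
Qed.

Lemma integ_ge0 A f : (forall x, A x -> 0 <= f x) -> 0 <= integ A f.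
Proof. by move=> f0; apply: Rintegral_ge0 => s /f0. Qed.

Lemma vol_ge0 A : 0 <= vol A.
Proof. by rewrite /vol fine_ge0. Qed.

Let integ_fin A f : bounded_open A -> integrand A f ->
  (\int[mu]_(s in pre A) (f (rV_of_tuple s))%:E)%E \is a fin_num.
Proof.
move=> bA hf; apply: integrable_fin_num; first exact: mpre.
exact: integrand_integrable.
Qed.

Lemma integE A f : bounded_open A -> integrand A f ->
  (integ A f)%:E = (\int[mu]_(s in pre A) (f (rV_of_tuple s))%:E)%E.
Proof. by move=> bA hf; rewrite /integ /Rintegral fineK // integ_fin. Qed.

Lemma integ_subset A B f : bounded_open A -> bounded_open B -> A `<=` B ->
  integrand B f -> (forall x, B x -> 0 <= f x) -> integ A f <= integ B f.
Proof.
move=> bA bB AB hf f0; rewrite -lee_fin !integE //; last exact: integrandS hf.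
apply: ge0_subset_integral; [exact: mpre|exact: mpre| |by move=> s /f0; rewrite lee_fin|].
  apply/measurable_EFinP; apply: integrand_measurable; first by case: bB.
  by case: hf.
by move=> s /AB.
Qed.

Lemma bounded_openU A B : bounded_open A -> bounded_open B ->
  bounded_open (A `|` B).
Proof.
move=> [oA [r Ar]] [oB [s Bs]]; split; first exact: openU.
exists (Num.max r s) => x [/Ar|/Bs]; apply: le_ball; rewrite le_max lexx ?orbT //.
Qed.

Lemma bounded_openI A B : bounded_open A -> open B -> bounded_open (A `&` B).
Proof.
move=> [oA [r Ar]] oB; split; first exact: openI.
by exists r => x [/Ar].
Qed.

Lemma open_ball x r : open (ball x r).
Proof.
have [r0|r0] := ltP 0 r; first exact: ball_open.
rewrite (_ : ball x r = set0); first exact: open0.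
by rewrite -subset0 => y [] /=; rewrite ltNge r0.
Qed.

Lemma bounded_open_ball x r : bounded_open (ball x r).
Proof.
split; first exact: open_ball.
exists (`|x| + r) => y; rewrite -!ball_normE /= sub0r normrN => xy.
by rewrite -(subrK x y) addrC (le_lt_trans (ler_normD _ _)) // ltrD2l distrC.
Qed.

Lemma integ_setU_le A B f : bounded_open A -> bounded_open B ->
  integrand (A `|` B) f -> (forall x, (A `|` B) x -> 0 <= f x) ->
  integ (A `|` B) f <= integ A f + integ B f.
Proof.
move=> bA bB hf f0; have hA : integrand A f by apply: integrandS hf => x; left.
have hB : integrand B f by apply: integrandS hf => x; right.
have bAB := bounded_openU bA bB.
have mA := mpre bA; have mB := mpre bB.
have mf : measurable_fun (pre (A `|` B)) (fun s => (f (rV_of_tuple s))%:E).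
  apply/measurable_EFinP; apply: integrand_measurable; first by case: bAB.
  by case: hf.
rewrite -lee_fin EFinD !integE //.
have E : pre (A `|` B) = pre A `|` (pre B `\` pre A).
  by rewrite setDE setUIr setUv setIT.
have f0' s : pre (A `|` B) s -> (0 <= (f (rV_of_tuple s))%:E)%E.
  by move=> /f0; rewrite lee_fin.
rewrite E in mf f0' *; rewrite ge0_integral_setU //; last 2 first.
- exact: measurableD.
- by rewrite disj_set2E; apply/eqP; rewrite setDE setIC -setIA setICl setI0.
rewrite leeD2l //; apply: ge0_subset_integral => //; first exact: measurableD.
- by apply: measurable_funS mf; [rewrite -E; exact: mpre|rewrite -E => s; right].
- by move=> s Bs; rewrite lee_fin f0 //; right.
Qed.

Lemma integ_vanish A B f : A `<=` B -> (forall x, B x -> ~ A x -> f x = 0) ->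
  integ B f = integ A f.
Proof.
move=> AB f0; rewrite /integ Rintegral_mkcond [RHS]Rintegral_mkcond.
have memE (C : set 'rV[R]_d) s : (s \in pre C) = `[< C (rV_of_tuple s) >].
  by apply/idP/asboolP; rewrite inE.
apply: eq_Rintegral => s _; rewrite !patchE !memE.
case: asboolP => Bs; case: asboolP => As //; first by rewrite f0.
by have := AB _ As.
Qed.

Lemma bounded_open_translate A v :
  bounded_open A -> bounded_open [set x | A (x + v)].
Proof.
move=> [oA [r Ar]]; split.
  apply: (open_comp _ oA) => x _; apply: continuousD => //.
  exact: cst_continuous.
exists (r + `|v|) => x /Ar; rewrite -!ball_normE /= !sub0r !normrN => h.
by rewrite -(addrK v x) (le_lt_trans (ler_normB _ _)) // ltrD2r.
Qed.

Lemma integrand_translate A v f : integrand A f ->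
  integrand [set x | A (x + v)] (fun x => f (x + v)).
Proof.
move=> [cf [M fM]]; split; last by exists M => x /fM.
move=> x Ax; apply: (@continuous_comp _ _ _ (fun x => x + v) f); last exact: cf.
by apply: continuousD => //; exact: cst_continuous.
Qed.

Lemma integ_translate A v f : bounded_open A -> integrand A f ->
  integ [set x | A (x + v)] (fun x => f (x + v)) = integ A f.
Proof.
move=> bA hf; congr fine.
pose A' := [set x | A (x + v)].
have rVD s : rV_of_tuple (tuple_translate v s) = rV_of_tuple s + v.
  by apply/rowP => i; rewrite !mxE tnth_mktuple.
have mA := mpre bA.
have mtau := measurable_tuple_translate v.
pose g s := (f (rV_of_tuple s))%:E.
have mg : measurable_fun (pre A) g by have /integrableP[] := integrand_integrable bA hf.
have Ig := (integrable_mkcond g mA).1 (integrand_integrable bA hf).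
have mG : measurable_fun setT (g \_ (pre A)) by apply/(measurable_restrictT _ mA).
have memE (C : set 'rV[R]_d) s : (s \in pre C) = `[< C (rV_of_tuple s) >].
  by apply/idP/asboolP; rewrite inE.
have E : (fun s => (f (rV_of_tuple s + v))%:E) \_ (pre A') =
         (g \_ (pre A)) \o tuple_translate v.
  by apply/funext => s; rewrite /= !patchE !memE /g rVD.
have IG : mu.-integrable setT ((g \_ (pre A)) \o tuple_translate v).
  rewrite -E; apply/(integrable_mkcond _ (mpre (bounded_open_translate v bA))).
  exact: integrand_integrable (bounded_open_translate v bA)
                              (integrand_translate v hf).
rewrite [LHS]integral_mkcond [RHS]integral_mkcond E.
transitivity (\int[push_measure mu mtau]_x (g \_ (pre A)) x)%E.
  by rewrite /= integral_pushforward ?preimage_setT.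
apply: eq_measure_integral => B mB _.
by rewrite /= /pushforward lebesgue_tuple_translate.
Qed.

(** A positive value persists on a ball, and balls have positive volume. *)
Lemma integ_eq0 A f : bounded_open A -> integrand A f ->
  (forall x, A x -> 0 <= f x) -> integ A f <= 0 -> forall x, A x -> f x = 0.
Proof.
move=> bA hf f0 I0 x Ax; apply/eqP; rewrite eq_le f0 // andbT leNgt.
apply/negP => fx.
have : nbhs x (A `&` f @^-1` `](f x / 2), +oo[).
  apply: filterI; first by apply: open_nbhs_nbhs; split=> //; case: bA.
  apply: (hf.1 _ Ax); apply: open_nbhs_nbhs; split; first exact: interval_open.
  by rewrite /= in_itv /= andbT ltr_pdivrMr // mulr2n mulrDr mulr1 ltrDl.
move=> /nbhs_ballP [r /= r0 xr].
have bB := bounded_open_ball x r.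
have BA : ball x r `<=` A by move=> y /xr [].
have : integ (ball x r) (fun=> f x / 2) <= integ A f.
  apply: le_trans (integ_subset bB bA BA hf f0).
  apply: integ_le => //; [exact: integrand_cst|exact: integrandS hf|].
  by move=> y /xr [_ /=]; rewrite in_itv /= andbT => /ltW.
rewrite integ_cst // vol_ball // => /le_trans -/(_ _ I0).
by rewrite leNgt mulr_gt0 // ?divr_gt0 // exprn_gt0 // pmulrn_rgt0.
Qed.

Lemma vol_gt0 A : bounded_open A -> A !=set0 -> 0 < vol A.
Proof.
move=> bA [x Ax]; rewrite lt_neqAle vol_ge0 andbT; apply/eqP => v0.
have := @integ_eq0 A (fun=> 1) bA (integrand_cst _ _) (fun _ _ => ler01).
rewrite integ_cst // -v0 mulr0 => /(_ (lexx _) x Ax) /eqP.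
by rewrite oner_eq0.
Qed.

Lemma integ_dominated A (F : nat -> 'rV[R]_d -> R) f M : bounded_open A ->
  (forall n, integrand A (F n)) -> integrand A f ->
  (forall n x, A x -> `|F n x| <= M) ->
  (forall x, A x -> F n x @[n --> \oo] --> f x) ->
  integ A (F n) @[n --> \oo] --> integ A f.
Proof.
move=> bA hF hf FM Ff; rewrite /integ /Rintegral; apply: fine_cvg.
rewrite fineK ?integ_fin //.
apply: (@dominated_cvg _ _ _ mu _ (mpre bA) (fun n s => (F n (rV_of_tuple s))%:E)
  _ (fun=> M%:E)).
- by move=> n; apply/measurable_EFinP; apply: integrand_measurable; [case: bA|case: (hF n)].
- by move=> s As; apply: cvg_EFin; [exact: nearW|exact: Ff].
- by [].
- exact: (integrand_integrable bA (integrand_cst A M)).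
- by move=> n s As; rewrite lee_fin FM.
Qed.

Lemma integ_is_derive A (F dF : R -> 'rV[R]_d -> R) (a u b M : R) :
  bounded_open A -> u < a < b ->
  (forall t, u < t < b -> integrand A (F t)) ->
  (forall t x, u < t < b -> A x -> is_derive t 1 (fun s => F s x) (dF t x)) ->
  (forall t x, u < t < b -> A x -> `|dF t x| <= M) ->
  is_derive a 1 (fun t => integ A (F t)) (integ A (dF a)).
Proof.
move=> bA auv hF dFE dM.
have Ia : `]u, b[%classic a by rewrite /= in_itv.
have intF t : `]u, b[%classic t -> mu.-integrable (pre A)
    (EFin \o (fun s => F t (rV_of_tuple s))).
  by rewrite /= in_itv /= => ht; apply: integrand_integrable => //; exact: hF.
have derF t s : `]u, b[%classic t -> pre A s ->
    derivable (fun t => F t (rV_of_tuple s)) t 1.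
  by rewrite /= in_itv /= => ht As; case: (dFE _ _ ht As).
have dE t s : `]u, b[%classic t -> pre A s ->
    partial1of2 (fun t s => F t (rV_of_tuple s)) t s = dF t (rV_of_tuple s).
  rewrite /= in_itv /= partial1of2E => ht As.
  by case: (dFE _ _ ht As).
have M0 (s : d.-tuple (measurableTypeR R)) : 0 <= (fun=> `|M|) s :> R by [].
have iM := integrand_integrable bA (integrand_cst A `|M|).
have GM t s : `]u, b[%classic t -> pre A s ->
    `|partial1of2 (fun t s => F t (rV_of_tuple s)) t s| <= (fun=> `|M|) s.
  move=> ht As; rewrite dE //; apply: le_trans (ler_norm _).
  by apply: dM => //; move: ht; rewrite /= in_itv.
split.
  exact: (@derivable_under_integral _ _ _ mu _ _ (mpre bA) _ _ _ Ia intF derF _ M0 iM GM).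
rewrite -derive1E /integ.
rewrite (@differentiation_under_integral _ _ _ mu _ _ (mpre bA) _ _ _ Ia intF derF _ M0 iM GM).
by apply: eq_Rintegral => s; rewrite inE => As; rewrite dE.
Qed.

End integral.

(** * Continuously differentiable functions *)

Section C1.
Variables (R : realType) (V : normedModType R).
Implicit Types (U : set V) (f g : V -> R) (x v : V) (h : R -> R).

(** One unfolding of [continuously_differentiable]. *)
Definition C1 U f := (forall x, U x -> differentiable f x) /\
  forall v x, U x -> {for x, continuous (fun y => 'D_v f y)}.

Lemma C1_continuous U f x : C1 U f -> U x -> {for x, continuous f}.
Proof. by move=> [df _] Ux; apply: differentiable_continuous; exact: df. Qed.

Lemma C1S U U' f : U `<=` U' -> C1 U' f -> C1 U f.
Proof.
by move=> UU [df cf]; split; [move=> x /UU /df|move=> v x /UU; exact: cf].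
Qed.

Lemma differentiable_near_eq f g x : (\forall y \near x, f y = g y) ->
  differentiable f x -> differentiable g x.
Proof.
move=> fg /diff_locallyP[cdf /eqaddoP fE].
have gE : g \o shift x = cst (g x) + 'd f x +o_ (0 : V) id.
  apply/eqaddoP => e e0; have {}fE := fE _ e0.
  have fg0 : \forall h \near (0 : V), f (h + x) = g (h + x).
    have hx : (fun h : V => h + x) @ (0 : V) --> 0 + x.
      by apply: cvgD => //; exact: cvg_cst.
    by rewrite add0r in hx; exact: (hx (fun y => f y = g y) fg).
  have fgx : f x = g x := nbhs_singleton fg.
  apply: filterS2 fE fg0 => h /= + fgh.
  by rewrite /GRing.add /= /GRing.add /= fgx fgh.
by apply/diff_locallyP; rewrite (diff_unique cdf gE).
Qed.

Lemma continuous_near_eq f g x : (\forall y \near x, f y = g y) ->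
  {for x, continuous f} -> {for x, continuous g}.
Proof.
move=> fg cf; rewrite /prop_for /continuous_at -(nbhs_singleton fg).
by apply: cvg_trans cf; apply: near_eq_cvg.
Qed.

Lemma continuous_openeq U f g x : open U -> U x -> (forall y, U y -> f y = g y) ->
  {for x, continuous f} -> {for x, continuous g}.
Proof.
move=> oU Ux fg; apply: continuous_near_eq.
by apply: filterS (open_nbhs_nbhs (conj oU Ux)) => y /fg.
Qed.

(** Only local values matter; this lets a field be modified off [U]. *)
Lemma C1_near_eq U f g : (forall x, U x -> \forall y \near x, f y = g y) ->
  C1 U f -> C1 U g.
Proof.
move=> fg [df cf]; split.
  by move=> x Ux; apply: differentiable_near_eq (fg _ Ux) (df _ Ux).
move=> v x Ux; apply: continuous_near_eq (cf v x Ux).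
have : \forall y \near x, \forall z \near y, f z = g z.
  exact: (nbhs_interior (fg _ Ux)).
by apply: filterS => y; exact: near_eq_derive.
Qed.

Lemma C1_cst U k : C1 U (fun=> k).
Proof.
split=> [x _|v x _]; first exact: differentiable_cst.
apply: (continuous_openeq openT I (f := fun=> 0)); last exact: cst_continuous.
by move=> y _; rewrite (derive_cst k).
Qed.

(** The rules with suffix _fun are about functions given by their values, the
    form in which they occur under integrals. *)
Lemma deriveD_fun f g x v : differentiable f x -> differentiable g x ->
  'D_v (fun y => f y + g y) x = 'D_v f x + 'D_v g x.
Proof. by move=> df dg; apply: deriveD; exact: diff_derivable. Qed.

Lemma deriveM_fun f g x v : differentiable f x -> differentiable g x ->
  'D_v (fun y => f y * g y) x = f x * 'D_v g x + g x * 'D_v f x.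
Proof. by move=> df dg; apply: deriveM; exact: diff_derivable. Qed.

Lemma differentiableD_fun f g x : differentiable f x -> differentiable g x ->
  differentiable (fun y => f y + g y) x.
Proof. exact: differentiableD. Qed.

Lemma differentiableM_fun f g x : differentiable f x -> differentiable g x ->
  differentiable (fun y => f y * g y) x.
Proof. exact: differentiableM. Qed.

Lemma differentiableZ_fun f (k : R) x : differentiable f x ->
  differentiable (fun y => k * f y) x.
Proof. exact: (@differentiableZ _ _ _ f). Qed.

Lemma derive_cst_fun (k : R) x v : 'D_v (fun _ : V => k) x = 0.
Proof. exact: derive_cst. Qed.

Lemma deriveZ_fun f k x v : differentiable f x ->
  'D_v (fun y => k * f y) x = k * 'D_v f x.
Proof. by move=> df; apply: (@deriveZ _ _ _ f); exact: diff_derivable. Qed.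

Lemma derive_comp_fun f h (dh : R) x v : differentiable f x ->
  is_derive (f x) 1 h dh -> 'D_v (fun y => h (f y)) x = dh * 'D_v f x.
Proof.
move=> df [dh1 <-]; have dh' : differentiable h (f x) by exact/derivable1_diffP.
rewrite (deriveE _ (differentiable_comp df dh')) (diff_comp df dh') /=.
by rewrite [in RHS](deriveE _ df) (diff1E dh') /= derive1E; exact: mulrC.
Qed.

Lemma C1D U f g : open U -> C1 U f -> C1 U g -> C1 U (fun x => f x + g x).
Proof.
move=> oU [df cf] [dg cg]; split=> [x Ux|v x Ux].
  by apply: differentiableD; [exact: df|exact: dg].
apply: (continuous_openeq oU Ux (f := fun y => 'D_v f y + 'D_v g y)).
  by move=> y Uy; rewrite deriveD_fun //; [exact: df|exact: dg].
by apply: continuousD; [exact: cf|exact: cg].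
Qed.

Lemma C1M U f g : open U -> C1 U f -> C1 U g -> C1 U (fun x => f x * g x).
Proof.
move=> oU hf hg; have [df cf] := hf; have [dg cg] := hg.
split=> [x Ux|v x Ux].
  by apply: differentiableM; [exact: df|exact: dg].
apply: (continuous_openeq oU Ux (f := fun y => f y * 'D_v g y + g y * 'D_v f y)).
  by move=> y Uy; rewrite deriveM_fun //; [exact: df|exact: dg].
by apply: continuousD; apply: continuousM;
  [exact: C1_continuous hf Ux|exact: cg|exact: C1_continuous hg Ux|exact: cf].
Qed.

Lemma C1Z U k f : open U -> C1 U f -> C1 U (fun x => k * f x).
Proof. by move=> oU; apply: C1M => //; exact: C1_cst. Qed.

Lemma C1N U f : open U -> C1 U f -> C1 U (fun x => - f x).
Proof.
move=> oU /(C1Z (-1) oU); congr C1; apply/funext => x; exact: mulN1r.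
Qed.

Lemma C1B U f g : open U -> C1 U f -> C1 U g -> C1 U (fun x => f x - g x).
Proof. by move=> oU hf hg; exact: (C1D oU hf (C1N oU hg)). Qed.

Lemma C1_sum U n (F : 'I_n -> V -> R) : open U -> (forall i, C1 U (F i)) ->
  C1 U (fun x => \sum_i F i x).
Proof.
move=> oU; elim: n F => [|n IH] F hF.
  rewrite (_ : (fun x => _) = fun=> 0); first exact: C1_cst.
  by apply/funext => x; rewrite big_ord0.
rewrite (_ : (fun x => _) = fun x => F ord0 x + \sum_i F (lift ord0 i) x).
  by apply: (C1D oU (hF ord0)); exact: IH.
by apply/funext => x; rewrite big_ord_recl.
Qed.

Lemma continuous_sum_fun n (F : 'I_n -> V -> R) x :
  (forall i, {for x, continuous (F i)}) ->
  {for x, continuous (fun y => \sum_i F i y)}.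
Proof.
elim: n F => [|n IH] F cF.
  rewrite (_ : (fun x => _) = fun=> 0); first exact: cst_continuous.
  by apply/funext => y; rewrite big_ord0.
rewrite (_ : (fun x => _) = fun x => F ord0 x + \sum_i F (lift ord0 i) x).
  by apply: continuousD; [exact: cF|exact: IH].
by apply/funext => y; rewrite big_ord_recl.
Qed.

Lemma C1_comp U f h (h' : R -> R) : open U -> C1 U f ->
  (forall s : R, is_derive s 1 h (h' s)) -> continuous h' ->
  C1 U (fun x => h (f x)).
Proof.
move=> oU hf dh ch; have [df cf] := hf; split=> [x Ux|v x Ux].
  apply: differentiable_comp; first exact: df.
  by apply/derivable1_diffP; case: (dh (f x)).
apply: (continuous_openeq oU Ux (f := fun y => h' (f y) * 'D_v f y)).
  by move=> y Uy; rewrite (derive_comp_fun _ (df _ Uy) (dh _)).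
apply: continuousM; last exact: cf.
by apply: continuous_comp; [exact: C1_continuous hf Ux|exact: ch].
Qed.

Lemma is_derive_line f x v (s : R) : differentiable f (x + s *: v) ->
  is_derive s 1 (fun t => f (x + t *: v)) ('D_v f (x + s *: v)).
Proof.
move=> df.
have dl : differentiable (fun t : R => x + t *: v) s.
  apply: differentiableD => //; exact: differentiableZl.
have dc := differentiable_comp dl df.
split; first exact: diff_derivable.
rewrite (deriveE _ dc) diff_comp //= (deriveE _ df); congr ('d f _ _).
rewrite -deriveE // (_ : (fun t : R => _) = cst x + (fun t : R => t *: v)) //.
rewrite deriveD //; last by apply: diff_derivable; exact: differentiableZl.
rewrite derive_cst add0r deriveE; last exact: differentiableZl.
rewrite (_ : 'd _ s = (fun t => t *: v) :> (R -> V)) ?scale1r //.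
by have [] := is_diff_scalel s v.
Qed.

Lemma line_increase f x v (k s1 : R) : 0 <= s1 ->
  (forall s, 0 <= s <= s1 -> differentiable f (x + s *: v)) ->
  (forall s, 0 <= s <= s1 -> k <= 'D_v f (x + s *: v)) ->
  k * s1 <= f (x + s1 *: v) - f x.
Proof.
rewrite le_eqVlt => /predU1P[<-|s0] df kf.
  by rewrite mulr0 scale0r addr0 subrr.
have [||c] := @MVT R (fun t => f (x + t *: v)) (fun t => 'D_v f (x + t *: v)) _ _ s0.
- move=> s; rewrite in_itv /= => /andP[a b]; apply: is_derive_line.
  by apply: df; rewrite !ltW.
- apply: derivable_within_continuous => s; rewrite in_itv /= => hs.
  by have [] := is_derive_line (df _ hs).
rewrite in_itv /= subr0 scale0r addr0 => /andP[a b] ->.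
by apply: ler_wpM2r; [exact: ltW|apply: kf; rewrite !ltW].
Qed.

Lemma compact_bounded_fun (K : set V) f : compact K ->
  (forall x, K x -> {for x, continuous f}) -> exists M, forall x, K x -> `|f x| <= M.
Proof.
move=> cK cf.
have cfK : {within K, continuous f}.
  by apply: continuous_in_subspaceT => x; rewrite inE => /cf.
have [M [_ hM]] := compact_bounded (continuous_compact cfK cK).
by exists (M + 1) => x Kx; apply: (hM (M + 1)); [rewrite ltrDl|exists x].
Qed.

End C1.

(** * Truncated powers and a step function *)

Section real_functions.
Variable R : realType.
Implicit Types (s t h : R).

(** For piecewise polynomials of class C^1 the quadratic bound on the
    remainder is checked piece by piece, and derivatives at the nodes need no
    separate treatment. *)
Lemma is_derive_quadratic (f : R -> R) s (l C : R) :
  (forall h, `|f (h + s) - f s - h * l| <= C * h ^+ 2) -> is_derive s 1 f l.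
Proof.
move=> H.
have C0 : 0 <= C by have := H 1; rewrite expr1n mulr1; apply: le_trans.
have cv : (fun h => h^-1 *: ((f \o shift s) (h *: (1 : R)) - f s)) @ 0^' --> l.
  apply/cvgrPdist_le => e e0; near=> h.
  have h0 : h != 0 by near: h; exact: nbhs_dnbhs_neq.
  have hn : 0 < `|h| by rewrite normr_gt0.
  have he : `|h| <= e / (C + 1).
    by near: h; apply: dnbhs0_le; rewrite divr_gt0 // ltr_wpDl.
  rewrite distrC -(ler_pM2l hn) -normrM mulrBr /=.
  rewrite (_ : h *: 1 = h); last exact: mulr1.
  rewrite (_ : h * (h^-1 *: _) = f (h + s) - f s); last first.
    by rewrite /GRing.scale /= mulrA mulfV // mul1r.
  apply: le_trans (H h) _.
  rewrite -(real_normK (num_real h)) expr2 mulrCA ler_pM2l //.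
  rewrite ler_pdivlMr in he; last by rewrite ltr_wpDl.
  by apply: le_trans he; rewrite mulrC ler_pM2l // lerDl.
split; first by apply/cvg_ex; exists l.
by apply: cvg_lim.
Unshelve. all: by end_near. Qed.

Definition pospart s : R := Num.max s 0.

Lemma pospart_ge0 s : 0 <= pospart s. Proof. by rewrite le_max lexx orbT. Qed.

Lemma pospart_cases s : (0 <= s /\ pospart s = s) \/ (s <= 0 /\ pospart s = 0).
Proof. by rewrite /pospart; case: (leP 0 s) => h; [left|right; split=> //; exact: ltW]. Qed.

Lemma continuous_pos : continuous pospart.
Proof. by move=> s; apply: continuous_max; [exact: cvg_id|exact: cst_continuous]. Qed.

Lemma is_derive_pos2 a s :
  is_derive s 1 (fun t => pospart (t - a) ^+ 2) (2 * pospart (s - a)).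
Proof.
apply: (@is_derive_quadratic _ _ _ 1) => h; rewrite -(addrA h s) ler_norml.
by apply/andP; split;
  case: (pospart_cases (s - a)) => -[u ->]; case: (pospart_cases (h + (s - a))) => -[b ->]; nra.
Qed.

Lemma is_derive_pos3 a s :
  is_derive s 1 (fun t => pospart (t - a) ^+ 3) (3 * pospart (s - a) ^+ 2).
Proof.
rewrite (_ : (fun t => _) = (id - cst a : R -> R) * (fun t => pospart (t - a) ^+ 2)).
  have := is_deriveM (is_deriveB (is_derive_id s (1 : R)) (is_derive_cst a s 1))
    (is_derive_pos2 a s).
  move/is_derive_eq; apply; rewrite /= /GRing.scale /=.
  rewrite [X in X * _](_ : _ = s - a) //.
  by case: (pospart_cases (s - a)) => -[u ->]; ring.
apply/funext => t; rewrite /GRing.mul /= [X in X * _](_ : _ = t - a) //.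
by case: (pospart_cases (t - a)) => -[u ->]; ring.
Qed.

(** A C^1 step from 0 on [s <= 1] to 1 on [2 <= s]; its derivative is a hat. *)
Definition step s : R :=
  2 * pospart (s - 1) ^+ 2 - 4 * pospart (s - 3 / 2) ^+ 2 + 2 * pospart (s - 2) ^+ 2.

Definition dstep s : R :=
  4 * pospart (s - 1) - 8 * pospart (s - 3 / 2) + 4 * pospart (s - 2).

Lemma is_derive_step s : is_derive s 1 step (dstep s).
Proof.
have H := is_deriveD (is_deriveB (is_deriveZ 2 (is_derive_pos2 1 s))
  (is_deriveZ 4 (is_derive_pos2 (3 / 2) s))) (is_deriveZ 2 (is_derive_pos2 2 s)).
apply: (is_derive_eq H); rewrite /dstep /GRing.scale /=; ring.
Qed.

Lemma continuous_pos_shift a : continuous (fun t => pospart (t - a)).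
Proof.
move=> s; apply: (@continuous_comp _ _ _ (fun t => t - a) pospart).
  by apply: continuousB; [exact: cvg_id|exact: cst_continuous].
exact: continuous_pos.
Qed.

Lemma continuous_dstep : continuous dstep.
Proof.
move=> s; have H (a k : R) : {for s, continuous (fun t => k * pospart (t - a))}.
  by apply: continuousM; [exact: cst_continuous|exact: continuous_pos_shift].
exact: (continuousD (continuousB (H 1 4) (H (3 / 2) 8)) (H 2 4)).
Qed.

Lemma step_le1 s : s <= 1 -> step s = 0.
Proof.
move=> s1; rewrite /step; case: (pospart_cases (s - 1)) => -[a ->];
case: (pospart_cases (s - 3/2)) => -[b ->]; case: (pospart_cases (s - 2)) => -[c ->]; nra.
Qed.

Lemma step_ge2 s : 2 <= s -> step s = 1.
Proof.
move=> s1; rewrite /step; case: (pospart_cases (s - 1)) => -[a ->];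
case: (pospart_cases (s - 3/2)) => -[b ->]; case: (pospart_cases (s - 2)) => -[c ->]; nra.
Qed.

Lemma step_01 s : 0 <= step s <= 1.
Proof.
rewrite /step; apply/andP; case: (pospart_cases (s - 1)) => -[a ->];
case: (pospart_cases (s - 3/2)) => -[b ->]; case: (pospart_cases (s - 2)) => -[c ->]; split; nra.
Qed.

Lemma dstep_le2 s : `|dstep s| <= 2.
Proof.
rewrite /dstep ler_norml; apply/andP; case: (pospart_cases (s - 1)) => -[a ->];
case: (pospart_cases (s - 3/2)) => -[b ->]; case: (pospart_cases (s - 2)) => -[c ->]; split; nra.
Qed.

Lemma dstep_ge2 s : 2 <= s -> dstep s = 0.
Proof.
move=> s1; rewrite /dstep; case: (pospart_cases (s - 1)) => -[a ->];
case: (pospart_cases (s - 3/2)) => -[b ->]; case: (pospart_cases (s - 2)) => -[c ->]; lra.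
Qed.

End real_functions.

(** * Calculus on row vectors *)

Lemma continuous_translate (R : realType) (V : normedModType R) (v : V) :
  continuous (fun x => x + v).
Proof.
move=> x; have H : (fun y : V => y + v) @ x --> x + v.
  by apply: cvgD => //; exact: cvg_cst.
exact: H.
Qed.

Section rV_calculus.
Variables (R : realType) (d : nat).
Implicit Types (x v y : 'rV[R]_d) (f g : 'rV[R]_d -> R) (U Omega : set 'rV[R]_d).

Lemma coord_le_norm x i : `|x 0 i| <= `|x|.
Proof.
rewrite -[leRHS]/(mx_norm x) mx_normrE.
exact: (le_bigmax _ (fun ij => `|x ij.1 ij.2|) (0, i)).
Qed.

Lemma norm_le_coord x r : 0 <= r -> (forall i, `|x 0 i| <= r) -> `|x| <= r.
Proof.
move=> r0 H; rewrite -[leLHS]/(mx_norm x) mx_normrE; apply/bigmax_leP; split=> //.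
by move=> [i j] _ /=; rewrite (ord1 i).
Qed.

Lemma bounded_open_compact Omega : bounded_open Omega -> compact (closure Omega).
Proof.
move=> [_ [r Or]]; apply: bounded_closed_compact; last exact: closed_closure.
exists `|r|; split; first exact: num_real.
move=> M rM x Ox /=.
have cl : closed [set y : 'rV[R]_d | `|y| <= M].
  by apply: closed_comp (@closed_le R M) => y _; exact: norm_continuous.
suff : closure [set y : 'rV[R]_d | `|y| <= M] x by rewrite -(closure_id _).1.
apply: closure_subset Ox => y /Or; rewrite -ball_normE /= sub0r normrN => h.
by apply: ltW; apply: lt_trans h (le_lt_trans (ler_norm _) rM).
Qed.

Lemma dotC v y : dot v y = dot y v.
Proof. by apply: eq_bigr => i _; rewrite mulrC. Qed.

Lemma dotDl v y z : dot (v + y) z = dot v z + dot y z.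
Proof. by rewrite -big_split /=; apply: eq_bigr => i _; rewrite mxE mulrDl. Qed.

Lemma dotZl k v y : dot (k *: v) y = k * dot v y.
Proof. by rewrite mulr_sumr; apply: eq_bigr => i _; rewrite mxE mulrA. Qed.

Lemma dot_ge0 v : 0 <= dot v v.
Proof. by apply: sumr_ge0 => i _; rewrite -expr2 sqr_ge0. Qed.

Lemma dot_gt0 v : v != 0 -> 0 < dot v v.
Proof.
move=> v0; rewrite lt_neqAle dot_ge0 andbT eq_sym; apply: contra v0.
rewrite psumr_eq0; last by move=> i _; rewrite -expr2 sqr_ge0.
move=> /allP H; apply/eqP/rowP => i; rewrite mxE.
have := H i (mem_index_enum i); rewrite -expr2 sqrf_eq0 => /eqP //.
Qed.

Lemma deriveE_dot f x v : differentiable f x -> 'D_v f x = dot (grad f x) v.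
Proof.
move=> df; rewrite (deriveE _ df) {1}(row_sum_delta v) linear_sum.
by apply: eq_bigr => i _; rewrite linearZ mxE (deriveE _ df) [RHS]mulrC.
Qed.

Lemma gradE f x i : grad f x 0 i = 'D_(delta_mx 0 i) f x.
Proof. by rewrite mxE. Qed.

Lemma derive_coord x i v : 'D_v (fun x : 'rV[R]_d => x 0 i) x = v 0 i.
Proof.
have lin : linear (fun y : 'rV[R]_d => y 0 i : R).
  by move=> k y z; rewrite !mxE.
pose L := GRing.isLinear.Build R 'rV[R]_d R *:%R _ lin.
pose f : {linear 'rV[R]_d -> R} := HB.pack (fun y : 'rV[R]_d => y 0 i : R) L.
rewrite (deriveE _ (differentiable_coord x 0 i)).
have -> : 'd (fun y : 'rV[R]_d => y 0 i) x = f :> (_ -> _).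
  by apply: (@diff_lin _ _ _ f) => y; exact: coord_continuous.
by [].
Qed.

Lemma C1_coord U i : C1 U (fun x : 'rV[R]_d => x 0 i).
Proof.
split=> [x _|v x _]; first exact: differentiable_coord.
apply: (continuous_openeq openT I (f := fun=> v 0 i)); last exact: cst_continuous.
by move=> y _; rewrite derive_coord.
Qed.

Lemma C1_at_outside U f : (forall x, ~ U x -> \forall y \near x, f y = 0) ->
  C1 U f -> C1 setT f.
Proof.
move=> f0 [df cf].
have H : C1 (~` U) f.
  apply: (@C1_near_eq _ _ _ (fun=> 0)); last exact: C1_cst.
  by move=> x /f0; apply: filterS => y ->.
split=> [x _|v x _]; have [Ux|Ux] := pselect (U x);
  by [exact: df|exact: H.1|exact: cf|exact: H.2].
Qed.

Lemma C1_integrand U A f : open U -> compact (closure A) -> closure A `<=` U ->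
  (forall x, U x -> {for x, continuous f}) -> integrand A f.
Proof.
move=> oU cA AU cf; split; first by move=> x /subset_closure /AU /cf.
have [x /AU /cf //|M hM] := @compact_bounded_fun _ _ (closure A) f cA.
by exists M => x /subset_closure /hM.
Qed.

(** The integral of [f (x + t v)] does not depend on [t]; its derivative at
    [t = 0] is the integral of the derivative along [v]. *)
Lemma integ_derive_supported Omega f v : bounded_open Omega -> C1 Omega f ->
  (forall x, ~ Omega x -> \forall y \near x, f y = 0) ->
  integ Omega (fun x => 'D_v f x) = 0.
Proof.
move=> bO hf f0; have hT := C1_at_outside f0 hf.
have [r Or] := bO.2.
pose B := ball (0 : 'rV[R]_d) (r + `|v|).
have bB : bounded_open B by exact: bounded_open_ball.
pose B2 := ball (0 : 'rV[R]_d) (r + `|v| + `|v|).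
have cB2 := bounded_open_compact (bounded_open_ball (0 : 'rV[R]_d) (r + `|v| + `|v|)).
have [M hM] := compact_bounded_fun cB2 (fun x _ => hT.2 v x I).
have H : is_derive (0 : R) 1 (fun t : R => integ B (fun x => f (x + t *: v)))
     (integ B (fun x => 'D_v f (x + 0 *: v))).
  apply: (@integ_is_derive _ _ B (fun t x => f (x + t *: v))
    (fun t x => 'D_v f (x + t *: v)) 0 (-1) 1 M) => //.
  - by rewrite ltrN10 ltr01.
  - move=> t _; apply: (@C1_integrand setT) => //; first exact: openT.
      exact: bounded_open_compact.
    move=> x _; apply: (@continuous_comp _ _ _ (fun x => x + t *: v) f).
      exact: continuous_translate.
    exact: (C1_continuous hT I).
  - by move=> t x _ _; apply: is_derive_line; exact: hT.1.
  - move=> t x t1 Bx; apply: hM; apply: subset_closure.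
    move: Bx; rewrite /B /B2 -!ball_normE /= !sub0r !normrN => Bx.
    apply: le_lt_trans (ler_normD _ _) _; apply: ltr_leD => //.
    by rewrite normrZ ler_piMl // ltW // ltr_norml; lra.
have -> : integ Omega (fun x => 'D_v f x) = integ B (fun x => 'D_v f (x + 0 *: v)).
  rewrite (@integ_vanish _ _ Omega B).
  - by apply: eq_integ => x _; rewrite scale0r addr0.
  - by move=> x /Or; apply: le_ball; rewrite lerDl.
  - move=> x _ /f0 fx; rewrite scale0r addr0.
    by rewrite (near_eq_derive (g := fun=> 0)) // (derive_cst (0 : R)).
have [_ <-] := H; rewrite (near_eq_derive (g := fun=> integ Omega f)).
  exact: derive_cst.
near=> t.
have t1 : `|t| <= 1.
  by near: t; exists 1 => //= t; rewrite /= sub0r normrN => /ltW.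
have hO : integrand Omega f.
  apply: (@C1_integrand setT) => //; first exact: openT.
    exact: bounded_open_compact.
  by move=> x _; exact: (C1_continuous hT I).
rewrite -(integ_translate (t *: v) bO hO); apply: integ_vanish.
  move=> x /= /Or; rewrite /B -!ball_normE /= !sub0r !normrN => h.
  rewrite -(addrK (t *: v) x); apply: le_lt_trans (ler_normB _ _) _.
  by apply: ltr_leD => //; rewrite normrZ ler_piMl.
by move=> x _ /= /f0 fx; exact: (nbhs_singleton fx).
Unshelve. all: by end_near. Qed.

End rV_calculus.

(** * Defining functions of the boundary *)

Section charts.
Variables (R : realType) (d : nat) (Omega : set 'rV[R]_d).
Implicit Types (x y z : 'rV[R]_d) (U : set 'rV[R]_d) (phi : 'rV[R]_d -> R).

(** [local_defining_function] with its neighbourhood made explicit, so that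
    the same function serves at all nearby points. *)
Definition chart U phi := [/\ open U, smooth_open U phi,
  (forall y, U y -> grad phi y != 0) &
  Omega `&` U = [set y | U y /\ phi y < 0]].

Lemma chart_defining U phi z : chart U phi -> U z ->
  local_defining_function Omega z phi.
Proof. by move=> [a b c e] Uz; exists U; split. Qed.

Lemma chart_C1 U phi : chart U phi -> C1 U phi.
Proof. by move=> [_ /(_ 1%N)]. Qed.

Lemma chart_C1_derive U phi v : chart U phi -> C1 U (fun x => 'D_v phi x).
Proof. by move=> [_ /(_ 2%N) [_ /(_ v)]]. Qed.

Lemma chart_in U phi x : chart U phi -> U x -> Omega x <-> phi x < 0.
Proof.
move=> [_ _ _ E] Ux; split=> [Ox|px].
  by have : (Omega `&` U) x by []; rewrite E => -[].
have : (Omega `&` U) x by rewrite E; split.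
by case.
Qed.

Lemma boundary_out x : open Omega -> boundary Omega x -> ~ Omega x.
Proof. by move=> oO [_]; rewrite ((interior_id Omega).1 oO). Qed.

(** Going backwards along the gradient, [phi] becomes negative: its zeros are
    limits of points of [Omega]. *)
Lemma chart_boundary U phi z : open Omega -> chart U phi -> U z -> phi z = 0 ->
  boundary Omega z.
Proof.
move=> oO ch Uz pz; split; last first.
  rewrite ((interior_id Omega).1 oO) => /(chart_in ch Uz).1.
  by rewrite pz ltxx.
move=> B Bz; have [oU _ gr _] := ch; have c1 := chart_C1 ch.
set g := grad phi z; have g0 : 0 < dot g g by apply: dot_gt0; exact: gr.
have : \forall y \near z, [/\ B y, U y & dot g g / 2 <= 'D_g phi y].
  have cD := c1.2 g z Uz.
  have hD : \forall y \near z, dot g g / 2 < 'D_g phi y.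
    apply: (cvgr_gt _ cD); rewrite (deriveE_dot _ (c1.1 _ Uz)) -/g.
    by rewrite ltr_pdivrMr // mulr2n mulrDr mulr1 ltrDl.
  near=> y; split; [by near: y|by near: y; exact: open_nbhs_nbhs|].
  by apply: ltW; near: y.
move=> /nbhs_ballP [r /= r0 Hr].
pose t := r / (2 * (`|g| + 1)).
have t0 : 0 < t by rewrite divr_gt0 // mulr_gt0 // ltr_wpDl.
have tg : t * `|g| < r.
  rewrite /t mulrAC ltr_pdivrMr ?mulr_gt0 ?ltr_wpDl // ltr_pM2l //.
  by have := normr_ge0 g; lra.
have inB s : 0 <= s <= t -> ball z r (z - t *: g + s *: g).
  move=> /andP[s0 st]; rewrite -ball_normE /=.
  rewrite (_ : z - _ = (t - s) *: g); last first.
    by rewrite scalerBl opprD addrA opprB addrCA subrr addr0.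
  rewrite normrZ; apply: le_lt_trans tg; apply: ler_wpM2r => //.
  by rewrite ger0_norm; lra.
have := @line_increase _ _ phi (z - t *: g) g (dot g g / 2) t (ltW t0).
rewrite subrK pz sub0r => H.
exists (z - t *: g).
have in0 : ball z r (z - t *: g).
  by have := inB 0; rewrite scale0r addr0; apply; rewrite lexx ltW.
have [Bz' Uz' _] := Hr _ in0; split => //.
apply/(chart_in ch Uz'); rewrite -oppr_gt0.
apply: lt_le_trans (H _ _); first by rewrite mulr_gt0 // divr_gt0.
- by move=> s /inB /Hr [_ /c1.1].
- by move=> s /inB /Hr [].
Unshelve. all: by end_near. Qed.

Lemma chart_boundary0 U phi z : open Omega -> chart U phi -> U z ->
  boundary Omega z -> phi z = 0.
Proof.
move=> oO ch Uz bz; apply/eqP; rewrite eq_le; apply/andP; split; last first.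
  by rewrite leNgt; apply/negP => /(chart_in ch Uz).2; exact: boundary_out.
rewrite leNgt; apply/negP => pz.
have [oU _ _ _] := ch.
have : \forall y \near z, U y /\ 0 < phi y.
  near=> y; split; first by near: y; exact: open_nbhs_nbhs.
  by near: y; apply: (cvgr_gt _ (C1_continuous (chart_C1 ch) Uz)).
move=> /bz.1 [y [Oy [Uy]]].
by have := (chart_in ch Uy).1 Oy => /lt_trans h /h; rewrite ltxx.
Unshelve. all: by end_near. Qed.

Variables (V : 'rV[R]_d -> 'rV[R]_d) (U0 : set 'rV[R]_d).
Hypotheses (oO : open Omega) (oU0 : open U0) (OU0 : closure Omega `<=` U0).
Hypothesis hV : forall i, C1 U0 (fun x => V x 0 i).
Hypothesis tangential : forall x phi, boundary Omega x ->
  local_defining_function Omega x phi -> dot (grad phi x) (V x) = 0.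

Let flux (f : 'rV[R]_d -> R) x := dot (grad f x) (V x).

Lemma fluxE f x : flux f x = \sum_i 'D_(delta_mx 0 i) f x * V x 0 i.
Proof. by apply: eq_bigr => i _; rewrite gradE. Qed.

(** Along an outward transversal, [K * phi +- flux phi] is nondecreasing and
    vanishes at the boundary. This linear bound compensates for the factor
    [t^-1] in the gradients of the cut-off functions. *)
Lemma tangential_bound U phi y0 : chart U phi -> U y0 -> boundary Omega y0 ->
  exists r K, [/\ 0 < r, 0 <= K, ball y0 r `<=` U `&` U0 &
    forall x, Omega x -> ball y0 r x -> `|flux phi x| <= K * - phi x].
Proof.
move=> ch Uy0 by0; have [oU _ gr _] := ch; have c1 := chart_C1 ch.
have U0y0 : U0 y0 by apply: OU0; case: by0.
have p0 := chart_boundary0 oO ch Uy0 by0.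
set nu := grad phi y0; have nu0 : 0 < dot nu nu by apply: dot_gt0; exact: gr.
have oUU : open (U `&` U0) by exact: openI.
have cw : C1 (U `&` U0) (fun x => flux phi x).
  rewrite (_ : (fun x => _) =
     fun x => \sum_i 'D_(delta_mx 0 i) phi x * V x 0 i); last first.
    by apply/funext => x; rewrite fluxE.
  apply: C1_sum => // i; apply: C1M => //.
    by apply: (C1S (@subIsetl _ U U0)); exact: chart_C1_derive.
  by apply: (C1S (@subIsetr _ U U0)).
set c := dot nu nu / 2; have c0 : 0 < c by rewrite divr_gt0.
set L := `|'D_nu (flux phi) y0| + 1.
have L0 : 0 <= L by rewrite addr_ge0.
have : \forall y \near y0, [/\ U y, U0 y, c <= 'D_nu phi y &
    `|'D_nu (flux phi) y| <= L].
  have h1 : \forall y \near y0, c < 'D_nu phi y.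
    apply: (cvgr_gt _ (c1.2 nu y0 Uy0)); rewrite (deriveE_dot _ (c1.1 _ Uy0)).
    by rewrite -/nu /c ltr_pdivrMr // mulr2n mulrDr mulr1 ltrDl.
  have h2 : \forall y \near y0, `|'D_nu (flux phi) y| < L.
    have := cw.2 nu y0 (conj Uy0 U0y0) => /cvg_norm /(cvgr_lt _); apply.
    by rewrite /L ltrDl.
  near=> y; split.
  - by near: y; exact: open_nbhs_nbhs.
  - by near: y; exact: open_nbhs_nbhs.
  - by apply: ltW; near: y.
  - by apply: ltW; near: y.
move=> /nbhs_ballP [rho /= rho0 Hrho].
pose s1 := rho / (2 * (`|nu| + 1)).
have s10 : 0 < s1 by rewrite divr_gt0 // mulr_gt0 // ltr_wpDl.
have s1nu : s1 * `|nu| < rho / 2.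
  rewrite /s1 mulrAC ltr_pdivrMr ?mulr_gt0 ?ltr_wpDl //.
  rewrite mulrA divfK // ltr_pM2l //.
  by have := normr_ge0 nu; lra.
have : \forall y \near y0, - (c * s1) < phi y.
  by apply: (cvgr_gt _ (C1_continuous c1 Uy0)); rewrite p0 oppr_lt0 mulr_gt0.
move=> /nbhs_ballP [rho' /= rho'0 Hrho'].
exists (Num.min rho' (rho / 2)), (L / c).
have sub x : ball y0 (Num.min rho' (rho / 2)) x -> ball y0 (rho / 2) x.
  by apply: le_ball; rewrite ge_min lexx orbT.
have sub' x : ball y0 (Num.min rho' (rho / 2)) x -> ball y0 rho' x.
  by apply: le_ball; rewrite ge_min lexx.
split.
- by rewrite lt_min rho'0 divr_gt0.
- by rewrite divr_ge0 // ltW.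
- move=> y /sub Hy; have : ball y0 rho y.
    by move: Hy; apply: le_ball; lra.
  by move=> /Hrho [].
move=> x Ox xr.
have inB s : 0 <= s <= s1 -> ball y0 rho (x + s *: nu).
  move=> /andP[s0 ss]; move/sub : xr; rewrite -!ball_normE /= => xr.
  rewrite opprD addrA (splitr rho); apply: le_lt_trans (ler_normB _ _) _.
  apply: ltrD => //; rewrite normrZ; apply: le_lt_trans s1nu.
  by apply: ler_wpM2r => //; rewrite ger0_norm.
have Ux s : 0 <= s <= s1 -> (U `&` U0) (x + s *: nu).
  by move=> /inB /Hrho [].
have Ux0 : U x by have := Ux 0; rewrite scale0r addr0 lexx ltW // => /(_ isT) [].
have px : phi x < 0 by apply/(chart_in ch Ux0).
(* The transversal through x leaves Omega before time s1. *)
have px1 : 0 <= phi (x + s1 *: nu).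
  have := @line_increase _ _ phi x nu c s1 (ltW s10).
  have /Hrho' := sub' _ xr.
  move=> h1 h2; have {}h2 := h2 (fun s hs => c1.1 _ (Ux s hs).1).
  have : c * s1 <= phi (x + s1 *: nu) - phi x.
    by apply: h2 => s /inB /Hrho [].
  by move: h1; lra.
have [s ss ps] : exists2 s, s \in `[0, s1] & phi (x + s *: nu) = 0.
  apply: (@IVT _ (fun s => phi (x + s *: nu))); first exact: ltW.
    apply: derivable_within_continuous => s; rewrite in_itv /= => hs.
    by have [] := is_derive_line (c1.1 _ (Ux s hs).1).
  rewrite scale0r addr0; apply/andP; split.
    by rewrite ge_min ltW.
  by rewrite le_max px1 orbT.
move: ss; rewrite in_itv /= => /andP[s0 ss].
have Uz := Ux s; rewrite s0 ss in Uz; have {Uz}[Uz U0z] := Uz isT.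
have wz : flux phi (x + s *: nu) = 0.
  apply: tangential; last exact: chart_defining ch Uz.
  exact: chart_boundary ch Uz ps.
have incl t : 0 <= t <= s -> 0 <= t <= s1.
  by move=> /andP[-> h]; exact: le_trans h ss.
have key (e : R) : `|e| = 1 ->
    (L / c) * phi x + e * flux phi x <= 0.
  move=> e1.
  pose q y := (L / c) * phi y + e * flux phi y.
  have := @line_increase _ _ q x nu 0 s s0.
  rewrite /q ps wz !mulr0 addr0 mul0r sub0r oppr_ge0; apply.
    move=> t /incl /Ux Ht; apply: differentiableD.
      by apply: (@differentiableZ _ _ _ phi); exact: c1.1 Ht.1.
    by apply: (@differentiableZ _ _ _ (flux phi)); exact: cw.1 Ht.
  move=> t /incl Ht; have Ut := Ux t Ht.
  have dp := c1.1 _ Ut.1; have dw := cw.1 _ Ut.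
  rewrite deriveD_fun; last 2 first.
  - exact: (@differentiableZ _ _ _ phi).
  - exact: (@differentiableZ _ _ _ (flux phi)).
  rewrite (deriveZ_fun _ _ dp) (deriveZ_fun _ _ dw).
  have [_ _ hc hL] := Hrho _ (inB t Ht).
  have h1 : L <= L / c * 'D_nu phi (x + t *: nu).
    by rewrite mulrAC ler_pdivlMr // ler_wpM2l.
  have h2 : - L <= e * 'D_nu (flux phi) (x + t *: nu).
    have : `|e * 'D_nu (flux phi) (x + t *: nu)| <= L by rewrite normrM e1 mul1r.
    by rewrite ler_norml => /andP[].
  by lra.
have k1 := key 1 (normr1 _); have k2 := key (-1) (normrN1 _).
rewrite ler_norml; apply/andP; split; lra.
Unshelve. all: by end_near. Qed.

End charts.

(** * Integral of the divergence of a tangent field *)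

Section bump.
Variables (R : realType) (d : nat).

(** Built on the squared Euclidean distance, which is smooth, whereas the norm
    of row vectors is not; it vanishes at Euclidean distance at least [rho]. *)
Definition bump (y0 : 'rV[R]_d) (rho : R) (x : 'rV[R]_d) : R :=
  step (3 - 2 / rho ^+ 2 * dot (x - y0) (x - y0)).

Lemma C1_sqdist (y0 : 'rV[R]_d) : C1 setT (fun x => dot (x - y0) (x - y0)).
Proof.
have oT : open [set: 'rV[R]_d] by exact: openT.
have H i : C1 setT (fun x => (x - y0) 0 i).
  rewrite (_ : (fun x => _) = fun x : 'rV[R]_d => x 0 i - y0 0 i).
    by apply: C1B => //; [exact: C1_coord|exact: C1_cst].
  by apply/funext => x; rewrite !mxE.
by apply: C1_sum => // i; exact: C1M.
Qed.

Lemma C1_bump y0 rho : C1 setT (bump y0 rho).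
Proof.
have oT : open [set: 'rV[R]_d] by exact: openT.
exact: (C1_comp oT (C1B oT (C1_cst _ 3) (C1Z (2 / rho ^+ 2) oT (C1_sqdist y0)))
  (@is_derive_step R) (@continuous_dstep R)).
Qed.

Lemma bump_01 y0 rho x : 0 <= bump y0 rho x <= 1.
Proof. exact: step_01. Qed.

Lemma bump_near1 y0 rho : 0 < rho ->
  exists N, [/\ open N, N y0 & forall x, N x -> bump y0 rho x = 1].
Proof.
move=> r0; exists [set x | 2 / rho ^+ 2 * dot (x - y0) (x - y0) < 1]; split.
- apply: (open_comp _ (@open_lt R 1)) => x _.
  exact: (C1_continuous (C1Z _ openT (C1_sqdist y0)) I).
- rewrite /= subrr (_ : dot 0 0 = 0) ?mulr0 //.
  by apply: big1 => i _; rewrite mxE mulr0.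
- by move=> x /= h; apply: step_ge2; lra.
Qed.

Lemma coord_sq_le_dot (v : 'rV[R]_d) i : v 0 i ^+ 2 <= dot v v.
Proof.
rewrite /dot (bigD1 i) //= expr2 lerDl; apply: sumr_ge0 => j _.
by rewrite -expr2 sqr_ge0.
Qed.

Lemma bump_far y0 rho x : 0 < rho -> ~ closed_ball y0 rho x ->
  \forall y \near x, bump y0 rho y = 0.
Proof.
move=> r0 nx.
have dx : rho ^+ 2 < dot (x - y0) (x - y0).
  rewrite ltNge; apply/negP => h; apply: nx.
  rewrite closed_ballE // /closed_ball_ /= distrC; apply: norm_le_coord; first exact: ltW.
  move=> i; rewrite -(ler_pXn2r (n := 2)) ?nnegrE ?(ltW r0) //.
  by rewrite real_normK ?num_real //; exact: le_trans (coord_sq_le_dot _ i) h.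
have : \forall y \near x, rho ^+ 2 < dot (y - y0) (y - y0).
  exact: (cvgr_gt _ (C1_continuous (C1_sqdist y0) I)).
apply: filterS => y hy; apply: step_le1.
have : 2 < 2 / rho ^+ 2 * dot (y - y0) (y - y0).
  by rewrite mulrAC ltr_pdivlMr ?exprn_gt0 // ltr_pM2l.
lra.
Qed.

End bump.

Section no_flux.
Variables (R : realType) (d : nat) (Omega : set 'rV[R]_d).
Variables (V : 'rV[R]_d -> 'rV[R]_d) (U0 : set 'rV[R]_d).
Hypotheses (bO : bounded_open Omega) (oU0 : open U0) (OU0 : closure Omega `<=` U0).
Hypothesis hV : forall i, C1 U0 (fun x => V x 0 i).
Hypothesis tangential : forall x phi, boundary Omega x ->
  local_defining_function Omega x phi -> dot (grad phi x) (V x) = 0.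

Let flux (f : 'rV[R]_d -> R) x := dot (grad f x) (V x).

Let oO : open Omega. Proof. by case: bO. Qed.
Let oT : open [set: 'rV[R]_d]. Proof. exact: openT. Qed.

(** As [t] tends to 0, [chi t] tends to 1 in [Omega] and vanishes near the
    part of the boundary that lies in [N]. The uniform bound on the derivative
    of [chi t] along [V] is what allows passing to the limit under the
    integral sign: the gradient itself is of size [t^-1]. *)
Record cutoff (N : set 'rV[R]_d) (chi : R -> 'rV[R]_d -> R) : Prop := {
  cutoff_C1 : forall t, 0 < t -> C1 setT (chi t);
  cutoff_le1 : forall t x, 0 < t -> `|chi t x| <= 1;
  cutoff_flux : exists C, forall t x, 0 < t -> Omega x -> `|flux (chi t) x| <= C;
  cutoff_in : forall x, Omega x -> exists2 t0, 0 < t0 &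
    forall t, 0 < t -> t < t0 -> \forall y \near x, chi t y = 1;
  cutoff_bd : forall t y, 0 < t -> N y -> boundary Omega y ->
    \forall x \near y, chi t x = 0 }.

Lemma cutoff1 : cutoff set0 (fun _ _ => 1).
Proof.
split=> //.
- by move=> t _; exact: C1_cst.
- by move=> t x _; rewrite normr1.
- exists 0 => t x _ _; rewrite /flux /dot big1 ?normr0 // => i _.
  by rewrite gradE derive_cst_fun mul0r.
- by move=> x _; exists 1 => // t _ _; apply: filterE.
Qed.

Lemma flux_M (f g : 'rV[R]_d -> R) x : differentiable f x -> differentiable g x ->
  flux (fun y => f y * g y) x = f x * flux g x + g x * flux f x.
Proof.
move=> df dg; rewrite /flux /dot !mulr_sumr -big_split /=; apply: eq_bigr => i _.
by rewrite !gradE (deriveM_fun _ df dg); ring.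
Qed.

Lemma flux_continuous f U x : C1 U f -> U x -> U0 x ->
  {for x, continuous (flux f)}.
Proof.
move=> hf Ux U0x; rewrite (_ : flux f =
    fun x => \sum_i 'D_(delta_mx 0 i) f x * V x 0 i); last first.
  by apply/funext => y; apply: eq_bigr => i _; rewrite gradE.
apply: continuous_sum_fun => i; apply: continuousM; first exact: hf.2.
exact: C1_continuous (hV i) U0x.
Qed.

Lemma cutoffM N1 N2 chi1 chi2 : cutoff N1 chi1 -> cutoff N2 chi2 ->
  cutoff (N1 `|` N2) (fun t x => chi1 t x * chi2 t x).
Proof.
move=> h1 h2; split.
- by move=> t t0; apply: C1M => //; [exact: (cutoff_C1 h1)|exact: (cutoff_C1 h2)].
- move=> t x t0; rewrite normrM mulr_ile1 //; first exact: (cutoff_le1 h1).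
  exact: (cutoff_le1 h2).
- have [C1 hC1] := cutoff_flux h1; have [C2 hC2] := cutoff_flux h2.
  exists (C2 + C1) => t x t0 Ox.
  have d1 := (cutoff_C1 h1 t0).1 x I; have d2 := (cutoff_C1 h2 t0).1 x I.
  rewrite flux_M //; apply: le_trans (ler_normD _ _) _; rewrite !normrM.
  have l1 := cutoff_le1 h1 x t0; have l2 := cutoff_le1 h2 x t0.
  by apply: lerD; apply: le_trans (ler_piMl _ _) _ => //; [exact: hC2|exact: hC1].
- move=> x Ox; have [a a0 ha] := cutoff_in h1 Ox; have [b b0 hb] := cutoff_in h2 Ox.
  exists (Num.min a b); first by rewrite lt_min a0.
  move=> t t0; rewrite lt_min => /andP[ta tb].
  by apply: filterS2 (ha t t0 ta) (hb t t0 tb) => y -> ->; rewrite mulr1.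
- move=> t y t0 [Ny|Ny] by_.
    by apply: filterS (cutoff_bd h1 t0 Ny by_) => x ->; rewrite mul0r.
  by apply: filterS (cutoff_bd h2 t0 Ny by_) => x ->; rewrite mulr0.
Qed.

(** With [b] a bump, [1 - b (1 - step (- phi / t))] cuts off the layer
    [- phi < 2 t]; there the derivative of [phi] along [V] is of size [t] by
    [tangential_bound]. *)
Lemma local_cutoff y0 : smooth_boundary Omega -> boundary Omega y0 ->
  exists N chi, [/\ open N, N y0 & cutoff N chi].
Proof.
move=> sm by0; have [phi [U [oU Uy0 smU grU EU]]] := sm _ by0.
have ch : chart Omega U phi by split.
have [r [K [r0 K0 sub tb]]] :=
  @tangential_bound _ _ _ V U0 oO oU0 OU0 hV tangential _ _ _ ch Uy0 by0.
have c1 : C1 (ball y0 r) phi.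
  by apply: C1S (chart_C1 ch) => x /sub [].
pose b := bump y0 (r / 2); have r20 : 0 < r / 2 by rewrite divr_gt0.
have [N [oN Ny0 N1]] := bump_near1 y0 r20.
pose chi t x := 1 - b x * (1 - step (- t^-1 * phi x)).
have far x : ~ ball y0 r x -> \forall y \near x, b y = 0.
  move=> nx; apply: bump_far => //; apply: contra_not nx.
  rewrite closed_ballE // /closed_ball_ -ball_normE /= => h; apply: le_lt_trans h _; lra.
have chi_far t x : ~ ball y0 r x -> \forall y \near x, chi t y = 1.
  by move=> /far; apply: filterS => y; rewrite /chi => ->; rewrite mul0r subr0.
have C1step t : C1 (ball y0 r) (fun x => step (- t^-1 * phi x)).
  apply: (@C1_comp _ _ _ (fun x => - t^-1 * phi x) (@step R) (@dstep R)).
  - exact: open_ball.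
  - by apply: C1Z c1; exact: open_ball.
  - exact: is_derive_step.
  - exact: continuous_dstep.
have C1b : C1 (ball y0 r) b by apply: C1S (C1_bump _ _).
have dchi t x v : ball y0 r x -> 'D_v (chi t) x =
   - (1 - step (- t^-1 * phi x)) * 'D_v b x
   - b x * dstep (- t^-1 * phi x) * t^-1 * 'D_v phi x.
  move=> xr; have db := C1b.1 _ xr; have ds := (C1step t).1 _ xr.
  have dp := c1.1 _ xr.
  have d1 : differentiable (fun=> 1 : R) x by exact: differentiable_cst.
  have d1s := differentiableD_fun d1 (differentiableZ_fun (-1) ds).
  have dbs := differentiableM_fun db d1s.
  have -> : chi t = fun x => 1 + -1 * (b x * (1 + -1 * step (- t^-1 * phi x))).
    by apply/funext => z; rewrite /chi; ring.
  rewrite (deriveD_fun _ d1 (differentiableZ_fun (-1) dbs)) derive_cst_fun add0r.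
  rewrite (deriveZ_fun _ _ dbs) (deriveM_fun _ db d1s).
  rewrite (deriveD_fun _ d1 (differentiableZ_fun (-1) ds)) derive_cst_fun add0r.
  rewrite (deriveZ_fun _ _ ds).
  have := derive_comp_fun v (differentiableZ_fun (- t^-1) dp)
    (is_derive_step (- t^-1 * phi x)).
  by rewrite (deriveZ_fun _ _ dp) => ->; ring.
exists (N `&` ball y0 r), chi; split.
- by apply: openI => //; exact: open_ball.
- by split=> //; exact: ballxx.
split.
- move=> t t0.
  have in_ : C1 (ball y0 r) (chi t).
    have oB : open (ball y0 r) by exact: open_ball.
    exact: (C1B oB (C1_cst _ 1) (C1M oB C1b (C1B oB (C1_cst _ 1) (C1step t)))).
  have out : C1 (~` ball y0 r) (chi t).
    apply: (@C1_near_eq _ _ _ (fun=> 1)); last exact: C1_cst.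
    by move=> x /(chi_far t); apply: filterS => y ->.
  split=> [x _|v x _]; have [xr|xr] := pselect (ball y0 r x);
    by [exact: in_.1|exact: out.1|exact: in_.2|exact: out.2].
- move=> t x t0; rewrite /chi.
  have /andP[b0 b1] := bump_01 y0 (r / 2) x; rewrite -/(b x) in b0 b1.
  have /andP[s0 s1] := step_01 (- t^-1 * phi x).
  have : 0 <= b x * (1 - step (- t^-1 * phi x)) <= 1.
    apply/andP; split; first by apply: mulr_ge0 => //; lra.
    by apply: mulr_ile1 => //; lra.
  move=> /andP[h1 h2]; rewrite ler_norml; lra.
- have cO := bounded_open_compact bO.
  have [Cb hCb] := @compact_bounded_fun _ _ _ (flux b) cO
    (fun x Ox => flux_continuous (C1_bump _ _) I (OU0 Ox)).
  exists (Cb + 4 * K) => t x t0 Ox.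
  have Cb0 : 0 <= Cb by apply: le_trans (hCb x (@subset_closure _ _ _ Ox)).
  have [xr|xr] := pselect (ball y0 r x); last first.
    rewrite /flux /dot big1 ?normr0 ?addr_ge0 ?mulr_ge0 // => i _.
    by rewrite gradE (near_eq_derive (g := fun=> (1 : R)) _ (chi_far t x xr)) derive_cst_fun mul0r.
  have -> : flux (chi t) x = - (1 - step (- t^-1 * phi x)) * flux b x
     - b x * dstep (- t^-1 * phi x) * t^-1 * flux phi x.
    rewrite /flux /dot !mulr_sumr -sumrB; apply: eq_bigr => i _.
    by rewrite !gradE dchi //; ring.
  apply: le_trans (ler_normB _ _) _; apply: lerD.
    rewrite normrM normrN; apply: le_trans (hCb x (@subset_closure _ _ _ Ox)).
    have /andP[s0 s1] := step_01 (- t^-1 * phi x).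
    by apply: ler_piMl => //; rewrite ler_norml; lra.
  have [h2|h2] := leP 2 (- t^-1 * phi x).
    by rewrite dstep_ge2 // mulr0 !mul0r normr0 mulr_ge0.
  have hp : - phi x < 2 * t by move: h2; rewrite mulNr mulrC -mulNr ltr_pdivrMr.
  have hf := tb x Ox xr.
  have /andP[b0 b1] := bump_01 y0 (r / 2) x; rewrite -/(b x) in b0 b1.
  have hd := dstep_le2 (- t^-1 * phi x).
  rewrite !normrM (ger0_norm b0) (gtr0_norm (_ : 0 < t^-1)) ?invr_gt0 //.
  have hbd : b x * `|dstep (- t^-1 * phi x)| <= 2.
    by apply: le_trans hd; exact: ler_piMl.
  have htf : t^-1 * `|flux phi x| <= 2 * K.
    rewrite mulrC ler_pdivrMr //; apply: le_trans hf _.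
    by rewrite [leRHS]mulrAC mulrC ler_wpM2r // ltW.
  rewrite -mulrA (_ : 4 * K = 2 * (2 * K)); last by ring.
  by apply: ler_pM => //; rewrite mulr_ge0 // invr_ge0 ltW.
- move=> x Ox; have [xr|xr] := pselect (ball y0 r x); last first.
    by exists 1 => // t _ _; exact: chi_far.
  have px : phi x < 0 by apply/(chart_in ch (sub _ xr).1).
  exists (- phi x / 4); first by rewrite divr_gt0 // oppr_gt0.
  move=> t t0 ht.
  have : \forall y \near x, phi y < phi x / 2.
    by apply: (cvgr_lt _ (C1_continuous c1 xr)); lra.
  apply: filterS => y hy; rewrite /chi step_ge2 ?subrr ?mulr0 ?subr0 //.
  by rewrite mulNr mulrC -mulNr ler_pdivlMr //; lra.
- move=> t y t0 [Ny yr] by_.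
  have py : phi y = 0 := chart_boundary0 oO ch (sub _ yr).1 by_.
  have h1 : \forall x \near y, - t < phi x.
    by apply: (cvgr_gt _ (C1_continuous c1 yr)); rewrite py oppr_lt0.
  have h2 : \forall x \near y, N x by exact: open_nbhs_nbhs.
  apply: filterS2 h1 h2 => x px /N1; rewrite /chi -/(b x) => ->.
  rewrite step_le1; first by ring.
  by rewrite mulNr mulrC -mulNr ler_pdivrMr //; lra.
Qed.

(** Finitely many local cut-off functions cover the boundary; take their
    product. *)
Lemma boundary_cutoff : smooth_boundary Omega ->
  exists chi, cutoff (boundary Omega) chi.
Proof.
move=> sm; have cB : compact (boundary Omega).
  apply: (subclosed_compact _ (bounded_open_compact bO)); last by move=> x [].
  rewrite /boundary setDE; apply: closedI; first exact: closed_closure.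
  by rewrite closedC; exact: open_interior.
pose P (y : 'rV[R]_d) (w : set 'rV[R]_d * (R -> 'rV[R]_d -> R)) :=
  boundary Omega y -> [/\ open w.1, w.1 y & cutoff w.1 w.2].
have : forall y, exists w, P y w.
  move=> y; have [by_|nb] := pselect (boundary Omega y).
    by have [N [chi H]] := local_cutoff sm by_; exists (N, chi).
  by exists (set0, fun _ _ => 0).
move=> /choice [w hw].
move: cB; rewrite compact_cover => /(_ _ (boundary Omega) (fun y => (w y).1)).
case=> [y /hw []//|y by_|D sD cov]; first by exists y => //; case: (hw y by_).
suff [chi hchi] : exists chi,
    cutoff (\bigcup_(y in [set` (finmap.enum_fset D)]) (w y).1) chi.
  exists chi; split; [exact: cutoff_C1 hchi|exact: cutoff_le1 hchi|
    exact: cutoff_flux hchi|exact: cutoff_in hchi|].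
  move=> t y t0 by_ _; apply: (cutoff_bd hchi t0 _ by_).
  by have [z Dz wz] := cov y by_; exists z.
have : forall y, y \in finmap.enum_fset D -> boundary Omega y.
  by move=> y /sD; rewrite inE.
elim: (finmap.enum_fset D) => [|y l IH] H.
  exists (fun _ _ => 1); rewrite (_ : \bigcup_(_ in _) _ = set0).
    exact: cutoff1.
  by rewrite -subset0 => x [z].
have [chi hchi] := IH (fun z zl => H z (mem_behead (s := y :: l) zl)).
have [_ _ hy] := hw y (H y (mem_head _ _)).
exists (fun t x => (w y).2 t x * chi t x).
rewrite (_ : \bigcup_(_ in _) _ =
    (w y).1 `|` \bigcup_(z in [set` l]) (w z).1); first exact: cutoffM.
apply/seteqP; split => x.
  move=> [z /=]; rewrite inE => /orP[/eqP ->|zl] wz; first by left.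
  by right; exists z.
move=> [wy|[z /= zl wz]]; first by exists y => //=; rewrite mem_head.
by exists z => //=; rewrite inE zl orbT.
Qed.

(** The field [chi t V] vanishes near the boundary, so its divergence has
    integral zero; that divergence is [chi t (div V)] plus the derivative of
    [chi t] along [V], and dominated convergence applies. *)
Lemma integ_divergence_eq0 : smooth_boundary Omega ->
  integ Omega (divergence V) = 0.
Proof.
move=> sm; have [chi hchi] := boundary_cutoff sm.
have cO := bounded_open_compact bO.
have OU : Omega `<=` U0 by move=> x /subset_closure /OU0.
have iV i v : integrand Omega (fun x => 'D_v (fun y => V y 0 i) x).
  apply: (C1_integrand oU0 cO OU0) => x Ux; exact: (hV i).2.
have iV0 i : integrand Omega (fun x => V x 0 i).
  apply: (C1_integrand oU0 cO OU0) => x Ux; exact: (C1_continuous (hV i)).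
have idiv : integrand Omega (divergence V) by apply: integrand_sum => i.
have [Md hMd] := idiv.2; have [C hC] := cutoff_flux hchi.
have ichi t : 0 < t -> integrand Omega (chi t).
  move=> t0; apply: (C1_integrand oT cO) => // x _.
  exact: C1_continuous (cutoff_C1 hchi t0) I.
have iDchi t v : 0 < t -> integrand Omega (fun x => 'D_v (chi t) x).
  move=> t0; apply: (C1_integrand oT cO) => // x _.
  exact: (cutoff_C1 hchi t0).2.
pose F (n : nat) x := chi n.+1%:R^-1 x * divergence V x + flux (chi n.+1%:R^-1) x.
have n0 (n : nat) : 0 < n.+1%:R^-1 :> R by [].
have IF0 n : integ Omega (F n) = 0.
  have t0 := n0 n; set t := n.+1%:R^-1 in t0 *.
  have zero i : integ Omega (fun x => chi t x * 'D_(delta_mx 0 i) (fun y => V y 0 i) x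
      + V x 0 i * 'D_(delta_mx 0 i) (chi t) x) = 0.
    pose g x := if `[< Omega x >] then chi t x * V x 0 i else 0.
    have gE x : Omega x -> \forall y \near x, chi t y * V y 0 i = g y.
      move=> Ox; apply: filterS (open_nbhs_nbhs (conj oO Ox)) => y Oy.
      by rewrite /g asboolT.
    have C1g : C1 Omega g.
      apply: C1_near_eq gE _; apply: C1M => //.
        by apply: C1S (cutoff_C1 hchi t0).
      exact: C1S (hV i).
    rewrite -[RHS](integ_derive_supported (delta_mx 0 i) bO C1g); last first.
      move=> x nOx; have [cx|ncx] := pselect (closure Omega x); last first.
        have : nbhs x (~` closure Omega).
          apply: open_nbhs_nbhs; split=> //; rewrite openC; exact: closed_closure.
        apply: filterS => y ny; rewrite /g asboolF // => /subset_closure //.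
      have bx : boundary Omega x.
        by split=> //; rewrite ((interior_id Omega).1 oO).
      apply: filterS (cutoff_bd hchi t0 bx bx) => y cy.
      by rewrite /g cy mul0r; case: ifP.
    apply: eq_integ => x Ox; rewrite -(near_eq_derive _ (gE x Ox)).
    by rewrite deriveM_fun //; [exact: (cutoff_C1 hchi t0).1|exact: (hV i).1 (OU _ Ox)].
  transitivity (\sum_i integ Omega (fun x =>
      chi t x * 'D_(delta_mx 0 i) (fun y => V y 0 i) x
      + V x 0 i * 'D_(delta_mx 0 i) (chi t) x)); last exact: big1.
  rewrite -integ_sum //; last first.
    move=> i; apply: integrandD; apply: integrandM => //; [exact: ichi|exact: iDchi].
  apply: eq_integ => x _; rewrite /F /divergence /flux /dot mulr_sumr -big_split /=.
  by apply: eq_bigr => i _; rewrite gradE [V x 0 i * _]mulrC.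
have cF : integ Omega (F n) @[n --> \oo] --> integ Omega (divergence V).
  apply: (@integ_dominated _ _ _ _ _ (Md + C)) => //.
  - move=> n; apply: integrandD; first by apply: integrandM => //; exact: ichi.
    apply: integrand_sum => i; apply: integrandM => //.
    rewrite (_ : (fun x => _) = fun x => 'D_(delta_mx 0 i) (chi n.+1%:R^-1) x).
      exact: iDchi.
    by apply/funext => x; rewrite gradE.
  - move=> n x Ox; apply: le_trans (ler_normD _ _) _; apply: lerD; last exact: hC.
    rewrite normrM; apply: le_trans (hMd x Ox); apply: ler_piMl => //.
    exact: (cutoff_le1 hchi).
  - move=> x Ox; have [t0 t00 ht] := cutoff_in hchi Ox.
    apply: cvg_near_cst; near=> n.
    have nt : n.+1%:R^-1 < t0.
      by near: n; exact: (near_infty_natSinv_lt (PosNum t00)).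
    have E := ht _ (n0 n) nt; rewrite /F (nbhs_singleton E) mul1r.
    rewrite /flux /dot big1 ?addr0 // => i _.
    by rewrite gradE (near_eq_derive (g := fun=> (1 : R)) _ E) derive_cst_fun mul0r.
have c0 : integ Omega (F n) @[n --> \oo] --> (0 : R).
  rewrite (_ : (fun n => integ Omega (F n)) = fun=> 0); first exact: cvg_cst.
  by apply/funext => n; rewrite IF0.
by rewrite -(cvg_lim _ cF) // (cvg_lim _ c0).
Unshelve. all: by end_near. Qed.

End no_flux.

(** * Differential inequalities *)

Section gronwall.
Variable R : realType.

Lemma gronwall (g dg : R -> R) (a T : R) : 0 <= T ->
  {within `[0, T], continuous g} ->
  (forall t : R, 0 < t < T -> is_derive t 1 g (dg t)) ->
  (forall t : R, 0 < t < T -> dg t <= a * g t) ->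
  g T <= g 0 * expR (a * T).
Proof.
move=> T0 cg dgE dgle.
have [->|Tn0] := eqVneq T 0; first by rewrite mulr0 expR0 mulr1.
have {}T0 : 0 < T by rewrite lt_neqAle eq_sym Tn0.
pose h t := g t * expR (- a * t).
have dexp t : is_derive t (1 : R) (fun s => expR (- a * s)) (- a * expR (- a * t)).
  have H := is_derive1_comp (is_derive_expR _) (is_deriveZ (- a) (is_derive_id t (1 : R))).
  by apply: is_derive_eq H _; rewrite /GRing.scale /= mulr1 mulrC.
have [t||t] := @MVT _ h (fun t => (dg t - a * g t) * expR (- a * t)) 0 T T0.
- rewrite in_itv /= => ht.
  have := is_deriveM (dgE _ ht) (dexp t); move/is_derive_eq; apply.
  by rewrite /GRing.scale /=; ring.
- have cexp : {within `[0, T], continuous (fun s => expR (- a * s))}.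
    apply: derivable_within_continuous => s _.
    by have [] := dexp s.
  by move=> x; exact: (cvgM (cg x) (cexp x)).
rewrite in_itv /= => ht; rewrite subr0 /h mulr0 expR0 mulr1 => E.
have h1 : g T * expR (- a * T) <= g 0.
  rewrite -subr_le0 E; apply: mulr_le0_ge0 (ltW T0).
  by apply: mulr_le0_ge0 (expR_ge0 _); rewrite subr_le0 dgle.
have := ler_wpM2r (expR_ge0 (a * T)) h1.
by rewrite -mulrA -expRD mulNr addNr expR0 mulr1.
Qed.

(** Composing with the projection onto the interval gives a Lipschitz function
    on the line. *)
Lemma lipschitz_within (g : R -> R) (M a b : R) :
  (forall s t : R, a <= s <= b -> a <= t <= b -> `|g s - g t| <= M * `|s - t|) ->
  {within `[a, b], continuous g}.
Proof.
move=> H.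
have [ab|ab] := leP a b; last first.
  by rewrite set_itv_ge ?bnd_simp -?ltNge //; exact: continuous_subspace0.
pose p t : R := Num.max a (Num.min t b).
have pab t : a <= p t <= b.
  by rewrite /p le_max lexx ge_max ab ge_min lexx orbT.
have plip s t : `|p s - p t| <= `|s - t|.
  have pE r : (r <= a /\ p r = a) \/ (a <= r <= b /\ p r = r) \/ (b <= r /\ p r = b).
    have [ra|ar] := leP r a.
      by left; split=> //; rewrite /p (min_l (le_trans ra ab)) max_l.
    right; have [rb|br] := leP r b.
      by left; split; [rewrite ltW|rewrite /p (min_l rb) max_r // ltW].
    by right; split; [exact: ltW|rewrite /p (min_r (ltW br)) max_r].
  have h1 := ler_norm (s - t); have h2 := ler_norm (t - s).
  rewrite (distrC t s) in h2; rewrite ler_norml.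
  by case: (pE s) => [[hs ->]|[[/andP[hs hs'] ->]|[hs ->]]];
    case: (pE t) => [[ht ->]|[[/andP[ht ht'] ->]|[ht ->]]];
    apply/andP; split; lra.
have M0 : 0 <= `|M| + 1 by rewrite addr_ge0.
have cp : continuous (g \o p).
  move=> s; apply/cvgrPdist_le => e e0.
  have e1 : 0 < e / (`|M| + 1) by rewrite divr_gt0 // ltr_wpDl.
  apply: filterS (nbhsx_ballx s _ e1) => t; rewrite -ball_normE /= => st.
  apply: le_trans (H _ _ (pab s) (pab t)) _.
  apply: (@le_trans _ _ ((`|M| + 1) * `|s - t|)).
    apply: le_trans (_ : `|M| * `|p s - p t| <= _).
      by apply: ler_wpM2r => //; exact: ler_norm.
    apply: le_trans (_ : `|M| * `|s - t| <= _); first by apply: ler_wpM2l.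
    by apply: ler_wpM2r => //; rewrite lerDl.
  by rewrite mulrC -ler_pdivlMr ?ltr_wpDl // ltW.
apply: (@subspace_eq_continuous _ _ _ (g \o p)); last exact: continuous_subspaceT.
move=> t; rewrite inE /= in_itv /= => /andP[h1 h2] /=; congr g.
by rewrite /p min_l // max_r.
Qed.

Variable d : nat.

(** The uniform bound on the time derivative makes the integral Lipschitz in
    time, hence continuous up to the end points, as [gronwall] requires. *)
Lemma integ_path (A : set 'rV[R]_d) (F dF : R -> 'rV[R]_d -> R) (T M : R) :
  bounded_open A -> 0 < T ->
  (forall t, 0 <= t <= T -> integrand A (F t)) ->
  (forall (t : R) x, 0 <= t <= T -> A x -> is_derive t 1 (fun s => F s x) (dF t x)) ->
  (forall t x, 0 <= t <= T -> A x -> `|dF t x| <= M) ->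
  {within `[0, T], continuous (fun t => integ A (F t))} /\
  (forall t : R, 0 < t < T ->
     is_derive t 1 (fun t => integ A (F t)) (integ A (dF t))).
Proof.
move=> bA T0 hF dFE hM.
have inc (t : R) : 0 < t < T -> 0 <= t <= T by move=> /andP[/ltW -> /ltW ->].
split; last first.
  move=> t ht; apply: (@integ_is_derive _ _ A F dF t 0 T M) => //.
  - by move=> s /inc /hF.
  - by move=> s x /inc hs; exact: dFE.
  - by move=> s x /inc; exact: hM.
have lip s t x : 0 <= s <= T -> 0 <= t <= T -> A x ->
    `|F s x - F t x| <= M * `|s - t|.
  wlog st : s t / s <= t.
    move=> W hs ht Ax; have [/W|/ltW/W] := leP s t; first exact.
    by rewrite distrC [`|t - s|]distrC; apply.
  move=> /andP[s0 sT] /andP[t0 tT] Ax.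
  have [<-|nst] := eqVneq s t; first by rewrite !subrr normr0 mulr0.
  have {}st : s < t by rewrite lt_neqAle nst.
  have [r||r] := @MVT _ (fun t => F t x) (fun t => dF t x) s t st.
  - rewrite in_itv /= => /andP[/ltW a /ltW b]; apply: dFE => //.
    by rewrite (le_trans s0 a) (le_trans b tT).
  - apply: derivable_within_continuous => r; rewrite in_itv /= => /andP[a b].
    have hr : 0 <= r <= T by rewrite (le_trans s0 a) (le_trans b tT).
    by case: (dFE r x hr Ax).
  rewrite in_itv /= => /andP[/ltW a /ltW b] E.
  rewrite distrC E normrM (distrC s); apply: ler_wpM2r => //.
  by apply: hM => //; rewrite (le_trans s0 a) (le_trans b tT).
apply: (@lipschitz_within _ (M * vol A)) => s t hs ht.
have hs' := hF _ hs; have ht' := hF _ ht.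
rewrite -integB // mulrAC -integ_cst // ler_norml -integN //; last exact: integrand_cst.
by apply/andP; split; apply: integ_le => //;
  first [exact: integrandB|exact: integrand_cst|apply: integrandN; exact: integrand_cst|
  move=> x Ax; have := lip _ _ _ hs ht Ax; rewrite ler_norml => /andP[]].
Qed.

End gronwall.

(** * The Poincare inequality for functions vanishing on the boundary *)

Section dirichlet.
Variables (R : realType) (d : nat) (Omega : set 'rV[R]_d).
Hypotheses (bO : bounded_open Omega) (sm : smooth_boundary Omega).

Definition grad2 (f : 'rV[R]_d -> R) x := dot (grad f x) (grad f x).

Lemma grad2_continuous U f x : C1 U f -> U x -> {for x, continuous (grad2 f)}.
Proof.
move=> hf Ux; apply: continuous_sum_fun => i.
have H : {for x, continuous (fun y => grad f y 0 i)}.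
  rewrite (_ : (fun y => _) = fun y => 'D_(delta_mx 0 i) f y); first exact: hf.2.
  by apply/funext => y; rewrite gradE.
exact: continuousM.
Qed.

Lemma grad2_integrand U f : open U -> closure Omega `<=` U -> C1 U f ->
  integrand Omega (grad2 f).
Proof.
move=> oU OU hf; apply: (C1_integrand oU (bounded_open_compact bO) OU) => x.
exact: grad2_continuous.
Qed.

(** The field [f^2 x_0 e_0] vanishes on the boundary, so the integral of [f^2]
    is that of [- 2 f x_0 d_0 f], which Young's inequality absorbs. *)
Lemma poincare_dirichlet (i0 : 'I_d) : exists2 C, 0 <= C & forall U f, open U ->
  closure Omega `<=` U -> C1 U f -> (forall x, boundary Omega x -> f x = 0) ->
  integ Omega (fun x => f x ^+ 2) <= C * integ Omega (grad2 f).
Proof.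
have [r Or] := bO.2; exists (4 * r ^+ 2); first by rewrite mulr_ge0 ?sqr_ge0.
move=> U f oU OU hf fb.
have cO := bounded_open_compact bO.
have OsU : Omega `<=` U by move=> x /subset_closure /OU.
pose V (x : 'rV[R]_d) : 'rV[R]_d := \row_i ((i == i0)%:R * (f x * f x * x 0 i0)).
have hff : C1 U (fun x => f x * f x) by exact: C1M.
have hx : C1 U (fun x : 'rV[R]_d => x 0 i0) by exact: C1_coord.
have hfx := C1M oU hff hx.
have VE i : (fun x => V x 0 i) = fun x => (i == i0)%:R * (f x * f x * x 0 i0).
  by apply/funext => x; rewrite mxE.
have hV i : C1 U (fun x => V x 0 i) by rewrite VE; exact: C1Z.
have tang x phi : boundary Omega x -> local_defining_function Omega x phi ->
    dot (grad phi x) (V x) = 0.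
  move=> bx _; rewrite /dot big1 // => i _.
  by rewrite [V x 0 i]mxE fb // !mul0r !mulr0.
have := integ_divergence_eq0 bO oU OU hV tang sm.
have -> : integ Omega (divergence V) = integ Omega (fun x =>
    f x ^+ 2 + 2 * (f x * x 0 i0 * 'D_(delta_mx 0 i0) f x)).
  apply: eq_integ => x /OsU Ux; rewrite /divergence (bigD1 i0) //= big1; last first.
    move=> i ni; rewrite VE (deriveZ_fun _ _ (hfx.1 _ Ux)).
    by rewrite (negbTE ni) mul0r.
  rewrite VE (deriveZ_fun _ _ (hfx.1 _ Ux)) eqxx mul1r addr0.
  rewrite (deriveM_fun _ (hff.1 _ Ux) (hx.1 _ Ux)) derive_coord mxE !eqxx /=.
  rewrite (deriveM_fun _ (hf.1 _ Ux) (hf.1 _ Ux)); ring.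
have if_ : integrand Omega f.
  by apply: (C1_integrand oU cO OU) => x; exact: C1_continuous.
have ix : integrand Omega (fun x : 'rV[R]_d => x 0 i0).
  by apply: (C1_integrand oU cO OU) => x; exact: C1_continuous.
have iD : integrand Omega (fun x => 'D_(delta_mx 0 i0) f x).
  by apply: (C1_integrand oU cO OU) => x; exact: hf.2.
have i2 : integrand Omega (fun x => f x ^+ 2) by exact: integrandX.
have i3 : integrand Omega (fun x => f x * x 0 i0 * 'D_(delta_mx 0 i0) f x).
  by apply: integrandM => //; exact: integrandM.
have ig := grad2_integrand oU OU hf.
rewrite integD //; last exact: integrandZ.
rewrite integZ // => E.
have : integ Omega (fun x => - (f x * x 0 i0 * 'D_(delta_mx 0 i0) f x)) <=
    integ Omega (fun x => 4^-1 * f x ^+ 2 + r ^+ 2 * grad2 f x).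
  apply: integ_le => //; first exact: integrandN.
    by apply: integrandD; exact: integrandZ.
  move=> x Ox; set D := 'D_ _ f x; set y := x 0 i0.
  have hy : y ^+ 2 <= r ^+ 2.
    have := Or _ Ox; rewrite -ball_normE /= sub0r normrN => xr.
    have := le_lt_trans (coord_le_norm x i0) xr => /ltW; rewrite -/y ler_norml.
    by move=> /andP[]; nra.
  have hD : D ^+ 2 <= grad2 f x.
    by rewrite /D -gradE; exact: coord_sq_le_dot.
  have : y ^+ 2 * D ^+ 2 <= r ^+ 2 * grad2 f x by apply: ler_pM => //; exact: sqr_ge0.
  have := sqr_ge0 (f x / 2 + y * D); nra.
rewrite integN // integD ?integZ //; [|exact: integrandZ..].
by lra.
Qed.

End dirichlet.

(** * The Poincare inequality for functions of mean zero *)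

Section tonelli.
Variables (R : realType) (d : nat).
Local Notation mu := (lebesgue_tuple R d).
Local Notation TT := (d.-tuple (measurableTypeR R)).

Lemma ge0_integral_translate (v : 'rV[R]_d) (g : TT -> \bar R) :
  measurable_fun setT g -> (forall s, 0 <= g s)%E ->
  (\int[mu]_s g (tuple_translate v s) = \int[mu]_s g s)%E.
Proof.
move=> mg g0; have mtau := measurable_tuple_translate v.
transitivity (\int[push_measure mu mtau]_s g s)%E.
  by rewrite /= ge0_integral_pushforward ?preimage_setT.
apply: eq_measure_integral => B mB _.
by rewrite /= /pushforward lebesgue_tuple_translate.
Qed.

Lemma measurable_tuple_sum :
  measurable_fun setT (fun z : TT * TT => tuple_translate (rV_of_tuple z.1) z.2).
Proof.
apply/measurable_fun_tnthP => i.
rewrite (_ : _ \o _ = fun z : TT * TT => tnth z.2 i + tnth z.1 i); last first.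
  by apply/funext => z /=; rewrite tnth_mktuple mxE.
by apply: measurable_funD; apply: (measurableT_comp (measurable_tnth i)).
Qed.

(** Integrating over pairs of points is integrating over points and
    displacements. *)
Lemma double_integral_translate (Phi : TT * TT -> \bar R) :
  measurable_fun setT Phi -> (forall z, 0 <= Phi z)%E ->
  (\int[mu]_s \int[mu]_t Phi (s, t) =
   \int[mu]_h \int[mu]_s Phi (s, tuple_translate (rV_of_tuple s) h))%E.
Proof.
move=> mPhi Phi0.
pose Psi (z : TT * TT) := Phi (z.1, tuple_translate (rV_of_tuple z.1) z.2).
have mPsi : measurable_fun setT Psi.
  apply: (measurableT_comp mPhi); apply/measurable_fun_pairP; split.
    exact: measurable_fst.
  exact: measurable_tuple_sum.
transitivity (\int[mu]_s \int[mu]_h Psi (s, h))%E; last first.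
  exact: (fubini_tonelli Psi mPsi (fun z => Phi0 _)).
apply: eq_integral => s _.
rewrite -(ge0_integral_translate (rV_of_tuple s)) //.
exact: (measurableT_comp mPhi (pair1_measurable s)).
Qed.

End tonelli.

Section poincare_wirtinger.
Variables (R : realType) (d : nat) (Omega : set 'rV[R]_d).
Hypotheses (bO : bounded_open Omega) (sm : smooth_boundary Omega).
Implicit Types (A B : set 'rV[R]_d) (f : 'rV[R]_d -> R) (x v : 'rV[R]_d).
Local Notation mu := (lebesgue_tuple R d).

(** C^1 up to the boundary. *)
Definition C1bar f := exists U, [/\ open U, closure Omega `<=` U & C1 U f].

Definition dirichlet_energy f := integ Omega (grad2 f).

Lemma grad2_ge0 f x : 0 <= grad2 f x. Proof. exact: dot_ge0. Qed.

Lemma C1bar_grad2 f : C1bar f -> integrand Omega (grad2 f).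
Proof. by move=> [U [oU OU hf]]; exact: grad2_integrand oU OU hf. Qed.

Lemma energy_ge0 f : 0 <= dirichlet_energy f.
Proof. by apply: integ_ge0 => x _; exact: grad2_ge0. Qed.

Lemma C1bar_integrand f : C1bar f -> integrand Omega f.
Proof.
move=> [U [oU OU hf]].
apply: (C1_integrand oU (bounded_open_compact bO) OU) => x.
exact: C1_continuous.
Qed.

Lemma dot_cauchy (v w : 'rV[R]_d) : dot v w ^+ 2 <= dot v v * dot w w.
Proof.
have [->|w0] := eqVneq w 0.
  have z u : dot u (0 : 'rV[R]_d) = 0.
    by rewrite /dot big1 // => i _; rewrite mxE mulr0.
  by rewrite !z expr0n mulr0.
have ww := dot_gt0 w0.
have := dot_ge0 (dot w w *: v + (- dot v w) *: w).
rewrite dotDl !dotZl ![dot _ (_ + _)]dotC !dotDl !dotZl (dotC w v) => h.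
have {h} : 0 <= dot w w * (dot v v * dot w w - dot v w ^+ 2) by nra.
by rewrite pmulr_rge0 // subr_ge0.
Qed.

(** The integral [I s] of [(f (x + s v) - f x)^2] vanishes at [s = 0], and
    [2 a b <= a^2 + b^2] gives [I' <= I + |v|^2 energy]. Gronwall's lemma for
    [I + |v|^2 energy] concludes at [s = 1]. *)
Lemma shift_bound A v f : bounded_open A -> C1bar f ->
  (forall x s, A x -> 0 <= s <= 1 -> Omega (x + s *: v)) ->
  integ A (fun x => (f (x + v) - f x) ^+ 2) <=
  expR 1 * (dot v v * dirichlet_energy f).
Proof.
move=> bA Cf AO; have [U [oU OU hf]] := Cf.
have cO := bounded_open_compact bO.
have OsU : Omega `<=` U by move=> x /subset_closure /OU.
have AOs s : 0 <= s <= 1 -> A `<=` [set x | Omega (x + s *: v)].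
  by move=> hs x Ax; exact: AO.
have AsO : A `<=` Omega.
  by move=> x Ax; have := AO x 0 Ax; rewrite scale0r addr0 lexx ler01; exact.
have ifO := C1bar_integrand Cf.
have iDO : integrand Omega (fun x => 'D_v f x).
  by apply: (C1_integrand oU cO OU) => x; exact: hf.2.
pose D s x := f (x + s *: v) - f x.
have iD s : 0 <= s <= 1 -> integrand A (D s).
  move=> hs; apply: integrandB; last exact: integrandS ifO.
  by apply: integrandS (integrand_translate (s *: v) ifO); exact: AOs.
have idD s : 0 <= s <= 1 -> integrand A (fun x => 'D_v f (x + s *: v)).
  move=> hs; apply: integrandS (integrand_translate (s *: v) iDO); exact: AOs.
have [Mf hMf] := ifO.2; have [Md hMd] := iDO.2.
have [cont der] : {within `[0, 1], continuous (fun s => integ A (fun x => D s x ^+ 2))} /\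
  (forall s : R, 0 < s < 1 -> is_derive s 1 (fun s => integ A (fun x => D s x ^+ 2))
     (integ A (fun x => 2 * (D s x * 'D_v f (x + s *: v))))).
  apply: (@integ_path _ _ A (fun s x => D s x ^+ 2)
    (fun s x => 2 * (D s x * 'D_v f (x + s *: v))) 1 (2 * ((Mf + Mf) * Md))) => //.
  - by move=> s hs; apply: integrandX; exact: iD.
  - move=> s x hs Ax.
    have h1 := is_derive_line (hf.1 _ (OsU _ (AO _ _ Ax hs))).
    have h2 := is_deriveB h1 (is_derive_cst (f x) s 1).
    have := is_deriveX 2 h2; move/is_derive_eq; apply.
    by rewrite subr0 /GRing.scale /= expr1; rewrite mulrA.
  - move=> s x hs Ax; rewrite normrM (ger0_norm (_ : 0 <= 2)) //.
    rewrite ler_pM2l // normrM ler_pM //; last exact: hMd (AO _ _ Ax hs).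
    apply: le_trans (ler_normB _ _) _; apply: lerD; apply: hMf; [exact: AO|exact: AsO].
have E0 := energy_ge0 f.
set J := dot v v * dirichlet_energy f; have J0 : 0 <= J.
  by rewrite mulr_ge0 ?dot_ge0.
pose psi s := integ A (fun x => D s x ^+ 2) + J.
have bound : psi 1 <= psi 0 * expR (1 * 1).
  apply: (@gronwall _ psi (fun s => integ A (fun x => 2 * (D s x * 'D_v f (x + s *: v)))) 1 1) => //.
  - move=> s; have c2 : {within `[0, 1 : R], continuous (fun _ : R => J)}.
      by apply: continuous_subspaceT => y; exact: cst_continuous.
    exact: (cvgD (cont s) (c2 s)).
  - move=> s hs; have := is_deriveD (der s hs) (is_derive_cst J s 1).
    by move/is_derive_eq; apply; rewrite addr0.
  move=> s /andP[s0 s1]; have hs : 0 <= s <= 1 by rewrite !ltW.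
  rewrite mul1r /psi.
  apply: (@le_trans _ _ (integ A (fun x => D s x ^+ 2) +
      integ A (fun x => 'D_v f (x + s *: v) ^+ 2))).
    have i1 := integrandX 2 (iD s hs); have i2 := integrandX 2 (idD s hs).
    rewrite -integD //; apply: integ_le => //; last 2 first.
    + exact: integrandD.
    + move=> x _; have := sqr_ge0 (D s x - 'D_v f (x + s *: v)); nra.
    by apply: integrandZ; apply: integrandM; [exact: iD|exact: idD].
  rewrite lerD2l /J.
  have iv2 := integrandX 2 iDO.
  apply: (@le_trans _ _ (integ Omega (fun x => 'D_v f x ^+ 2))).
    rewrite -[leRHS](integ_translate (s *: v) bO iv2).
    apply: integ_subset => //; [exact: bounded_open_translate|exact: AOs| |].
      exact: (integrand_translate (s *: v) iv2).
    by move=> x _; exact: sqr_ge0.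
  have ig := C1bar_grad2 Cf.
  rewrite -integZ //; apply: integ_le => //; first exact: integrandZ.
  move=> x Ox; rewrite (deriveE_dot _ (hf.1 _ (OsU _ Ox))) mulrC.
  exact: dot_cauchy.
have psi0 : psi 0 = J.
  rewrite /psi (eq_integ (g := fun=> 0)); last first.
    by move=> x _; rewrite /D scale0r addr0 subrr expr0n.
  by rewrite integ_cst // mul0r add0r.
rewrite psi0 mulr1 mulrC in bound.
apply: le_trans bound; rewrite /psi.
rewrite (eq_integ (g := fun x => D 1 x ^+ 2)); last first.
  by move=> x _; rewrite /D scale1r.
by rewrite lerDl.
Qed.

(** The energy is taken over all of [Omega], and not over [A] only: this is
    what makes the notion stable under overlapping unions and under
    translations inside [Omega]. *)
Definition poincare_set A := [/\ bounded_open A, A `<=` Omega &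
  exists2 C, 0 <= C & forall f, C1bar f -> exists k,
    integ A (fun x => (f x - k) ^+ 2) <= C * dirichlet_energy f].

Lemma dot_le_norm v : dot v v <= d%:R * `|v| ^+ 2.
Proof.
rewrite /dot -[d in d%:R]card_ord -sumr_const mulr_suml; apply: ler_sum => i _.
rewrite mul1r -expr2 -(real_normK (num_real (v 0 i))).
by rewrite ler_pXn2r ?nnegrE // coord_le_norm.
Qed.

(** Expanding the square: the inner integral is a quadratic polynomial in
    [f x], so it is again an integrand. *)
Lemma integ_pairs B f : bounded_open B -> integrand B f ->
  integrand B (fun x => integ B (fun y => (f y - f x) ^+ 2)) /\
  integ B (fun x => integ B (fun y => (f y - f x) ^+ 2)) =
  2 * (vol B * integ B (fun x => f x ^+ 2) - integ B f ^+ 2).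
Proof.
move=> bB hf; have hf2 := integrandX 2 hf.
set m1 := integ B f; set m2 := integ B (fun x => f x ^+ 2); set w := vol B.
have E (k : R) : integ B (fun y => (f y - k) ^+ 2) = m2 - 2 * k * m1 + k ^+ 2 * w.
  rewrite -integ_cst // -integZ // -integB //; last exact: integrandZ.
  rewrite -integD //; last 2 first.
  - by apply: integrandB => //; exact: integrandZ.
  - exact: integrand_cst.
  by apply: eq_integ => x _; ring.
have E2 : (fun x => integ B (fun y => (f y - f x) ^+ 2)) =
    fun x => m2 + (- (2 * m1) * f x + w * f x ^+ 2).
  by apply/funext => x; rewrite E; ring.
have i1 : integrand B (fun x => - (2 * m1) * f x) by exact: integrandZ.
have i2 : integrand B (fun x => w * f x ^+ 2) by exact: integrandZ.
rewrite E2; split.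
  by apply: integrandD; [exact: integrand_cst|exact: integrandD].
rewrite integD //; [|exact: integrand_cst|exact: integrandD].
rewrite integD // !integZ // integ_cst // -/m1 -/m2 -/w; ring.
Qed.

Lemma integ_variance B f : bounded_open B -> 0 < vol B -> integrand B f ->
  integ B (fun x => (f x - integ B f / vol B) ^+ 2) =
  (2 * vol B)^-1 * integ B (fun x => integ B (fun y => (f y - f x) ^+ 2)).
Proof.
move=> bB v0 hf; have [_ ->] := integ_pairs bB hf.
have hf2 := integrandX 2 hf; set k := integ B f / vol B.
have -> : integ B (fun x => (f x - k) ^+ 2) = integ B (fun x => f x ^+ 2)
   - 2 * k * integ B f + k ^+ 2 * vol B.
  rewrite -integ_cst // -integZ // -integB //; last exact: integrandZ.
  rewrite -integD //; last 2 first.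
  - by apply: integrandB => //; exact: integrandZ.
  - exact: integrand_cst.
  by apply: eq_integ => x _; ring.
by rewrite /k; field; rewrite gt_eqF.
Qed.

(** The mean over pairs of points of a ball, written as a mean over
    displacements, is controlled by [shift_bound]. *)
Lemma poincare_ball x0 r : 0 < r -> ball x0 (3 * r) `<=` Omega ->
  poincare_set (ball x0 r).
Proof.
move=> r0 BO; pose B := ball x0 r.
have bB : bounded_open B by exact: bounded_open_ball.
have v0 : 0 < vol B by apply: vol_gt0 => //; exists x0; exact: ballxx.
have BsO : B `<=` Omega.
  by move=> x xB; apply: BO; move: xB; apply: le_ball; lra.
pose K := expR 1 * (d%:R * (2 * r) ^+ 2).
have K0 : 0 <= K by rewrite mulr_ge0 ?expR_ge0 // mulr_ge0 // sqr_ge0.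
pose V2 := vol (ball (0 : 'rV[R]_d) (2 * r)).
split=> //; exists ((2 * vol B)^-1 * (K * V2)).
  apply: mulr_ge0; first by rewrite invr_ge0 mulr_ge0 // ltW.
  by apply: mulr_ge0 => //; exact: vol_ge0.
move=> f Cf; set E := dirichlet_energy f.
have E0 : 0 <= E := energy_ge0 f.
have hf : integrand B f by apply: integrandS (C1bar_integrand Cf).
exists (integ B f / vol B); rewrite integ_variance // -mulrA.
rewrite ler_pM2l ?invr_gt0 ?mulr_gt0 //.
have [ig _] := integ_pairs bB hf.
pose P := @rV_of_tuple R d @^-1` B.
have mP : measurable P by apply: measurable_rV_ball.
pose G := (fun s => f (rV_of_tuple s)) \_ P.
have mG : measurable_fun setT G.
  apply/(measurable_restrictT _ mP); apply: integrand_measurable; first by case: bB.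
  by case: hf.
pose Phi (z : d.-tuple (measurableTypeR R) * d.-tuple (measurableTypeR R)) : \bar R :=
  (\1_P z.1 * \1_P z.2 * (G z.2 - G z.1) ^+ 2)%:E.
have Phi0 z : (0 <= Phi z)%E.
  by rewrite lee_fin; apply: mulr_ge0; [exact: mulr_ge0|exact: sqr_ge0].
have mPhi : measurable_fun setT Phi.
  apply/measurable_EFinP; apply: measurable_funM.
    by apply: measurable_funM; apply: measurableT_comp => //; exact: measurable_indic.
  by apply: measurable_funX; apply: measurable_funB; apply: measurableT_comp.
have inP s : P s -> \1_P s = 1 :> R by move=> h; rewrite indicE mem_set.
have ninP s : ~ P s -> \1_P s = 0 :> R by move=> h; rewrite indicE memNset.
have GP s : P s -> G s = f (rV_of_tuple s) by move=> h; rewrite /G patchE mem_set.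
have LHS : (\int[mu]_s \int[mu]_t Phi (s, t) =
    (integ B (fun x => integ B (fun y => (f y - f x) ^+ 2)))%:E)%E.
  rewrite integE // [RHS]integral_mkcond; apply: eq_integral => s _.
  have [Ps|nPs] := pselect (P s); last first.
    rewrite patchE (memNset nPs) integral0_eq // => t _.
    by rewrite /Phi /= (ninP s nPs) !mul0r.
  have is_ : integrand B (fun y => (f y - f (rV_of_tuple s)) ^+ 2).
    by apply: integrandX; apply: integrandB => //; exact: integrand_cst.
  rewrite patchE (mem_set Ps) integE // [RHS]integral_mkcond.
  apply: eq_integral => t _.
  rewrite /Phi /= (inP s Ps) mul1r (GP s Ps).
  have [Pt|nPt] := pselect (P t).
    by rewrite patchE (mem_set Pt) (inP t Pt) mul1r (GP t Pt).
  by rewrite patchE (memNset nPt) (ninP t nPt) mul0r.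
rewrite -lee_fin -LHS double_integral_translate //.
pose Q := @rV_of_tuple R d @^-1` (ball (0 : 'rV[R]_d) (2 * r)).
have mQ : measurable Q by exact: measurable_rV_ball.
apply: (@le_trans _ _ (\int[mu]_(h in Q) (K * E)%:E)%E); last first.
  have bQ := bounded_open_ball (0 : 'rV[R]_d) (2 * r).
  by rewrite -(integE bQ (integrand_cst _ (K * E))) integ_cst // lee_fin mulrAC.
pose Psi (z : d.-tuple (measurableTypeR R) * d.-tuple (measurableTypeR R)) :=
  Phi (z.1, tuple_translate (rV_of_tuple z.1) z.2).
have mPsi : measurable_fun setT Psi.
  apply: (measurableT_comp mPhi); apply/measurable_fun_pairP; split.
    exact: measurable_fst.
  exact: measurable_tuple_sum.
have sumE s h : rV_of_tuple (tuple_translate (rV_of_tuple s) h) =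
    rV_of_tuple s + rV_of_tuple h.
  by apply/rowP => i; rewrite !mxE tnth_mktuple mxE addrC.
rewrite [leRHS]integral_mkcond; apply: ge0_le_integral => //.
- by move=> h _; exact: integral_ge0.
- exact: (measurable_fun_fubini_tonelli_G Psi mPsi (fun z => Phi0 _)).
- by apply/(measurable_restrictT _ mQ); exact: measurable_cst.
move=> h _; have [Qh|nQh] := pselect (Q h); last first.
  rewrite patchE (memNset nQh) integral0_eq // => s _.
  rewrite /Phi /=; have [Ps|nPs] := pselect (P s); last by rewrite (ninP s nPs) !mul0r.
  have [Pt|nPt] := pselect (P (tuple_translate (rV_of_tuple s) h)); last first.
    by rewrite (ninP _ nPt) mulr0 mul0r.
  exfalso; apply: nQh; move: Ps Pt; rewrite /P /B /Q /= sumE.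
  rewrite -!ball_normE /= sub0r normrN => h1 h2.
  rewrite (_ : rV_of_tuple h = (x0 - rV_of_tuple s) -
    (x0 - (rV_of_tuple s + rV_of_tuple h))); last first.
    by apply/rowP => i; rewrite !mxE; ring.
  apply: le_lt_trans (ler_normB _ _) _.
  by rewrite (_ : 2 * r = r + r); [exact: ltrD|ring].
rewrite patchE (mem_set Qh); set v := rV_of_tuple h.
have hv : `|v| < 2 * r by move: Qh; rewrite /Q /= -ball_normE /= sub0r normrN.
have BOv x s : B x -> 0 <= s <= 1 -> Omega (x + s *: v).
  move=> xB /andP[s0 s1]; apply: BO; move: xB; rewrite /B -!ball_normE /= => xB.
  rewrite opprD addrA; apply: le_lt_trans (ler_normB _ _) _.
  rewrite (_ : 3 * r = r + 2 * r); last by ring.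
  apply: ltrD => //; rewrite normrZ; apply: le_lt_trans hv.
  by apply: ler_piMl => //; rewrite ger0_norm.
have iv : integrand B (fun x => (f (x + v) - f x) ^+ 2).
  apply: integrandX; apply: integrandB => //.
  apply: integrandS (integrand_translate v (C1bar_integrand Cf)).
  by move=> x Bx /=; have := BOv x 1 Bx; rewrite scale1r lexx ler01; exact.
apply: (@le_trans _ _ (integ B (fun x => (f (x + v) - f x) ^+ 2))%:E); last first.
  rewrite lee_fin; apply: le_trans (shift_bound bB Cf BOv) _.
  have hd : dot v v <= d%:R * (2 * r) ^+ 2.
    apply: le_trans (dot_le_norm v) _; apply: ler_wpM2l => //.
    by rewrite ler_pXn2r ?nnegrE ?mulr_ge0 ?(ltW r0) // ltW.
  rewrite (_ : K * E = expR 1 * ((d%:R * (2 * r) ^+ 2) * E)); last exact/esym/mulrA.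
  exact: (ler_wpM2l (expR_ge0 1) (ler_wpM2r E0 hd)).
have mPh : measurable_fun setT (fun s => Psi (s, h)).
  exact: (measurableT_comp mPsi (pair2_measurable h)).
have mv : measurable_fun setT
    ((fun s => ((f (rV_of_tuple s + v) - f (rV_of_tuple s)) ^+ 2)%:E) \_ P).
  apply/(measurable_restrictT _ mP); apply/measurable_EFinP.
  apply: (integrand_measurable (f := fun x => (f (x + v) - f x) ^+ 2)).
    by case: bB.
  by case: iv.
rewrite integE // [leRHS]integral_mkcond; apply: ge0_le_integral => //.
move=> s _; rewrite /Phi /=.
have [Ps|nPs] := pselect (P s); last by rewrite patchE (memNset nPs) (ninP s nPs) !mul0r.
rewrite patchE (mem_set Ps) (inP s Ps) mul1r.
have [Pt|nPt] := pselect (P (tuple_translate (rV_of_tuple s) h)); last first.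
  by rewrite (ninP _ nPt) mul0r lee_fin sqr_ge0.
by rewrite (inP _ Pt) mul1r (GP _ Pt) (GP _ Ps) sumE.
Qed.

Lemma sqrD_le (a b : R) : (a + b) ^+ 2 <= 2 * a ^+ 2 + 2 * b ^+ 2.
Proof. by have := sqr_ge0 (a - b); nra. Qed.

Lemma C1bar_sq A f k : A `<=` Omega -> C1bar f ->
  integrand A (fun x => (f x - k) ^+ 2).
Proof.
move=> AO Cf; apply: integrandX; apply: integrandB; last exact: integrand_cst.
by apply: integrandS AO _; exact: C1bar_integrand.
Qed.

(** On the overlap [f] is close to both constants, which are therefore close
    to each other. *)
Lemma poincare_setU A B : poincare_set A -> poincare_set B -> A `&` B !=set0 ->
  poincare_set (A `|` B).
Proof.
move=> [bA AO [CA CA0 hA]] [bB BO [CB CB0 hB]] AB0.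
have bAB : bounded_open (A `&` B) by apply: bounded_openI => //; case: bB.
have v0 : 0 < vol (A `&` B) by exact: vol_gt0.
have ABO : A `|` B `<=` Omega by move=> x [/AO|/BO].
split=> //; first exact: bounded_openU.
pose q := 2 * vol B / vol (A `&` B) * (2 * CA + 2 * CB).
have q0 : 0 <= q.
  by rewrite mulr_ge0 ?divr_ge0 ?mulr_ge0 ?addr_ge0 ?mulr_ge0 ?vol_ge0 // ltW.
exists (CA + (2 * CB + q)); first by apply: addr_ge0 => //; apply: addr_ge0 => //; exact: mulr_ge0.
move=> f Cf; have [k hk] := hA f Cf; have [l hl] := hB f Cf; exists k.
have E0 := energy_ge0 f; set E := dirichlet_energy f in hk hl E0 *.
have iA k' : integrand A (fun x => (f x - k') ^+ 2) by exact: C1bar_sq.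
have iB k' : integrand B (fun x => (f x - k') ^+ 2) by exact: C1bar_sq.
have iAB k' : integrand (A `&` B) (fun x => (f x - k') ^+ 2).
  by apply: C1bar_sq => // x [/AO].
have kl : (k - l) ^+ 2 * vol (A `&` B) <= (2 * CA + 2 * CB) * E.
  rewrite -integ_cst //.
  apply: (@le_trans _ _ (integ (A `&` B)
    (fun x => 2 * (f x - k) ^+ 2 + 2 * (f x - l) ^+ 2))).
    apply: integ_le => //; first exact: integrand_cst.
      by apply: integrandD; exact: integrandZ.
    move=> x _; rewrite (_ : (k - l) ^+ 2 = (- (f x - k) + (f x - l)) ^+ 2).
      by rewrite -(sqrrN (f x - k)); exact: sqrD_le.
    by ring.
  rewrite integD //; [|exact: integrandZ..]; rewrite !integZ //.
  rewrite [leRHS]mulrDl; apply: lerD; rewrite -mulrA ler_pM2l //.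
    apply: le_trans (integ_subset bAB bA (@subIsetl _ A B) (iA k) _) hk => x _.
    exact: sqr_ge0.
  apply: le_trans (integ_subset bAB bB (@subIsetr _ A B) (iB l) _) hl => x _.
  exact: sqr_ge0.
apply: le_trans (integ_setU_le bA bB _ _) _.
- exact: C1bar_sq.
- by move=> x _; exact: sqr_ge0.
rewrite [leRHS]mulrDl; apply: lerD => //.
apply: (@le_trans _ _ (integ B (fun x => 2 * (f x - l) ^+ 2 + 2 * (k - l) ^+ 2))).
  apply: integ_le => //.
    by apply: integrandD; [exact: integrandZ|exact: integrand_cst].
  move=> x _; rewrite (_ : (f x - k) ^+ 2 = ((f x - l) + - (k - l)) ^+ 2).
    by rewrite -(sqrrN (k - l)); exact: sqrD_le.
  by ring.
rewrite integD //; [|exact: integrandZ|exact: integrand_cst].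
rewrite integZ // integ_cst //.
rewrite [leRHS]mulrDl -mulrA; apply: lerD; first by rewrite ler_pM2l.
have h : (k - l) ^+ 2 <= (2 * CA + 2 * CB) * E / vol (A `&` B).
  by rewrite ler_pdivlMr.
rewrite (_ : q * E = 2 * vol B * ((2 * CA + 2 * CB) * E / vol (A `&` B))); last first.
  by rewrite /q; ring.
rewrite (_ : 2 * (k - l) ^+ 2 * vol B = 2 * vol B * (k - l) ^+ 2); last by ring.
by apply: ler_wpM2l => //; apply: mulr_ge0 => //; exact: vol_ge0.
Qed.

(** [f x] is compared with [f (x + v)] by [shift_bound], and [f (x + v)] with
    the constant of [B]. *)
Lemma poincare_shift A v B : bounded_open A -> A `<=` Omega -> poincare_set B ->
  (forall x s, A x -> 0 <= s <= 1 -> Omega (x + s *: v)) ->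
  (forall x, A x -> B (x + v)) -> poincare_set A.
Proof.
move=> bA AO [bB BO [C C0 hB]] AOv ABv; split=> //.
pose q := 2 * (expR 1 * dot v v).
have q0 : 0 <= q.
  by apply: mulr_ge0 => //; apply: mulr_ge0; [exact: expR_ge0|exact: dot_ge0].
exists (q + 2 * C); first by rewrite addr_ge0 // mulr_ge0.
move=> f Cf; have [k hk] := hB f Cf; exists k.
have ifv : integrand A (fun x => f (x + v)).
  by apply: integrandS (integrand_translate v (C1bar_integrand Cf)) => x /ABv /BO.
have if_ : integrand A f by apply: integrandS AO (C1bar_integrand Cf).
have i1 : integrand A (fun x => (f (x + v) - f x) ^+ 2).
  by apply: integrandX; exact: integrandB.
have i2 : integrand A (fun x => (f (x + v) - k) ^+ 2).
  by apply: integrandX; apply: integrandB => //; exact: integrand_cst.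
apply: (@le_trans _ _ (integ A
    (fun x => 2 * (f (x + v) - f x) ^+ 2 + 2 * (f (x + v) - k) ^+ 2))).
  apply: integ_le => //; [exact: C1bar_sq|by apply: integrandD; exact: integrandZ|].
  move=> x _.
  rewrite (_ : (f x - k) ^+ 2 = (- (f (x + v) - f x) + (f (x + v) - k)) ^+ 2).
    by rewrite -(sqrrN (f (x + v) - f x)); exact: sqrD_le.
  by ring.
rewrite integD //; [|exact: integrandZ..]; rewrite !integZ //.
rewrite [leRHS]mulrDl; apply: lerD; rewrite -!mulrA ler_pM2l //.
  exact: shift_bound.
apply: le_trans hk; have hB2 : integrand B (fun x => (f x - k) ^+ 2) by exact: C1bar_sq.
rewrite -[leRHS](integ_translate v bB hB2).
apply: integ_subset => //; first exact: bounded_open_translate.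
  exact: (integrand_translate v hB2).
by move=> x _; exact: sqr_ge0.
Qed.

(** Moving inwards along the normal stays in the domain and brings a
    neighbourhood of the boundary point into a ball well inside it. *)
Lemma poincare_boundary y0 : boundary Omega y0 ->
  exists2 r, 0 < r & poincare_set (Omega `&` ball y0 r).
Proof.
have oO : open Omega by case: bO.
move=> by0; have [phi [U [oU Uy0 smU grU EU]]] := sm by0.
have ch : chart Omega U phi by split.
have c1 := chart_C1 ch; have p0 := chart_boundary0 oO ch Uy0 by0.
set nu := grad phi y0; have nu0 : 0 < dot nu nu by apply: dot_gt0; exact: grU.
have : \forall y \near y0, U y /\ 0 < 'D_nu phi y.
  have h1 : \forall y \near y0, 0 < 'D_nu phi y.
    by apply: (cvgr_gt _ (c1.2 nu y0 Uy0)); rewrite (deriveE_dot _ (c1.1 _ Uy0)).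
  by apply: filterS2 (open_nbhs_nbhs (conj oU Uy0)) h1.
move=> /nbhs_ballP [rho /= rho0 Hrho].
pose s1 := rho / (2 * (`|nu| + 1)).
have s10 : 0 < s1 by rewrite divr_gt0 // mulr_gt0 // ltr_wpDl.
have s1nu : s1 * `|nu| < rho / 2.
  rewrite /s1 mulrAC ltr_pdivrMr ?mulr_gt0 ?ltr_wpDl //.
  rewrite mulrA divfK // ltr_pM2l //.
  by have := normr_ge0 nu; lra.
pose v := - (s1 *: nu).
have inB x s : ball y0 (rho / 2) x -> 0 <= s <= s1 -> ball y0 rho (x - s *: nu).
  rewrite -!ball_normE /= => xr /andP[s0 ss].
  rewrite (_ : y0 - _ = (y0 - x) + s *: nu); last first.
    by apply/rowP => i; rewrite !mxE; ring.
  rewrite (splitr rho); apply: le_lt_trans (ler_normD _ _) _.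
  apply: ltrD => //; rewrite normrZ; apply: le_lt_trans s1nu.
  by apply: ler_wpM2r => //; rewrite ger0_norm.
have decr x s : ball y0 (rho / 2) x -> 0 <= s <= s1 -> phi x <= 0 ->
    (s = 0 -> phi x < 0) -> Omega (x - s *: nu).
  move=> xr hs px px0; have [Uz _] := Hrho _ (inB _ _ xr hs).
  apply/(chart_in ch Uz); have [s0|s0] := eqVneq s 0.
    by rewrite s0 scale0r subr0 px0.
  move: (hs) => /andP[s0' ss].
  have sp : 0 < s by rewrite lt_neqAle eq_sym s0.
  have pt t : 0 <= t <= s -> U (x - s *: nu + t *: nu) /\
      0 < 'D_nu phi (x - s *: nu + t *: nu).
    move=> /andP[t0 ts]; rewrite -addrA -scaleNr -scalerDl.
    rewrite (_ : - s + t = - (s - t)); last by ring.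
    rewrite scaleNr; apply: Hrho; apply: inB => //.
    by rewrite subr_ge0 ts /=; apply: le_trans ss; rewrite gerBl.
  have [t||t] := @MVT _ (fun t => phi (x - s *: nu + t *: nu))
     (fun t => 'D_nu phi (x - s *: nu + t *: nu)) 0 s sp.
  - rewrite in_itv /= => /andP[t0 ts]; apply: is_derive_line.
    by apply: c1.1; apply: (pt t _).1; rewrite !ltW.
  - apply: derivable_within_continuous => t; rewrite in_itv /= => ht.
    by have [] := is_derive_line (c1.1 _ (pt t ht).1).
  rewrite in_itv /= => /andP[t0 ts] E.
  have ht : 0 <= t <= s by rewrite !ltW.
  have := mulr_gt0 (pt t ht).2 sp.
  move: E; rewrite subrK scale0r addr0 subr0 => <-; rewrite subr_gt0 => h.
  exact: lt_le_trans h px.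
have y0r : ball y0 (rho / 2) y0 by apply: ballxx; rewrite divr_gt0.
have s1s1 : 0 <= s1 <= s1 by rewrite lexx ltW.
have Oz : Omega (y0 - s1 *: nu).
  by apply: decr => //; [rewrite p0|move=> s1z; move: s10; rewrite s1z ltxx].
have /nbhs_ballP[e /= e0 He] : nbhs (y0 - s1 *: nu) Omega.
  exact: open_nbhs_nbhs.
have e3 : 0 < e / 3 by rewrite divr_gt0.
have PB : poincare_set (ball (y0 - s1 *: nu) (e / 3)).
  by apply: poincare_ball => //; rewrite mulrC divfK.
pose r := Num.min (rho / 2) (e / 3).
have r0 : 0 < r by rewrite lt_min e3 divr_gt0.
exists r => //; apply: (poincare_shift (v := v) _ _ PB).
- by apply: bounded_openI => //; exact: open_ball.
- by move=> x [].
- move=> x s [Ox xr] /andP[s0 ss]; rewrite /v scalerN scalerA.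
  have xr2 : ball y0 (rho / 2) x by move: xr; apply: le_ball; rewrite ge_min lexx.
  have [Ux _] : U x /\ 0 < 'D_nu phi x.
    by have := inB x 0 xr2; rewrite scale0r subr0 lexx ltW // => /(_ isT) /Hrho.
  have px : phi x < 0 by apply/(chart_in ch Ux).
  apply: decr => //; last by rewrite ltW.
  by rewrite mulr_ge0 ?(ltW s10) //= ler_piMl // ltW.
- move=> x [_ xr]; rewrite /v -!ball_normE /= in xr *.
  rewrite (_ : y0 - s1 *: nu - _ = y0 - x); last first.
    by apply/rowP => i; rewrite !mxE; ring.
  by apply: lt_le_trans xr _; rewrite ge_min lexx orbT.
Qed.

End poincare_wirtinger.

Section wirtinger.
Variables (R : realType) (d : nat) (Omega : set 'rV[R]_d).
Hypotheses (bO : bounded_open Omega) (sm : smooth_boundary Omega).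
Hypothesis cO : connected Omega.
Implicit Types (A B : set 'rV[R]_d) (x y : 'rV[R]_d).

Let oO : open Omega. Proof. by case: bO. Qed.

Lemma interior_ball x : Omega x ->
  exists2 r, 0 < r & poincare_set Omega (ball x r).
Proof.
move=> Ox; have /nbhs_ballP[e /= e0 He] : nbhs x Omega by exact: open_nbhs_nbhs.
exists (e / 3); first by rewrite divr_gt0.
by apply: poincare_ball => //; rewrite ?divr_gt0 // mulrC divfK.
Qed.

(** The points that share a [poincare_set] with [x0] form a subset of [Omega]
    that is open and closed in it. *)
Lemma poincare_connected x0 x : Omega x0 -> Omega x ->
  exists A, [/\ poincare_set Omega A, A x0 & A x].
Proof.
move=> Ox0 Ox; pose S := [set x | Omega x /\
  exists A, [/\ poincare_set Omega A, A x0 & A x]].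
suff SE : S = Omega by have [] : S x by rewrite SE.
apply: cO.
- exists x0; split=> //; have [r r0 hr] := interior_ball Ox0.
  by exists (ball x0 r); split=> //; exact: ballxx.
- exists S; last by apply/seteqP; split => y [] //.
  rewrite openE => y [Oy [A [pA Ax0 Ay]]].
  have [[oA _] AO _] := pA.
  apply: filterS (open_nbhs_nbhs (conj oA Ay)) => z Az; split; first exact: AO.
  by exists A.
- exists (closure S); first exact: closed_closure.
  apply/seteqP; split => y; first by move=> Sy; split; [case: Sy|exact: subset_closure].
  move=> [Oy cSy]; split=> //.
  have [r r0 hr] := interior_ball Oy.
  have [z [[_ [A [pA Ax0 Az]]] yz]] := cSy _ (nbhsx_ballx y r r0).
  exists (A `|` ball y r); split; [|by left|by right; exact: ballxx].
  by apply: poincare_setU => //; exists z.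
Qed.

(** By compactness of the closure, finitely many interior balls and boundary
    neighbourhoods cover [Omega]; each is linked to a base point through
    [poincare_connected]. *)
Lemma poincare_wirtinger : exists2 C, 0 <= C & forall f, C1bar Omega f ->
  exists k, integ Omega (fun x => (f x - k) ^+ 2) <= C * dirichlet_energy Omega f.
Proof.
have [[x0 Ox0]|nO] := pselect (exists x0, Omega x0); last first.
  exists 0 => // f Cf; exists 0; rewrite mul0r.
  rewrite (eq_integ (g := fun=> 0)); first by rewrite integ_cst // mul0r.
  by move=> x Ox; exfalso; apply: nO; exists x.
suff : poincare_set Omega Omega by case.
pose P (y : 'rV[R]_d) (N : set 'rV[R]_d) := closure Omega y ->
  [/\ open N, N y & poincare_set Omega (Omega `&` N)].
have : forall y, exists N, P y N.
  move=> y; have [Oy|nOy] := pselect (Omega y).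
    have [r r0 [bB BO hr]] := interior_ball Oy; exists (ball y r) => _.
    split; [exact: open_ball|exact: ballxx|].
    by rewrite (_ : Omega `&` ball y r = ball y r) //; exact/setIidPr.
  have [cy|ncy] := pselect (closure Omega y); last by exists set0.
  have by_ : boundary Omega y by split=> //; rewrite ((interior_id Omega).1 oO).
  have [r r0 hr] := poincare_boundary bO sm by_; exists (ball y r) => _.
  by split=> //; [exact: open_ball|exact: ballxx].
move=> /choice [N hN].
have := bounded_open_compact bO; rewrite compact_cover.
move=> /(_ _ (closure Omega) N); case=> [y /hN []//|y cy|D sD cov].
  by exists y => //; case: (hN y cy).
have [A [pA Ax0 hA]] : exists A, [/\ poincare_set Omega A, A x0 &
    forall y, y \in finmap.enum_fset D -> Omega `&` N y `<=` A].
  have : forall y, y \in finmap.enum_fset D -> closure Omega y.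
    by move=> y /sD; rewrite inE.
  elim: (finmap.enum_fset D) => [|y l IH] H.
    have [r r0 hr] := interior_ball Ox0.
    by exists (ball x0 r); split=> //; exact: ballxx.
  have [A [pA Ax0 hA]] := IH (fun z zl => H z (mem_behead (s := y :: l) zl)).
  have cy := H y (mem_head _ _); have [oN Ny pN] := hN y cy.
  have [z [Oz Nz]] := cy _ (open_nbhs_nbhs (conj oN Ny)).
  have [B [pB Bx0 Bz]] := poincare_connected Ox0 Oz.
  exists ((A `|` B) `|` (Omega `&` N y)); split.
  - apply: poincare_setU => //; last by exists z; split; [right|].
    by apply: poincare_setU => //; exists x0.
  - by left; left.
  - move=> w; rewrite inE => /orP[/eqP ->|wl] u Hu; first by right.
    by left; left; exact: (hA w wl).
suff AE : A = Omega by rewrite AE in pA.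
apply/seteqP; split => [|x Ox]; first by case: pA.
have [y Dy Nyx] := cov x (@subset_closure _ _ _ Ox).
exact: (hA y Dy).
Qed.

(** The mean minimises the quadratic deviation. *)
Lemma poincare_mean : exists2 C, 0 <= C & forall f m, C1bar Omega f ->
  integ Omega (fun x => f x - m) = 0 ->
  integ Omega (fun x => (f x - m) ^+ 2) <= C * dirichlet_energy Omega f.
Proof.
have [C C0 hC] := poincare_wirtinger; exists C => // f m Cf mean0.
have [k hk] := hC f Cf; apply: le_trans hk.
have hf := C1bar_integrand bO Cf.
have i0 : integrand Omega (fun x => f x - m).
  by apply: integrandB => //; exact: integrand_cst.
have i2 := integrandX 2 i0.
rewrite (eq_integ (f := fun x => (f x - k) ^+ 2) (g := fun x =>
  (f x - m) ^+ 2 + (2 * (m - k) * (f x - m) + (m - k) ^+ 2))); last first.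
  by move=> x _; ring.
rewrite integD //; last first.
  by apply: integrandD; [exact: integrandZ|exact: integrand_cst].
rewrite integD //; [|exact: integrandZ|exact: integrand_cst].
rewrite integZ // mean0 mulr0 add0r lerDl; apply: integ_ge0 => x _.
exact: sqr_ge0.
Qed.

End wirtinger.

(** * Entropy balance at a fixed time *)

Section energy_identity.
Variables (R : realType) (d : nat) (Omega : set 'rV[R]_d).
Hypotheses (bO : bounded_open Omega) (sm : smooth_boundary Omega).
Variables (U : set 'rV[R]_d) (D1 D2 eps : R).
Variables (a b phi a' b' : 'rV[R]_d -> R) (u : 'rV[R]_d -> 'rV[R]_d).
Hypotheses (oU : open U) (OU : closure Omega `<=` U).
Hypotheses (D10 : 0 < D1) (D20 : 0 < D2) (eps0 : 0 < eps).
Hypotheses (Ca : C1 U a) (Cb : C1 U b).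
Hypotheses (CDa : forall v, C1 U (fun x => 'D_v a x))
  (CDb : forall v, C1 U (fun x => 'D_v b x))
  (CDphi : forall v, C1 U (fun x => 'D_v phi x))
  (Cu : forall i, C1 U (fun x => u x 0 i)).
Hypothesis eq_a : forall x, Omega x -> a' x + dot (u x) (grad a x) =
  D1 * divergence (fun y => grad a y + (1 * a y) *: grad phi y) x.
Hypothesis eq_b : forall x, Omega x -> b' x + dot (u x) (grad b x) =
  D2 * divergence (fun y => grad b y + (-1 * b y) *: grad phi y) x.
Hypothesis eq_phi : forall x, Omega x -> - (eps * laplacian phi x) = a x - b x.
Hypothesis eq_u : forall x, Omega x -> divergence u x = 0.
Hypothesis bd_u : forall x, boundary Omega x -> u x = 0.
Hypothesis bd_ab : forall x, boundary Omega x -> a x = b x.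
Hypothesis bd_n : forall x n, boundary Omega x -> outward_unit_normal Omega x n ->
  dot n (grad (fun y => a y + b y) x) = 0.
Variables F F1 F2 : R -> R.
Hypotheses (dF : forall s : R, is_derive s 1 F (F1 s))
  (dF1 : forall s : R, is_derive s 1 F1 (F2 s)) (cF2 : continuous F2).

(** The coefficient of the Laplacian of the potential once the drift term has
    been integrated by parts. *)
Definition legendre_part (F F1 : R -> R) (s : R) := s * F1 s - F s.

Definition dissipation x := F2 (a x) * grad2 a x + F2 (b x) * grad2 b x +
  eps^-1 * ((legendre_part F F1 (a x) - legendre_part F F1 (b x)) * (a x - b x)).

Let cF1 : continuous F1.
Proof.
move=> s; apply: differentiable_continuous; apply/derivable1_diffP.
by case: (dF1 s).
Qed.

Let e i : 'rV[R]_d := delta_mx 0 i.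

(** Minus the total flux of [F(a) / D1 + F(b) / D2]; on the boundary only
    [F1(a) * grad (a + b)] is left of it. *)
Let V x : 'rV[R]_d := \row_i (F1 (a x) * 'D_(e i) a x + F1 (b x) * 'D_(e i) b x
  + (F (a x) - F (b x)) * 'D_(e i) phi x
  - (D1^-1 * F (a x) + D2^-1 * F (b x)) * u x 0 i).

Let VE i : (fun x => V x 0 i) = fun x =>
  F1 (a x) * 'D_(e i) a x + F1 (b x) * 'D_(e i) b x
  + (F (a x) - F (b x)) * 'D_(e i) phi x
  - (D1^-1 * F (a x) + D2^-1 * F (b x)) * u x 0 i.
Proof. by apply/funext => x; rewrite mxE. Qed.

Let CF f : C1 U f -> C1 U (fun x => F (f x)).
Proof. by move=> hf; exact: (C1_comp oU hf dF cF1). Qed.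

Let CF1 f : C1 U f -> C1 U (fun x => F1 (f x)).
Proof. by move=> hf; exact: (C1_comp oU hf dF1 cF2). Qed.

Let CV i : C1 U (fun x => V x 0 i).
Proof.
rewrite VE; apply: (C1B oU).
  apply: (C1D oU); first apply: (C1D oU).
  - exact: (C1M oU (CF1 Ca) (CDa _)).
  - exact: (C1M oU (CF1 Cb) (CDb _)).
  - exact: (C1M oU (C1B oU (CF Ca) (CF Cb)) (CDphi _)).
exact: (C1M oU (C1D oU (C1Z _ oU (CF Ca)) (C1Z _ oU (CF Cb))) (Cu i)).
Qed.

Let tangential x psi : boundary Omega x -> local_defining_function Omega x psi ->
  dot (grad psi x) (V x) = 0.
Proof.
move=> bx lp; have Ux : U x by apply: OU; case: bx.
have := bd_n bx (ex_intro2 _ _ psi lp (erefl _)).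
have gp : grad psi x != 0 by case: lp => W [_ Wx _ /(_ _ Wx)].
rewrite dotZl => /eqP; rewrite mulf_eq0 invr_eq0 sqrtr_eq0 leNgt dot_gt0 //=.
move=> /eqP E; rewrite -[RHS](mulr0 (F1 (a x))) -E /dot mulr_sumr.
apply: eq_bigr => i _; have ui : u x 0 i = 0 by rewrite bd_u // mxE.
rewrite [V x 0 i]mxE ui mulr0 subr0 -bd_ab //.
have -> : grad (fun y => a y + b y) x 0 i = 'D_(e i) a x + 'D_(e i) b x.
  by rewrite gradE; exact: deriveD_fun _ (Ca.1 _ Ux) (Cb.1 _ Ux).
by rewrite subrr; ring.
Qed.

Let derive_F f x v : C1 U f -> U x -> 'D_v (fun y => F (f y)) x = F1 (f x) * 'D_v f x.
Proof. by move=> hf Ux; exact: (derive_comp_fun _ (hf.1 _ Ux) (dF _)). Qed.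

Let derive_F1 f x v : C1 U f -> U x -> 'D_v (fun y => F1 (f y)) x = F2 (f x) * 'D_v f x.
Proof. by move=> hf Ux; exact: (derive_comp_fun _ (hf.1 _ Ux) (dF1 _)). Qed.

Let divV x : U x -> divergence V x = \sum_i (
    F2 (a x) * 'D_(e i) a x ^+ 2 + F1 (a x) * 'D_(e i) (fun y => 'D_(e i) a y) x
  + F2 (b x) * 'D_(e i) b x ^+ 2 + F1 (b x) * 'D_(e i) (fun y => 'D_(e i) b y) x
  + (F1 (a x) * 'D_(e i) a x - F1 (b x) * 'D_(e i) b x) * 'D_(e i) phi x
  + (F (a x) - F (b x)) * 'D_(e i) (fun y => 'D_(e i) phi y) x
  - (D1^-1 * F1 (a x) * 'D_(e i) a x + D2^-1 * F1 (b x) * 'D_(e i) b x) * u x 0 i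
  - (D1^-1 * F (a x) + D2^-1 * F (b x)) * 'D_(e i) (fun y => u y 0 i) x).
Proof.
move=> Ux; apply: eq_bigr => i _; rewrite VE.
have da := (CF1 Ca).1 _ Ux; have db := (CF1 Cb).1 _ Ux.
have dFa := (CF Ca).1 _ Ux; have dFb := (CF Cb).1 _ Ux.
have dda := (CDa (e i)).1 _ Ux; have ddb := (CDb (e i)).1 _ Ux.
have ddp := (CDphi (e i)).1 _ Ux; have du := (Cu i).1 _ Ux.
have t1 := differentiableM_fun da dda; have t2 := differentiableM_fun db ddb.
have nFb := differentiableZ_fun (-1) dFb.
have sub f : (fun x => f x - F (b x)) = fun x => f x + -1 * F (b x).
  by apply/funext => y; rewrite mulN1r.
have t30 := differentiableD_fun dFa nFb; have t3 := differentiableM_fun t30 ddp.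
have t40 := differentiableD_fun (differentiableZ_fun D1^-1 dFa) (differentiableZ_fun D2^-1 dFb).
have t4 := differentiableM_fun t40 du.
have t4n := differentiableZ_fun (-1) t4.
have -> : (fun x => F1 (a x) * 'D_(e i) a x + F1 (b x) * 'D_(e i) b x
  + (F (a x) - F (b x)) * 'D_(e i) phi x
  - (D1^-1 * F (a x) + D2^-1 * F (b x)) * u x 0 i) =
  fun x => F1 (a x) * 'D_(e i) a x + F1 (b x) * 'D_(e i) b x
  + (F (a x) + -1 * F (b x)) * 'D_(e i) phi x
  + -1 * ((D1^-1 * F (a x) + D2^-1 * F (b x)) * u x 0 i).
  by apply/funext => y; ring.
rewrite (deriveD_fun _ (differentiableD_fun (differentiableD_fun t1 t2) t3) t4n).
rewrite (deriveD_fun _ (differentiableD_fun t1 t2) t3) (deriveD_fun _ t1 t2).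
rewrite (deriveM_fun _ da dda) (deriveM_fun _ db ddb) (deriveM_fun _ t30 ddp).
rewrite (deriveZ_fun _ _ t4) (deriveM_fun _ t40 du).
rewrite (deriveD_fun _ dFa nFb) (deriveZ_fun _ _ dFb).
rewrite (deriveD_fun _ (differentiableZ_fun D1^-1 dFa) (differentiableZ_fun D2^-1 dFb)).
rewrite !deriveZ_fun //.
rewrite (derive_F _ Ca Ux) (derive_F _ Cb Ux) (derive_F1 _ Ca Ux) (derive_F1 _ Cb Ux).
move: (F2 (a x)) (F2 (b x)) (F1 (a x)) (F1 (b x)) (F (a x)) (F (b x))
  ('D_(e i) (fun y => 'D_(e i) a y) x) ('D_(e i) (fun y => 'D_(e i) b y) x)
  ('D_(e i) (fun y => 'D_(e i) phi y) x) ('D_(e i) (fun y => u y 0 i) x)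
  ('D_(e i) a x) ('D_(e i) b x) ('D_(e i) phi x) (u x 0 i) (D1^-1) (D2^-1).
by move=> *; ring.
Qed.

Let div_flux (c : 'rV[R]_d -> R) z x : C1 U c -> (forall v, C1 U (fun x => 'D_v c x)) ->
  U x -> divergence (fun y => grad c y + (z * c y) *: grad phi y) x =
  \sum_i ('D_(e i) (fun y => 'D_(e i) c y) x + z * ('D_(e i) c x * 'D_(e i) phi x
    + c x * 'D_(e i) (fun y => 'D_(e i) phi y) x)).
Proof.
move=> Cc CDc Ux; apply: eq_bigr => i _.
have -> : (fun y => (grad c y + (z * c y) *: grad phi y) 0 i) =
  fun y => 'D_(e i) c y + z * (c y * 'D_(e i) phi y).
  by apply/funext => y; rewrite !mxE; ring.
have ddp := (CDphi (e i)).1 _ Ux.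
have t := differentiableM_fun (Cc.1 _ Ux) ddp.
rewrite (deriveD_fun _ ((CDc (e i)).1 _ Ux) (differentiableZ_fun z t)).
rewrite (deriveZ_fun _ _ t) (deriveM_fun _ (Cc.1 _ Ux) ddp).
by rewrite [X in _ * X]addrC [_ * 'D_(e i) c x]mulrC.
Qed.

Let entropy_balance x : Omega x ->
  D1^-1 * (F1 (a x) * a' x) + D2^-1 * (F1 (b x) * b' x) =
  divergence V x - dissipation x.
Proof.
move=> Ox; have Ux : U x by apply: OU; exact: subset_closure.
have Ea : a' x = D1 * divergence (fun y => grad a y + (1 * a y) *: grad phi y) x
   - dot (u x) (grad a x) by rewrite -eq_a // addrK.
have Eb : b' x = D2 * divergence (fun y => grad b y + (-1 * b y) *: grad phi y) x
   - dot (u x) (grad b x) by rewrite -eq_b // addrK.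
pose SAA := \sum_i 'D_(e i) (fun y => 'D_(e i) a y) x.
pose SBB := \sum_i 'D_(e i) (fun y => 'D_(e i) b y) x.
pose SPP := \sum_i 'D_(e i) (fun y => 'D_(e i) phi y) x.
pose SA2 := \sum_i 'D_(e i) a x ^+ 2.
pose SB2 := \sum_i 'D_(e i) b x ^+ 2.
pose SAP := \sum_i 'D_(e i) a x * 'D_(e i) phi x.
pose SBP := \sum_i 'D_(e i) b x * 'D_(e i) phi x.
pose SUA := \sum_i u x 0 i * 'D_(e i) a x.
pose SUB := \sum_i u x 0 i * 'D_(e i) b x.
pose SU := \sum_i 'D_(e i) (fun y => u y 0 i) x.
have Eu : SU = 0 := eq_u Ox.
have El : laplacian phi x = SPP.
  apply: eq_bigr => i _; congr (derive _ x _); apply/funext => y.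
  by rewrite gradE.
have Ep : eps^-1 * (a x - b x) = - SPP.
  by rewrite -eq_phi // El mulrN mulKf // gt_eqF.
have Eua : dot (u x) (grad a x) = SUA by apply: eq_bigr => i _; rewrite gradE.
have Eub : dot (u x) (grad b x) = SUB by apply: eq_bigr => i _; rewrite gradE.
have Ea2 : grad2 a x = SA2 by apply: eq_bigr => i _; rewrite gradE expr2.
have Eb2 : grad2 b x = SB2 by apply: eq_bigr => i _; rewrite gradE expr2.
have Efa : divergence (fun y => grad a y + (1 * a y) *: grad phi y) x =
    SAA + (1 * SAP + a x * SPP).
  rewrite (div_flux _ Ca CDa Ux) /SAA /SAP /SPP !mulr_sumr -!big_split /=.
  by apply: eq_bigr => i _; rewrite !mul1r.
have Efb : divergence (fun y => grad b y + (-1 * b y) *: grad phi y) x =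
    SBB + (-1 * SBP + (- b x) * SPP).
  rewrite (div_flux _ Cb CDb Ux) /SBB /SBP /SPP !mulr_sumr -!big_split /=.
  by apply: eq_bigr => i _; rewrite mulrDr !mulN1r mulNr.
have Ed : divergence V x = F2 (a x) * SA2 + F1 (a x) * SAA + F2 (b x) * SB2
    + F1 (b x) * SBB + F1 (a x) * SAP + (- F1 (b x)) * SBP
    + (F (a x) - F (b x)) * SPP + (- (D1^-1 * F1 (a x))) * SUA
    + (- (D2^-1 * F1 (b x))) * SUB + (- (D1^-1 * F (a x) + D2^-1 * F (b x))) * SU.
  rewrite divV // /SA2 /SAA /SB2 /SBB /SAP /SBP /SPP /SUA /SUB /SU.
  rewrite !mulr_sumr -!big_split /=; apply: eq_bigr => i _.
  move: (F2 (a x)) (F2 (b x)) (F1 (a x)) (F1 (b x)) (F (a x)) (F (b x))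
    ('D_(e i) (fun y => 'D_(e i) a y) x) ('D_(e i) (fun y => 'D_(e i) b y) x)
    ('D_(e i) (fun y => 'D_(e i) phi y) x) ('D_(e i) (fun y => u y 0 i) x)
    ('D_(e i) a x) ('D_(e i) b x) ('D_(e i) phi x) (u x 0 i) (D1^-1) (D2^-1).
  by move=> *; ring.
have n1 : D1 != 0 by rewrite gt_eqF.
have n2 : D2 != 0 by rewrite gt_eqF.
rewrite /dissipation (mulrCA eps^-1) Ep Ea Eb Efa Efb Eua Eub Ea2 Eb2 Ed Eu /legendre_part.
clear Ea Eb Ep Eua Eub Ea2 Eb2 Efa Efb Ed Eu El.
move: (F2 (a x)) (F2 (b x)) (F1 (a x)) (F1 (b x)) (F (a x)) (F (b x)) SAA SBB SPP
  SA2 SB2 SAP SBP SUA SUB (a x) (b x) n1 n2.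
by move=> *; field; apply/andP.
Qed.

Lemma dissipation_integrand : integrand Omega dissipation.
Proof.
have cO := bounded_open_compact bO.
have i0 f : C1 U f -> integrand Omega f.
  by move=> hf; apply: (C1_integrand oU cO OU) => x; exact: C1_continuous.
have i2 f : C1 U f -> integrand Omega (fun x => F2 (f x)).
  move=> hf; apply: (C1_integrand oU cO OU) => x Ux.
  by apply: continuous_comp; [exact: (C1_continuous hf Ux)|exact: cF2].
have il f : C1 U f -> integrand Omega (fun x => legendre_part F F1 (f x)).
  move=> hf; apply: integrandB; last exact: (i0 _ (CF hf)).
  by apply: integrandM; [exact: i0|exact: (i0 _ (CF1 hf))].
apply: integrandD; first apply: integrandD.
- by apply: integrandM; [exact: i2|exact: grad2_integrand oU OU Ca].
- by apply: integrandM; [exact: i2|exact: grad2_integrand oU OU Cb].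
apply: integrandZ; apply: integrandM; apply: integrandB;
  by [exact: il|exact: i0].
Qed.

(** By [entropy_balance] the two sides differ by the integral of the
    divergence of [V], which is tangent to the boundary. *)
Lemma energy_dissipation : integ Omega
    (fun x => D1^-1 * (F1 (a x) * a' x) + D2^-1 * (F1 (b x) * b' x)) =
  - integ Omega dissipation.
Proof.
have cO := bounded_open_compact bO.
rewrite (eq_integ entropy_balance) integB //.
- by rewrite (integ_divergence_eq0 bO oU OU CV tangential sm) sub0r.
- apply: (C1_integrand oU cO OU) => x Ux.
  by apply: continuous_sum_fun => i; exact: (CV i).2.
- exact: dissipation_integrand.
Qed.

End energy_identity.

(** * Entropy balance along a solution *)

Section slices.
Variables (R : realType) (d : nat).
Local Notation S := ('rV[R]_d * R)%type.
Implicit Types (c : S -> R) (U : set S) (x v : 'rV[R]_d) (t : R).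

Lemma derive_slice c x t v : 'D_v (at_time c t) x = 'D_((v, 0) : S) c (x, t).
Proof.
have E : (fun h : R => h^-1 *: ((at_time c t \o shift x) (h *: v) - at_time c t x)) =
    (fun h : R => h^-1 *: ((c \o shift ((x, t) : S)) (h *: ((v, 0) : S)) - c (x, t))).
  apply/funext => h; congr (_ *: (_ - _)); rewrite /= /at_time; congr c.
  by rewrite -[RHS]/(h *: v + x, h *: 0 + t) scaler0 add0r.
by rewrite /derive E.
Qed.

Lemma differentiable_embed x t : differentiable (fun y : 'rV[R]_d => (y, t) : S) x.
Proof.
apply: (@differentiable_pair _ _ _ _ id (cst t)); last exact: differentiable_cst.
by have [] := is_diff_id x.
Qed.

Lemma continuous_embed x t : {for x, continuous (fun y : 'rV[R]_d => (y, t) : S)}.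
Proof. exact: (differentiable_continuous (differentiable_embed x t)). Qed.

Definition slice U t := [set x | U (x, t)].

Lemma open_slice U t : open U -> open (slice U t).
Proof.
move=> oU; apply: (open_comp _ oU) => x _; exact: continuous_embed.
Qed.

Lemma C1_slice U c t : C1 U c -> C1 (slice U t) (at_time c t).
Proof.
move=> [dc cc]; split=> [x Ux|v x Ux].
  apply: (@differentiable_comp _ _ _ _ (fun y : 'rV[R]_d => (y, t) : S) c).
    exact: differentiable_embed.
  exact: dc.
rewrite (_ : (fun y => _) = (fun z => 'D_((v, 0) : S) c z) \o (fun y => (y, t))).
  by apply: continuous_comp; [exact: continuous_embed|exact: cc].
by apply/funext => y; rewrite derive_slice.
Qed.

Lemma is_derive_time c x t : differentiable c (x, t) ->
  is_derive t 1 (fun s => c (x, s)) ('D_((0, 1) : S) c (x, t)).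
Proof.
move=> dc; have E s : ((x, 0) : S) + s *: ((0, 1) : S) = (x, s).
  by rewrite -[LHS]/(x + s *: 0, 0 + s *: 1) scaler0 addr0 add0r [s *: 1]mulr1.
have := @is_derive_line _ _ c (x, 0) (0, 1) t; rewrite E => /(_ dc).
by congr (is_derive _ _ _ _); apply/funext => s; rewrite E.
Qed.

Lemma dtE c x t : differentiable c (x, t) -> dt c x t = 'D_((0, 1) : S) c (x, t).
Proof. by move=> /is_derive_time [_ <-]; rewrite /dt derive1E. Qed.

Lemma smooth_on_C1 A c : smooth_on A c ->
  exists U, [/\ open U, A `<=` U, C1 U c & forall w, C1 U (fun z => 'D_w c z)].
Proof.
move=> [U [oU AU sU]]; exists U; split=> //; first exact: (sU 1%N).
by move=> v; have [_ /(_ v)] := sU 2%N.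
Qed.

Lemma smooth_on_C1_coord A (u : S -> 'rV[R]_d) : smooth_on A u ->
  exists U, [/\ open U, A `<=` U & forall i, C1 U (fun z => u z 0 i)].
Proof.
move=> [U [oU AU sU]]; exists U; split=> // i; have [du cu] := sU 1%N.
have dc z : differentiable (fun y : 'rV[R]_d => y 0 i) z := differentiable_coord z 0 i.
split=> [z Uz|v z Uz].
  exact: (differentiable_comp (du z Uz) (dc _)).
apply: (continuous_openeq oU Uz (f := fun z => ('D_v u z) 0 i)); last first.
  apply: (@continuous_comp _ _ _ (fun z => 'D_v u z) (fun y : 'rV[R]_d => y 0 i)).
    exact: cu.
  exact: coord_continuous.
move=> y Uy; rewrite [RHS](deriveE _ (differentiable_comp (du y Uy) (dc _))).
rewrite (diff_comp (du y Uy) (dc _)) /= -(deriveE _ (du y Uy)).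
by rewrite -(deriveE _ (dc _)) derive_coord.
Qed.

End slices.

Section dynamics.
Variables (R : realType) (d : nat) (Omega : set 'rV[R]_d).
Hypotheses (bO : bounded_open Omega) (sm : smooth_boundary Omega).
Variables (D1 D2 eps nu kappa : R) (W : 'rV[R]_d -> R).
Variables (c1 c2 Phi : 'rV[R]_d * R -> R) (u : 'rV[R]_d * R -> 'rV[R]_d).
Hypotheses (D10 : 0 < D1) (D20 : 0 < D2) (eps0 : 0 < eps).
Hypothesis sol : global_smooth_NPNS_solution Omega D1 D2 eps nu kappa W c1 c2 Phi u.
Hypothesis bc : electroneutral_bc Omega c1 c2.
Variables F F1 F2 : R -> R.
Hypotheses (dF : forall s : R, is_derive s 1 F (F1 s))
  (dF1 : forall s : R, is_derive s 1 F1 (F2 s)) (cF2 : continuous F2).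

Definition entropy t := integ Omega
  (fun x => D1^-1 * F (c1 (x, t)) + D2^-1 * F (c2 (x, t))).

Definition entropy_loss t :=
  integ Omega (dissipation eps (at_time c1 t) (at_time c2 t) F F1 F2).

(** The equations hold at positive times only, but the solution is smooth up
    to [t = 0]; hence continuity on the closed interval and differentiability
    inside. *)
Lemma entropy_law T : 0 < T -> {within `[0, T], continuous entropy} /\
  (forall t : R, 0 < t < T -> is_derive t 1 entropy (- entropy_loss t)).
Proof.
move=> T0.
have cF1 : continuous F1.
  move=> s; apply: differentiable_continuous; apply/derivable1_diffP.
  by case: (dF1 s).
have [U1 [oU1 sU1 C1c1 CD1]] := smooth_on_C1 (c1_smooth sol).
have [U2 [oU2 sU2 C1c2 CD2]] := smooth_on_C1 (c2_smooth sol).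
have [UP [oUP sUP _ CDP]] := smooth_on_C1 (Phi_smooth sol).
have [Uu [oUu sUu C1u]] := smooth_on_C1_coord (u_smooth sol).
have inS x t : closure Omega x -> 0 <= t -> space_time Omega (x, t) by [].
have cO := bounded_open_compact bO.
have OO : Omega `<=` closure Omega := @subset_closure _ Omega.
pose g (z : 'rV[R]_d * R) := D1^-1 * (F1 (c1 z) * 'D_((0, 1) : 'rV[R]_d * R) c1 z)
  + D2^-1 * (F1 (c2 z) * 'D_((0, 1) : 'rV[R]_d * R) c2 z).
have cK := compact_setX cO (@segment_compact R 0 T).
have [M hM] : exists M, forall z, (closure Omega `*` `[0, T]) z -> `|g z| <= M.
  apply: compact_bounded_fun cK _ => -[x t] [/= Ox]; rewrite in_itv /= => /andP[t0 _].
  have u1 := sU1 _ (inS x t Ox t0); have u2 := sU2 _ (inS x t Ox t0).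
  have cF1c U c : C1 U c -> U (x, t) -> {for (x, t), continuous (fun z => F1 (c z))}.
    by move=> hc Uz; apply: continuous_comp; [exact: C1_continuous hc Uz|exact: cF1].
  apply: continuousD; apply: continuousM; try exact: cst_continuous.
    by apply: continuousM; [exact: cF1c C1c1 u1|exact: C1c1.2].
  by apply: continuousM; [exact: cF1c C1c2 u2|exact: C1c2.2].
have dtc (c : 'rV[R]_d * R -> R) U x (t : R) : C1 U c -> U (x, t) ->
    is_derive t 1 (fun s => F (c (x, s))) (F1 (c (x, t)) * 'D_((0, 1) : 'rV[R]_d * R) c (x, t)).
  move=> hc Uz; have h := is_derive_time (hc.1 _ Uz).
  exact: (is_derive1_comp (dF _) h).
have slU (U : set ('rV[R]_d * R)) (t : R) : space_time Omega `<=` U -> 0 <= t -> closure Omega `<=` slice U t.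
  by move=> sU t0 x Ox; apply: sU; exact: inS.
have iF (t : R) (c : 'rV[R]_d * R -> R) U : C1 U c -> open U -> space_time Omega `<=` U ->
    0 <= t -> integrand Omega (fun x => F (c (x, t))).
  move=> hc oU sU t0; have oS : open (slice U t) by exact: open_slice.
  have h : C1 (slice U t) (fun x => F (c (x, t))).
    have hs : C1 (slice U t) (at_time c t) by exact: C1_slice.
    exact (C1_comp oS hs dF cF1).
  apply: (C1_integrand oS cO (slU _ _ sU t0)) => x Ux.
  exact: (C1_continuous h Ux).
have [||| cont der] := @integ_path _ _ Omega
    (fun t x => D1^-1 * F (c1 (x, t)) + D2^-1 * F (c2 (x, t)))
    (fun t x => g (x, t)) T M bO T0.
- move=> t /andP[t0 _]; apply: integrandD; apply: integrandZ.
    exact: iF C1c1 oU1 sU1 t0.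
  exact: iF C1c2 oU2 sU2 t0.
- move=> t x /andP[t0 _] /OO Ox.
  exact: (is_deriveD (is_deriveZ D1^-1 (dtc _ _ _ _ C1c1 (sU1 _ (inS x t Ox t0))))
    (is_deriveZ D2^-1 (dtc _ _ _ _ C1c2 (sU2 _ (inS x t Ox t0))))).
- move=> t x tT Ox; apply: hM; split; first exact: OO.
  by rewrite /= in_itv.
split=> // t tT; apply: is_derive_eq (der t tT) _.
move: tT => /andP[t0 tT]; have t0' := ltW t0.
pose U := slice U1 t `&` slice U2 t `&` (slice UP t `&` slice Uu t).
have oU : open U by apply: openI; apply: openI; exact: open_slice.
have OU : closure Omega `<=` U.
  by move=> x Ox; split; split; [exact: slU sU1 t0' x Ox|exact: slU sU2 t0' x Ox|
    exact: slU sUP t0' x Ox|exact: slU sUu t0' x Ox].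
have s1 : U `<=` slice U1 t by move=> x [[]].
have s2 : U `<=` slice U2 t by move=> x [[]].
have sP : U `<=` slice UP t by move=> x [_ []].
have su : U `<=` slice Uu t by move=> x [_ []].
have CD (c : 'rV[R]_d * R -> R) W' v : (forall w, C1 W' (fun z => 'D_w c z)) ->
    U `<=` slice W' t -> C1 U (fun x => 'D_v (at_time c t) x).
  move=> hc sW; rewrite (_ : (fun x => _) = at_time (fun z => 'D_((v, 0) : 'rV[R]_d * R) c z) t).
    exact (C1S sW (@C1_slice _ _ _ _ t (hc (v, 0)))).
  by apply/funext => x; rewrite derive_slice.
pose a := at_time c1 t; pose b := at_time c2 t; pose phi := at_time Phi t.
have Ca : C1 U a by exact (C1S s1 (@C1_slice _ _ _ _ t C1c1)).
have Cb : C1 U b by exact (C1S s2 (@C1_slice _ _ _ _ t C1c2)).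
have CDa v : C1 U (fun x => 'D_v a x) by exact: CD CD1 s1.
have CDb v : C1 U (fun x => 'D_v b x) by exact: CD CD2 s2.
have CDp v : C1 U (fun x => 'D_v phi x) by exact: CD CDP sP.
have Cu i : C1 U (fun x => at_time u t x 0 i).
  by exact (C1S su (@C1_slice _ _ _ _ t (C1u i))).
have ED := @energy_dissipation _ _ _ bO sm U D1 D2 eps a b phi
  (fun x => dt c1 x t) (fun x => dt c2 x t) (at_time u t) oU OU D10 D20 eps0
  Ca Cb CDa CDb CDp Cu (fun x Ox => c1_eq sol Ox t0)
  (fun x Ox => c2_eq sol Ox t0) (fun x Ox => Phi_eq sol Ox t0)
  (fun x Ox => u_div sol Ox t0) (fun x bx => u_bc sol bx t0')
  (fun x bx => (bc bx t0').1) (fun x n bx => (bc bx t0').2 n)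
  F F1 F2 dF dF1 cF2.
apply: etrans ED; apply: eq_integ => x /OO Ox; rewrite /g /a /b /at_time.
by rewrite (dtE (C1c1.1 _ (sU1 _ (inS x t Ox t0'))))
           (dtE (C1c2.1 _ (sU2 _ (inS x t Ox t0')))).
Qed.

End dynamics.

(** * Convex truncations *)

Section truncation.
Variable R : realType.
Implicit Types (M s a b B : R).

(** For [0 <= M], the cube of the distance to [[0, M]]: convex and of class
    C^2, as [entropy_law] requires. *)
Definition excess M s : R := pospart (s - M) ^+ 3 + pospart (- s - 0) ^+ 3.
Definition excess1 M s : R := 3 * pospart (s - M) ^+ 2 - 3 * pospart (- s - 0) ^+ 2.
Definition excess2 M s : R := 6 * pospart (s - M) + 6 * pospart (- s - 0).

Lemma is_derive_reflect (f : R -> R) s (l : R) :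
  is_derive (- s) 1 f l -> is_derive s 1 (fun t => f (- t)) (- l).
Proof.
move=> hf; have := is_derive1_comp hf (is_deriveN (is_derive_id s (1 : R))).
by move/is_derive_eq; apply; rewrite mulrN1.
Qed.

Lemma is_derive_excess M s : is_derive s 1 (excess M) (excess1 M s).
Proof.
have h := is_deriveD (is_derive_pos3 M s) (is_derive_reflect (is_derive_pos3 0 (- s))).
exact: h.
Qed.

Lemma is_derive_excess1 M s : is_derive s 1 (excess1 M) (excess2 M s).
Proof.
have h := is_deriveB (is_deriveZ 3 (is_derive_pos2 M s))
  (is_deriveZ 3 (is_derive_reflect (is_derive_pos2 0 (- s)))).
by apply: is_derive_eq h _; rewrite /excess2 /GRing.scale /=; ring.
Qed.

Lemma continuous_excess2 M : continuous (excess2 M).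
Proof.
move=> s; have h1 : {for s, continuous (fun t => 6 * pospart (t - M))}.
  by apply: continuousM; [exact: cst_continuous|exact: continuous_pos_shift].
have h2 : {for s, continuous (fun t => 6 * pospart (- t - 0))}.
  apply: continuousM; first exact: cst_continuous.
  apply: (@continuous_comp _ _ _ (fun t : R => - t) (fun t => pospart (t - 0))).
    by apply: continuousN; exact: cvg_id.
  exact: continuous_pos_shift.
exact: (continuousD h1 h2).
Qed.

Lemma excess_ge0 M s : 0 <= excess M s.
Proof. by apply: addr_ge0; apply: exprn_ge0; exact: pospart_ge0. Qed.

Lemma excess2_ge0 M s : 0 <= excess2 M s.
Proof. by apply: addr_ge0; apply: mulr_ge0 => //; exact: pospart_ge0. Qed.

Lemma excess_in M s : 0 <= s <= M -> excess M s = 0.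
Proof.
move=> /andP[s0 sM]; rewrite /excess.
have -> : pospart (s - M) = 0 by case: (pospart_cases (s - M)) => -[h ->]; lra.
have -> : pospart (- s - 0) = 0 by case: (pospart_cases (- s - 0)) => -[h ->]; lra.
by rewrite !expr0n addr0.
Qed.

Lemma excess_eq0 M s : excess M s <= 0 -> 0 <= s <= M.
Proof.
have p1 := pospart_ge0 (s - M); have p2 := pospart_ge0 (- s - 0).
rewrite /excess => h.
have e1 : pospart (s - M) ^+ 3 = 0.
  apply/eqP; rewrite eq_le exprn_ge0 // andbT; apply: le_trans h.
  by rewrite lerDl exprn_ge0.
have e2 : pospart (- s - 0) ^+ 3 = 0.
  apply/eqP; rewrite eq_le exprn_ge0 // andbT; apply: le_trans h.
  by rewrite lerDr exprn_ge0.
move/eqP: e1; move/eqP: e2; rewrite !expf_eq0 /= => /eqP e2 /eqP e1.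
apply/andP; case: (pospart_cases (s - M)) e1 => -[h1 ->]; case: (pospart_cases (- s - 0)) e2 => -[h2 ->];
  split; lra.
Qed.

(** The Legendre part is the sum of the nondecreasing function [g], whose
    contribution has the right sign, and of twice the cube of the negative
    part, which the excess dominates. *)
Lemma excess_balance M a b B : 0 <= M -> `|a| <= B -> `|b| <= B ->
  - ((legendre_part (excess M) (excess1 M) a - legendre_part (excess M) (excess1 M) b)
     * (a - b)) <= 4 * B * (excess M a + excess M b).
Proof.
move=> M0; rewrite !ler_norml => /andP[a1 a2] /andP[b1 b2].
pose g s := 2 * pospart (s - M) ^+ 3 + 3 * M * pospart (s - M) ^+ 2.
have GE s : legendre_part (excess M) (excess1 M) s = g s + 2 * pospart (- s - 0) ^+ 3.
  rewrite /legendre_part /excess /excess1 /g.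
  case: (pospart_cases (s - M)) => -[h ->]; case: (pospart_cases (- s - 0)) => -[h' ->]; ring.
have pm s t : s <= t -> pospart (s - M) <= pospart (t - M).
  by move=> st; case: (pospart_cases (s - M)) => -[h ->]; case: (pospart_cases (t - M)) => -[h' ->]; lra.
have gm s t : s <= t -> g s <= g t.
  move=> /pm h; have p0 := pospart_ge0 (s - M); apply: lerD.
    by rewrite ler_pM2l // ler_pXn2r ?nnegrE // (le_trans p0).
  apply: ler_wpM2l; first exact: mulr_ge0.
  by rewrite ler_pXn2r ?nnegrE // (le_trans p0).
have gg : 0 <= (g a - g b) * (a - b).
  have [ab|/ltW ba] := leP a b.
    by apply: mulr_le0; rewrite subr_le0 // gm.
  by apply: mulr_ge0; rewrite subr_ge0 // gm.
have qa : 0 <= pospart (- a - 0) ^+ 3 by apply: exprn_ge0; exact: pospart_ge0.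
have qb : 0 <= pospart (- b - 0) ^+ 3 by apply: exprn_ge0; exact: pospart_ge0.
have ea : pospart (- a - 0) ^+ 3 <= excess M a.
  by rewrite /excess lerDr exprn_ge0 // pospart_ge0.
have eb : pospart (- b - 0) ^+ 3 <= excess M b.
  by rewrite /excess lerDr exprn_ge0 // pospart_ge0.
rewrite !GE; move: gg qa qb ea eb.
move: (g a) (g b) (pospart (- a - 0) ^+ 3) (pospart (- b - 0) ^+ 3) (excess M a) (excess M b).
move=> ga gb va vb xa xb gg qa qb ea eb.
have B0 : 0 <= B by lra.
have h1 : 0 <= (2 * B + (a - b)) * va by apply: mulr_ge0 => //; lra.
have h2 : 0 <= (2 * B - (a - b)) * vb by apply: mulr_ge0 => //; lra.
have h3 : 0 <= B * (xa - va) by apply: mulr_ge0 => //; lra.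
have h4 : 0 <= B * (xb - vb) by apply: mulr_ge0 => //; lra.
nra.
Qed.

End truncation.

(** * From quadratic bounds to L^p bounds *)

Section Lp.
Variables (R : realType) (d : nat) (Omega : set 'rV[R]_d).
Hypotheses (bO : bounded_open Omega).

(** Integrate [|f|^p <= M^(p-1) |f|] and [|f| <= f^2 / s + s]. The second
    inequality turns a bound on the integral of [f^2] into one on that of
    [|f|] of the order of its square root. *)
Lemma Lp_norm_bound (p M K s : R) f : 1 <= p -> 1 <= M -> 0 <= K -> 0 < s ->
  integrand Omega f -> (forall x, Omega x -> `|f x| <= M) ->
  integ Omega (fun x => f x ^+ 2) <= K * s ^+ 2 ->
  (Lp_norm Omega p f <=
    ((M `^ (p - 1) * (K + vol Omega)) `^ p^-1 * s `^ p^-1)%:E)%E.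
Proof.
move=> p1 M1 K0 s0 hf fM f2.
have p0 : 0 < p by exact: lt_le_trans p1.
have M0 : 0 < M by exact: lt_le_trans M1.
pose N := M `^ (p - 1).
have N0 : 0 <= N by exact: powR_ge0.
have hf2 := integrandX 2 hf.
have ib : integrand Omega (fun x => N * (s^-1 * f x ^+ 2 + s)).
  by apply: integrandZ; apply: integrandD; [exact: integrandZ|exact: integrand_cst].
have mO : measurable (@rV_of_tuple R d @^-1` Omega).
  by apply: measurable_rV_open; case: bO.
have mf := integrand_measurable bO.1 hf.1.
have key : (\int[lebesgue_tuple R d]_(z in @rV_of_tuple R d @^-1` Omega)
   (`|f (rV_of_tuple z)| `^ p)%:E <= (N * (K + vol Omega) * s)%:E)%E.
  apply: (@le_trans _ _ (integ Omega (fun x => N * (s^-1 * f x ^+ 2 + s)))%:E).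
    rewrite integE //; apply: ge0_le_integral => //.
    - apply/measurable_EFinP.
      apply: (measurableT_comp (measurable_powR p)).
      exact: measurableT_comp.
    - by apply/measurable_EFinP; exact: integrand_measurable bO.1 ib.1.
    move=> z Oz; rewrite lee_fin; set y := f (rV_of_tuple z).
    have hy : `|y| <= M by exact: fM.
    have [->|y0] := eqVneq y 0.
      rewrite normr0 powR0 ?gt_eqF //; apply: mulr_ge0 => //.
      apply: addr_ge0 (ltW s0); apply: mulr_ge0 (sqr_ge0 _).
      by rewrite invr_ge0 ltW.
    have yp : 0 < `|y| by rewrite normr_gt0.
    have -> : `|y| `^ p = `|y| `^ (p - 1) * `|y|.
      have := @powRD _ `|y| (p - 1) 1.
      by rewrite subrK powRr1 // normr_eq0 y0 implybT; apply.
    apply: ler_pM => //.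
      by apply: ge0_ler_powR => //; rewrite ?nnegrE ?subr_ge0 // ltW.
    rewrite -(real_normK (num_real y)) -(ler_pM2l s0) mulrDr mulrA mulfV ?gt_eqF //.
    by rewrite mul1r; have := sqr_ge0 (`|y| - s); nra.
  rewrite lee_fin integZ //; last first.
    by apply: integrandD; [exact: integrandZ|exact: integrand_cst].
  rewrite -mulrA; apply: ler_wpM2l => //.
  rewrite integD //; [|exact: integrandZ|exact: integrand_cst].
  rewrite integZ // integ_cst // mulrDl [vol _ * s]mulrC lerD2r.
  rewrite mulrC ler_pdivrMr //; apply: le_trans f2 _.
  by rewrite expr2 mulrA.
have NK0 : 0 <= N * (K + vol Omega) by rewrite mulr_ge0 // addr_ge0 // vol_ge0.
have s0' := ltW s0.
have -> : ((M `^ (p - 1) * (K + vol Omega)) `^ p^-1 * s `^ p^-1)%:E =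
    ((N * (K + vol Omega) * s)%:E `^ p^-1)%E.
  by rewrite poweR_EFin (powRM _ NK0 s0').
rewrite /Lp_norm unlock.
apply: gt0_ler_poweR.
- by rewrite invr_ge0 ltW.
- rewrite in_itv /= leey andbT; apply: integral_ge0 => z _.
  by rewrite lee_fin powR_ge0.
- by rewrite in_itv /= leey andbT lee_fin mulr_ge0.
apply: le_trans key; rewrite le_eqVlt; apply/orP; left; apply/eqP.
rewrite [RHS]integral_mkcond; apply: eq_integral => z _.
rewrite !patchE.
have memE : (z \in @rV_of_tuple R d @^-1` Omega) = ((\row_i tnth z i) \in Omega).
  by apply/idP/idP; rewrite !inE.
rewrite memE; case: ifP => _ /=; first by rewrite -poweR_EFin.
by rewrite normr0 powR0 // gt_eqF.
Qed.

End Lp.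

(** * Conservation of mass and bounds on the concentrations *)

Section solutions.
Variables (R : realType) (d : nat) (Omega : set 'rV[R]_d).
Hypotheses (bO : bounded_open Omega) (sm : smooth_boundary Omega).
Variables (D1 D2 eps nu kappa : R) (W : 'rV[R]_d -> R).
Variables (c1 c2 Phi : 'rV[R]_d * R -> R) (u : 'rV[R]_d * R -> 'rV[R]_d).
Hypotheses (D10 : 0 < D1) (D20 : 0 < D2) (eps0 : 0 < eps).
Hypothesis sol : global_smooth_NPNS_solution Omega D1 D2 eps nu kappa W c1 c2 Phi u.
Hypothesis bc : electroneutral_bc Omega c1 c2.

Lemma C1bar_slice (c : 'rV[R]_d * R -> R) t : smooth_on (space_time Omega) c ->
  0 <= t -> C1bar Omega (at_time c t).
Proof.
move=> /smooth_on_C1 [U [oU sU hc _]] t0; exists (slice U t); split.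
- exact: open_slice.
- by move=> x Ox; apply: sU.
- exact: C1_slice.
Qed.

(** For [F] the identity, both [F''] and the Legendre part vanish, so nothing
    is dissipated. *)
Lemma mass_conserved t : 0 <= t ->
  integ Omega (fun x => D1^-1 * c1 (x, t) + D2^-1 * c2 (x, t)) =
  integ Omega (fun x => D1^-1 * c1 (x, 0) + D2^-1 * c2 (x, 0)).
Proof.
move=> t0; have [->//|tn0] := eqVneq t 0.
have tp : 0 < t by rewrite lt_neqAle eq_sym tn0.
pose E := entropy Omega D1 D2 c1 c2 id.
pose one (s : R) : R := 1; pose zero (s : R) : R := 0.
have dF (s : R) : is_derive s 1 id (one s) by exact: is_derive_id.
have dF1 (s : R) : is_derive s 1 one (zero s) by exact: is_derive_cst.
have [cE dE] := entropy_law bO sm D10 D20 eps0 sol bc dF dF1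
  (@cst_continuous _ _ (0 : R)) tp.
have loss0 s : entropy_loss Omega eps c1 c2 id one zero s = 0.
  rewrite /entropy_loss (eq_integ (g := fun=> 0)) ?integ_cst ?mul0r // => x _.
  by rewrite /dissipation /legendre_part /one /zero !mulr1 !subrr !mul0r !mulr0 !addr0.
have dE0 (s : R) : 0 < s < t -> is_derive s 1 E 0.
  by move=> hs; have := dE s hs; rewrite loss0 oppr0.
have g1 := @gronwall _ E (fun=> 0) 0 t t0 cE dE0.
have cN : {within `[0, t], continuous (fun s => - E s)}.
  by move=> s; exact: (cvgN (cE s)).
have g2 := @gronwall _ (fun s => - E s) (fun=> 0) 0 t t0 cN.
rewrite mul0r expR0 mulr1 in g1; rewrite mul0r expR0 mulr1 in g2.
apply/eqP; rewrite eq_le; apply/andP; split.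
  by apply: g1 => s _; rewrite mul0r.
rewrite -lerN2; apply: g2 => s; last by rewrite mul0r.
by move=> hs; have := is_deriveN (dE0 s hs); rewrite oppr0.
Qed.

Hypothesis c1_init : forall x, Omega x -> 0 <= c1 (x, 0).
Hypothesis c2_init : forall x, Omega x -> 0 <= c2 (x, 0).

Let bounded_st (c : 'rV[R]_d * R -> R) T : smooth_on (space_time Omega) c ->
  exists B, forall x t, Omega x -> 0 <= t <= T -> `|c (x, t)| <= B.
Proof.
move=> /smooth_on_C1 [U [oU sU hc _]].
have cK := compact_setX (bounded_open_compact bO) (@segment_compact R 0 T).
have [|B hB] := @compact_bounded_fun _ _ _ c cK.
  move=> [x t] [/= Ox]; rewrite in_itv /= => /andP[t0 _].
  by apply: (C1_continuous hc); apply: sU.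
exists B => x t Ox tT; apply: hB; split; first exact: subset_closure.
by rewrite /= in_itv.
Qed.

(** By [excess_balance] the entropy of [excess M] satisfies a linear
    differential inequality, and it vanishes initially. The coefficient of the
    inequality involves a bound on the solution up to the time considered,
    which smoothness provides. *)
Lemma concentration_bounds M : 0 <= M ->
  (forall x, Omega x -> c1 (x, 0) <= M) -> (forall x, Omega x -> c2 (x, 0) <= M) ->
  forall x t, Omega x -> 0 <= t ->
  (0 <= c1 (x, t) <= M) /\ (0 <= c2 (x, t) <= M).
Proof.
move=> M0 M1 M2 x T Ox T0; have [->|Tn0] := eqVneq T 0.
  by rewrite c1_init // c2_init // M1 // M2.
have Tp : 0 < T by rewrite lt_neqAle eq_sym Tn0.
have [B1 hB1] := bounded_st T (c1_smooth sol).
have [B2 hB2] := bounded_st T (c2_smooth sol).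
pose B := Num.max B1 B2.
have [cE dE] := entropy_law bO sm D10 D20 eps0 sol bc (is_derive_excess M)
  (is_derive_excess1 M) (@continuous_excess2 _ M) Tp.
set F := excess M in cE dE; set F1 := excess1 M in dE; set F2 := excess2 M in dE.
pose E := entropy Omega D1 D2 c1 c2 F.
have cF : continuous F.
  move=> s; apply: differentiable_continuous; apply/derivable1_diffP.
  by case: (is_derive_excess M s).
have iF (c : 'rV[R]_d * R -> R) t : smooth_on (space_time Omega) c -> 0 <= t ->
    integrand Omega (fun y => F (c (y, t))).
  move=> sc t0; have [U [oU sU hc]] := C1bar_slice sc t0.
  apply: (C1_integrand oU (bounded_open_compact bO) sU) => y Uy.
  by apply: continuous_comp; [exact: C1_continuous hc Uy|exact: cF].
have iE t : 0 <= t ->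
    integrand Omega (fun y => D1^-1 * F (c1 (y, t)) + D2^-1 * F (c2 (y, t))).
  move=> t0; apply: integrandD; apply: integrandZ; apply: iF => //.
    exact: c1_smooth sol.
  exact: c2_smooth sol.
have E0 : E 0 = 0.
  rewrite /E /entropy (eq_integ (g := fun=> 0)) ?integ_cst ?mul0r // => y Oy.
  by rewrite /F !excess_in ?c1_init ?c2_init ?M1 ?M2 // !mulr0 addr0.
have iD1 : 0 <= D1^-1 by rewrite invr_ge0 ltW.
have iD2 : 0 <= D2^-1 by rewrite invr_ge0 ltW.
have Fge y t : 0 <= D1^-1 * F (c1 (y, t)) + D2^-1 * F (c2 (y, t)).
  by apply: addr_ge0; apply: mulr_ge0 => //; exact: excess_ge0.
pose a := eps^-1 * (4 * B) * (D1 + D2).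
have gr : E T <= E 0 * expR (a * T).
  apply: gronwall (ltW Tp) cE dE _ => t /andP[t0 tT].
  have tT' : 0 <= t <= T by rewrite !ltW.
  have [U [oU sU h1]] := C1bar_slice (c1_smooth sol) (ltW t0).
  have [U' [oU' sU' h2]] := C1bar_slice (c2_smooth sol) (ltW t0).
  have idis : integrand Omega (dissipation eps (at_time c1 t) (at_time c2 t) F F1 F2).
    have oI := openI oU oU'.
    have OI : closure Omega `<=` U `&` U' by move=> y Oy; split; [exact: sU|exact: sU'].
    exact (@dissipation_integrand _ _ _ bO (U `&` U') eps _ _ oI OI
      (C1S (@subIsetl _ U U') h1) (C1S (@subIsetr _ U U') h2) F F1 F2
      (is_derive_excess M) (is_derive_excess1 M) (@continuous_excess2 _ M)).
  have iEt := iE t (ltW t0).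
  rewrite /entropy_loss -integN // /entropy -integZ //.
  apply: integ_le => //; [exact: integrandN|exact: integrandZ|].
  move=> y Oy.
  have b1 : `|c1 (y, t)| <= B by rewrite le_max hB1.
  have b2 : `|c2 (y, t)| <= B by rewrite le_max hB2 // orbT.
  have B0 : 0 <= B by exact: le_trans b1.
  have := excess_balance M0 b1 b2; rewrite -/F -/F1 => eb.
  have x1 := excess_ge0 M (c1 (y, t)); have x2 := excess_ge0 M (c2 (y, t)).
  rewrite -/F in x1 x2.
  apply: (@le_trans _ _ (eps^-1 * (4 * B * (F (c1 (y, t)) + F (c2 (y, t)))))).
    apply: le_trans (ler_wpM2l (_ : 0 <= eps^-1) eb); last by rewrite invr_ge0 ltW.
    rewrite /dissipation mulrN lerN2 lerDr addr_ge0 // mulr_ge0 ?grad2_ge0 //;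
      exact: excess2_ge0.
  rewrite /a -!mulrA; apply: ler_wpM2l; first by rewrite invr_ge0 ltW.
  apply: ler_wpM2l => //; apply: ler_wpM2l => //.
  move: x1 x2; move: (F (c1 (y, t))) (F (c2 (y, t))) => X Y x1 x2.
  have -> : (D1 + D2) * (D1^-1 * X + D2^-1 * Y) =
      X + Y + (D2 * D1^-1 * X + D1 * D2^-1 * Y).
    have n1 : D1 != 0 by rewrite gt_eqF.
    have n2 : D2 != 0 by rewrite gt_eqF.
    by field; apply/andP.
  rewrite lerDl; apply: addr_ge0; apply: mulr_ge0 => //;
    by apply: mulr_ge0 => //; exact: ltW.
rewrite E0 mul0r in gr.
have Z := integ_eq0 bO (iE T T0) (fun y _ => Fge y T) gr Ox.
have z1 : 0 <= D1^-1 * F (c1 (x, T)) by apply: mulr_ge0 => //; exact: excess_ge0.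
have z2 : 0 <= D2^-1 * F (c2 (x, T)) by apply: mulr_ge0 => //; exact: excess_ge0.
split; apply: excess_eq0.
  by rewrite -(pmulr_rle0 _ (_ : 0 < D1^-1)) ?invr_gt0 //; move: Z z1 z2; rewrite /F; lra.
by rewrite -(pmulr_rle0 _ (_ : 0 < D2^-1)) ?invr_gt0 //; move: Z z1 z2; rewrite /F; lra.
Qed.

End solutions.

(** * Exponential decay *)

Lemma grad2_lincomb (R : realType) (d : nat) (f g : 'rV[R]_d -> R) (k l : R) x :
  differentiable f x -> differentiable g x ->
  grad2 (fun y => k * f y + l * g y) x <=
  2 * (k ^+ 2 + l ^+ 2) * (grad2 f x + grad2 g x).
Proof.
move=> df dg; rewrite /grad2 /dot -big_split /= mulr_sumr; apply: ler_sum => i _.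
have E : grad (fun y => k * f y + l * g y) x 0 i = k * grad f x 0 i + l * grad g x 0 i.
  rewrite !mxE deriveD_fun; [|exact: differentiableZ_fun..].
  by rewrite !deriveZ_fun.
rewrite E; move: (grad f x 0 i) (grad g x 0 i) => a b.
have h := sqrD_le (k * a) (l * b).
have h1 := sqr_ge0 (k * b); have h2 := sqr_ge0 (l * a).
by move: h h1 h2; rewrite !exprMn => *; nra.
Qed.

Section decay.
Variables (R : realType) (d : nat) (Omega : set 'rV[R]_d).
Hypotheses (bO : bounded_open Omega) (sm : smooth_boundary Omega).
Variables Cd Cn : R.
Hypothesis dirichlet : forall U f, open U -> closure Omega `<=` U -> C1 U f ->
  (forall x, boundary Omega x -> f x = 0) ->
  integ Omega (fun x => f x ^+ 2) <= Cd * integ Omega (grad2 f).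
Hypothesis neumann : forall f m, C1bar Omega f ->
  integ Omega (fun x => f x - m) = 0 ->
  integ Omega (fun x => (f x - m) ^+ 2) <= Cn * dirichlet_energy Omega f.
Hypotheses (Cd0 : 0 <= Cd) (Cn0 : 0 <= Cn).
Variables (D1 D2 : R).
Hypotheses (D10 : 0 < D1) (D20 : 0 < D2).
Local Notation p := D1^-1.
Local Notation q := D2^-1.

(** The entropy density of [F(s) = (s - m)^2]. *)
Definition spread (m : R) (a b : 'rV[R]_d -> R) x :=
  p * (a x - m) ^+ 2 + q * (b x - m) ^+ 2.

Definition spread_const :=
  (p + q)^-1 * (2 * (p ^+ 2 + q ^+ 2) * Cn + 4 * (p * q) * Cd).

Let p0 : 0 < p. Proof. by rewrite invr_gt0. Qed.
Let q0 : 0 < q. Proof. by rewrite invr_gt0. Qed.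
Let S0 : 0 < p + q. Proof. by rewrite addr_gt0. Qed.

Lemma spread_const_ge0 : 0 <= spread_const.
Proof.
have h1 : 0 <= p by exact: ltW.
have h2 : 0 <= q by exact: ltW.
apply: mulr_ge0; first by rewrite invr_ge0 ltW.
apply: addr_ge0; apply: mulr_ge0 => //; apply: mulr_ge0 => //.
  by apply: addr_ge0; exact: sqr_ge0.
exact: mulr_ge0.
Qed.

(** This decomposition separates the part that has mean zero from the part that
    vanishes on the boundary. *)
Lemma spreadE m a b x : (p + q) * spread m a b x =
  (p * a x + q * b x - m * (p + q)) ^+ 2 + p * q * (a x - b x) ^+ 2.
Proof. by rewrite /spread; move: (a x) (b x) p q => *; ring. Qed.

Lemma sqr_diff_le_spread m a b x :
  (a x - b x) ^+ 2 <= (p + q) / (p * q) * spread m a b x.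
Proof.
have pq0 : 0 < p * q by rewrite mulr_gt0.
rewrite mulrAC ler_pdivlMr // spreadE mulrC lerDr; exact: sqr_ge0.
Qed.

Lemma spread_ge0 m a b x : 0 <= spread m a b x.
Proof. by apply: addr_ge0; apply: mulr_ge0; rewrite ?sqr_ge0 // ltW. Qed.

Lemma spread_integrand m a b : integrand Omega a -> integrand Omega b ->
  integrand Omega (spread m a b).
Proof.
move=> ha hb; apply: integrandD; apply: integrandZ; apply: integrandX;
  apply: integrandB => //; exact: integrand_cst.
Qed.

(** The two squares of [spreadE] are bounded by the two Poincare
    inequalities. *)
Lemma poincare_spread m U a b : open U -> closure Omega `<=` U -> C1 U a -> C1 U b ->
  (forall x, boundary Omega x -> a x = b x) ->
  integ Omega (fun x => p * a x + q * b x - m * (p + q)) = 0 ->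
  integ Omega (spread m a b) <=
  spread_const * (integ Omega (grad2 a) + integ Omega (grad2 b)).
Proof.
move=> oU OU Ca Cb ab mean0.
have OsU : Omega `<=` U by move=> x /subset_closure /OU.
have Ba : C1bar Omega a by exists U.
have Bb : C1bar Omega b by exists U.
have ia := C1bar_integrand bO Ba; have ib := C1bar_integrand bO Bb.
have ga := C1bar_grad2 bO Ba; have gb := C1bar_grad2 bO Bb.
have Cc k l : C1 U (fun y => k * a y + l * b y) := C1D oU (C1Z k oU Ca) (C1Z l oU Cb).
have comb k l : integ Omega (grad2 (fun y => k * a y + l * b y)) <=
    2 * (k ^+ 2 + l ^+ 2) * (integ Omega (grad2 a) + integ Omega (grad2 b)).
  rewrite -integD // -integZ //; last exact: integrandD.
  apply: integ_le => //; [exact: grad2_integrand oU OU (Cc k l)|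
    by apply: integrandZ; exact: integrandD|].
  by move=> x /OsU Ux; apply: grad2_lincomb; [exact: Ca.1|exact: Cb.1].
set G := _ + _ in comb *.
have hn : integ Omega (fun x => (p * a x + q * b x - m * (p + q)) ^+ 2) <=
    Cn * (2 * (p ^+ 2 + q ^+ 2) * G).
  have Bh : C1bar Omega (fun y => p * a y + q * b y).
    by exists U; split=> //; exact: Cc.
  by apply: le_trans (neumann Bh mean0) _; apply: ler_wpM2l => //; exact: comb.
have hd : integ Omega (fun x => (a x - b x) ^+ 2) <= Cd * (2 * 2 * G).
  have E x : 1 * a x + (-1) * b x = a x - b x by rewrite mul1r mulN1r.
  rewrite (eq_integ (g := fun x => (1 * a x + (-1) * b x) ^+ 2)); last by move=> x _; rewrite E.
  apply: le_trans (dirichlet oU OU (Cc 1 (-1)) _) _.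
    by move=> x bx; rewrite E ab // subrr.
  apply: ler_wpM2l => //; apply: le_trans (comb 1 (-1)) _.
  by rewrite sqrrN expr1n.
have ir : integrand Omega (fun x => (a x - b x) ^+ 2).
  by apply: integrandX; exact: integrandB.
have ih : integrand Omega (fun x => (p * a x + q * b x - m * (p + q)) ^+ 2).
  apply: integrandX; apply: integrandB; last exact: integrand_cst.
  by apply: integrandD; exact: integrandZ.
have E : (p + q) * integ Omega (spread m a b) =
    integ Omega (fun x => (p * a x + q * b x - m * (p + q)) ^+ 2)
    + p * q * integ Omega (fun x => (a x - b x) ^+ 2).
  rewrite -integZ; [|by []|exact: spread_integrand].
  rewrite -(integZ (p * q) bO ir) -integD //; last exact: integrandZ.
  by apply: eq_integ => x _; rewrite spreadE.
rewrite -(ler_pM2l S0) E /spread_const -!mulrA mulVKf ?gt_eqF // mulrDl.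
apply: lerD.
  by apply: le_trans hn _; rewrite le_eqVlt; apply/orP; left; apply/eqP; ring.
have pq0 : 0 <= p * q by rewrite mulr_ge0 // ltW.
rewrite [leLHS]mulrA; apply: le_trans (ler_wpM2l pq0 hd) _.
rewrite le_eqVlt; apply/orP; left; apply/eqP; ring.
Qed.

Definition decay_rate := 2 / (spread_const + 1).

Lemma decay_rate_gt0 : 0 < decay_rate.
Proof. by rewrite divr_gt0 // ltr_wpDl // spread_const_ge0. Qed.

Variables (eps nu kappa : R) (W : 'rV[R]_d -> R).
Variables (c1 c2 Phi : 'rV[R]_d * R -> R) (u : 'rV[R]_d * R -> 'rV[R]_d).
Hypothesis eps0 : 0 < eps.
Hypothesis sol : global_smooth_NPNS_solution Omega D1 D2 eps nu kappa W c1 c2 Phi u.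
Hypothesis bc : electroneutral_bc Omega c1 c2.

(** The Legendre part of [(s - m)^2] is [s^2 - m^2], so the coupling term is
    [(c1 + c2) (c1 - c2)^2 / eps >= 0]; dropping it makes the rate independent
    of [eps]. *)
Lemma spread_decay m :
  integ Omega (fun x => p * c1 (x, 0) + q * c2 (x, 0) - m * (p + q)) = 0 ->
  (forall x t, Omega x -> 0 <= t -> 0 <= c1 (x, t) + c2 (x, t)) ->
  forall t, 0 <= t -> integ Omega (spread m (at_time c1 t) (at_time c2 t)) <=
    integ Omega (spread m (at_time c1 0) (at_time c2 0)) * expR (- decay_rate * t).
Proof.
move=> mean0 c0 T T0; have [->|Tn0] := eqVneq T 0; first by rewrite mulr0 expR0 mulr1.
have Tp : 0 < T by rewrite lt_neqAle eq_sym Tn0.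
pose F (s : R) := (s - m) ^+ 2; pose F1 (s : R) := 2 * (s - m); pose F2 (s : R) : R := 2.
have dl (s : R) : is_derive s 1 (fun r => r - m) (1 - 0).
  exact: is_deriveB (is_derive_id s 1) (is_derive_cst m s 1).
have dF (s : R) : is_derive s 1 F (F1 s).
  have h := is_deriveX 2 (dl s).
  by apply: is_derive_eq h _; rewrite /F1 /GRing.scale /=; ring.
have dF1 (s : R) : is_derive s 1 F1 (F2 s).
  have h := is_deriveZ 2 (dl s).
  by apply: is_derive_eq h _; rewrite /F2 /GRing.scale /=; ring.
have cF2 : continuous F2 by exact: cst_continuous.
have [cE dE] := entropy_law bO sm D10 D20 eps0 sol bc dF dF1 cF2 Tp.
apply: (gronwall T0 cE dE) => t /andP[t0 _]; have t0' := ltW t0.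
have [U [oU sU h1]] := C1bar_slice (c1_smooth sol) t0'.
have [U' [oU' sU' h2]] := C1bar_slice (c2_smooth sol) t0'.
have oI := openI oU oU'.
have OI : closure Omega `<=` U `&` U' by move=> y Oy; split; [exact: sU|exact: sU'].
have k1 := C1S (@subIsetl _ U U') h1; have k2 := C1S (@subIsetr _ U U') h2.
have B1 : C1bar Omega (at_time c1 t) by exists U.
have B2 : C1bar Omega (at_time c2 t) by exists U'.
have i1 := C1bar_integrand bO B1; have i2 := C1bar_integrand bO B2.
have g1 := C1bar_grad2 bO B1; have g2 := C1bar_grad2 bO B2.
have idis := @dissipation_integrand _ _ _ bO (U `&` U') eps _ _ oI OI k1 k2 F F1 F2
  dF dF1 cF2.
have mass : integ Omega (fun x => p * at_time c1 t x + q * at_time c2 t x - m * (p + q)) = 0.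
  rewrite -mean0.
  have j s : 0 <= s -> integrand Omega (fun x => p * c1 (x, s) + q * c2 (x, s)).
    move=> s0; apply: integrandD; apply: integrandZ.
      exact (C1bar_integrand bO (C1bar_slice (c1_smooth sol) s0)).
    exact (C1bar_integrand bO (C1bar_slice (c2_smooth sol) s0)).
  rewrite (integB bO (j t t0') (integrand_cst _ _)).
  rewrite (integB bO (j 0 (lexx _)) (integrand_cst _ _)).
  by rewrite (mass_conserved bO sm D10 D20 eps0 sol bc t0').
have P := poincare_spread oI OI k1 k2 (fun x bx => (bc bx t0').1) mass.
set G := _ + integ _ _ in P.
set E := integ Omega (spread _ _ _) in P *.
have loss : 2 * G <= entropy_loss Omega eps c1 c2 F F1 F2 t.
  rewrite /G -integD // -integZ //; last exact: integrandD.
  apply: integ_le => //; first by apply: integrandZ; exact: integrandD.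
  move=> x Ox; rewrite /dissipation /F2 -mulrDr lerDl.
  apply: mulr_ge0; first by rewrite invr_ge0 ltW.
  rewrite (_ : _ * _ = (at_time c1 t x + at_time c2 t x) * (at_time c1 t x - at_time c2 t x) ^+ 2).
    by apply: mulr_ge0; [exact: c0|exact: sqr_ge0].
  by rewrite /legendre_part /F /F1; move: (at_time c1 t x) (at_time c2 t x) => *; ring.
rewrite -[entropy _ _ _ _ _ _ _]/E mulNr lerN2; apply: le_trans loss.
have K0 : 0 < spread_const + 1 by rewrite ltr_wpDl // spread_const_ge0.
rewrite /decay_rate mulrAC ler_pdivrMr // -mulrA ler_pM2l //.
apply: le_trans P _; rewrite mulrC ler_wpM2l ?lerDl //.
by apply: addr_ge0; apply: integ_ge0 => x _; exact: grad2_ge0.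
Qed.

End decay.

(** * Constants determined by the data *)

Section data.
Variables (R : realType) (d : nat) (Omega : set 'rV[R]_d).

Lemma bounded_open_of_bounded_set : open Omega -> bounded_set Omega -> bounded_open Omega.
Proof.
move=> oO [M [_ hM]]; split=> //; exists (M + 2) => x Ox.
rewrite -ball_normE /= sub0r normrN.
apply: (@le_lt_trans _ _ (M + 1)); last by rewrite ltrD2l ltr1n.
by apply: (hM (M + 1)); rewrite ?ltrDl.
Qed.

Hypothesis bO : bounded_open Omega.

Definition weighted_mean (S : R) f := integ Omega f / (S * vol Omega).

(** The volume vanishes when [Omega] is empty, and then so do all
    integrals. *)
Lemma integ_weighted_mean (S : R) f : S != 0 -> integrand Omega f ->
  integ Omega (fun x => f x - weighted_mean S f * S) = 0.
Proof.
move=> S0 hf; have [[x Ox]|nO] := pselect (exists x, Omega x); last first.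
  rewrite (eq_integ (g := fun=> 0)); first by rewrite integ_cst // mul0r.
  by move=> x Ox; case: nO; exists x.
have v0 : vol Omega != 0 by rewrite gt_eqF // vol_gt0 //; exists x.
rewrite integB //; last exact: integrand_cst.
rewrite integ_cst // /weighted_mean; apply/eqP; rewrite subr_eq0; apply/eqP.
by field; apply/andP.
Qed.

End data.

Unset Implicit Arguments.

Theorem corollary1 (R : realType) (d : nat) (hd : d = 2%N \/ d = 3%N)
    (Omega : set 'rV[R]_d) (Omega_open : open Omega)
    (Omega_connected : connected Omega) (Omega_bounded : bounded_set Omega)
    (Omega_smooth : smooth_boundary Omega)
    (D1 D2 p : R) (D1_gt0 : 0 < D1) (D2_gt0 : 0 < D2) (p_ge1 : 1 <= p) :
  exists2 lambda : R, 0 < lambda &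
    forall (c10 c20 : 'rV[R]_d -> R) (u0 : 'rV[R]_d -> 'rV[R]_d),
      (forall x, closure Omega x -> 0 <= c10 x) ->
      (forall x, closure Omega x -> 0 <= c20 x) ->
      exists2 C : R, 0 < C &
        forall (eps nu kappa : R) (W : 'rV[R]_d -> R)
          (c1 c2 Phi : 'rV[R]_d * R -> R) (u : 'rV[R]_d * R -> 'rV[R]_d),
          0 < eps -> 0 < nu -> 0 < kappa ->
          smooth_on (boundary Omega) W ->
          global_smooth_NPNS_solution Omega D1 D2 eps nu kappa W c1 c2 Phi u ->
          electroneutral_bc Omega c1 c2 ->
          initial_value Omega c1 c10 ->
          initial_value Omega c2 c20 ->
          initial_value Omega u u0 ->
          forall t : R, 0 <= t ->
            (Lp_norm Omega p (at_time (charge_density c1 c2) t)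
               <= (C * expR (- lambda * t))%:E)%E.
Proof.
have bO := bounded_open_of_bounded_set Omega_open Omega_bounded.
have i0 : 'I_d by apply: (@Ordinal _ 0); case: hd => ->.
have [Cd Cd0 dirichlet] := poincare_dirichlet bO Omega_smooth i0.
have [Cn Cn0 neumann] := poincare_mean bO Omega_smooth Omega_connected.
pose lam := decay_rate Cd Cn D1 D2.
have lam0 : 0 < lam by exact: decay_rate_gt0.
have p0 : 0 < p by exact: lt_le_trans p_ge1.
exists (lam / (2 * p)); first by rewrite divr_gt0 // mulr_gt0.
move=> c10 c20 u0 c10_ge0 c20_ge0.
have OO : Omega `<=` closure Omega := @subset_closure _ Omega.
have S0 : 0 < D1^-1 + D2^-1 by rewrite addr_gt0 ?invr_gt0.
have P0 : 0 < D1^-1 * D2^-1 by rewrite mulr_gt0 ?invr_gt0.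
(* Unbounded data are not attained by any smooth solution, so every C is
   vacuously right for them. *)
have [[M M1 hM]|noM] := pselect (exists2 M, 1 <= M &
    forall x, Omega x -> c10 x <= M /\ c20 x <= M); last first.
  exists 1 => // eps nu kappa W c1 c2 Phi u eps0 _ _ _ sol bc i1 i2 _ t t0.
  case: noM.
  have [B1 h1] := (C1bar_integrand bO (C1bar_slice (c1_smooth sol) (lexx 0))).2.
  have [B2 h2] := (C1bar_integrand bO (C1bar_slice (c2_smooth sol) (lexx 0))).2.
  exists (Num.max 1 (Num.max B1 B2)); first by rewrite le_max lexx.
  move=> x Ox; rewrite -(i1 x (OO x Ox)) -(i2 x (OO x Ox)) !le_max.
  rewrite (le_trans (ler_norm _) (h1 x Ox)) (le_trans (ler_norm _) (h2 x Ox)).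
  by rewrite !orbT.
pose m := weighted_mean Omega (D1^-1 + D2^-1) (fun x => D1^-1 * c10 x + D2^-1 * c20 x).
pose K := (D1^-1 + D2^-1) / (D1^-1 * D2^-1) * integ Omega (spread D1 D2 m c10 c20).
have SP0 : 0 <= (D1^-1 + D2^-1) / (D1^-1 * D2^-1) by rewrite ltW // divr_gt0.
have K0 : 0 <= K.
  by apply: mulr_ge0 => //; apply: integ_ge0 => x _; exact: spread_ge0.
pose C := (M `^ (p - 1) * (K + vol Omega)) `^ p^-1.
(* C itself may vanish. *)
exists (C + 1); first by rewrite ltr_wpDl // powR_ge0.
move=> eps nu kappa W c1 c2 Phi u eps0 _ _ _ sol bc i1 i2 _ t t0.
have M0 : 0 <= M by exact: le_trans M1.
have bounds : forall x s, Omega x -> 0 <= s ->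
    (0 <= c1 (x, s) <= M) /\ (0 <= c2 (x, s) <= M).
  by apply: (concentration_bounds bO Omega_smooth D1_gt0 D2_gt0 eps0 sol bc) => //
    x Ox; rewrite ?i1 ?i2 ?c10_ge0 ?c20_ge0 //; try (exact: OO); case: (hM x Ox).
have ic (c : 'rV[R]_d * R -> R) s : smooth_on (space_time Omega) c -> 0 <= s ->
    integrand Omega (at_time c s).
  by move=> sc s0; exact (C1bar_integrand bO (C1bar_slice sc s0)).
have mean0 : integ Omega
    (fun x => D1^-1 * c1 (x, 0) + D2^-1 * c2 (x, 0) - m * (D1^-1 + D2^-1)) = 0.
  have -> : m = weighted_mean Omega (D1^-1 + D2^-1)
      (fun x => D1^-1 * c1 (x, 0) + D2^-1 * c2 (x, 0)).
    congr (_ / _); apply: eq_integ => x Ox.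
    by rewrite (i1 x (OO x Ox)) (i2 x (OO x Ox)).
  apply: integ_weighted_mean => //; first by rewrite gt_eqF.
  apply: integrandD; apply: integrandZ.
    exact: (ic c1 0 (c1_smooth sol) (lexx 0)).
  exact: (ic c2 0 (c2_smooth sol) (lexx 0)).
have decay := spread_decay bO Omega_smooth dirichlet neumann Cd0 Cn0 D1_gt0 D2_gt0
  eps0 sol bc mean0 _ t0.
have {}decay : integ Omega (spread D1 D2 m (at_time c1 t) (at_time c2 t)) <=
    integ Omega (spread D1 D2 m c10 c20) * expR (- lam * t).
  rewrite -(eq_integ (f := spread D1 D2 m (at_time c1 0) (at_time c2 0)) (g := spread D1 D2 m c10 c20)).
    apply: decay => x s Ox s0; have [/andP[a0 _] /andP[b0 _]] := bounds x s Ox s0.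
    exact: addr_ge0.
  by move=> x Ox; rewrite /spread /at_time (i1 x (OO x Ox)) (i2 x (OO x Ox)).
have ia := ic c1 t (c1_smooth sol) t0; have ib := ic c2 t (c2_smooth sol) t0.
have irho : integrand Omega (at_time (charge_density c1 c2) t) by exact: integrandB.
(* s is the square root of the decay factor of the integral of rho^2. *)
pose s := expR (- lam * t / 2).
apply: (@le_trans _ _ (C * s `^ p^-1)%:E).
  apply: Lp_norm_bound => //; first exact: expR_gt0.
    move=> x Ox; have [/andP[a0 a1] /andP[b0 b1]] := bounds x t Ox t0.
    rewrite /at_time /charge_density ler_norml; apply/andP; split; lra.
  have -> : s ^+ 2 = expR (- lam * t) by rewrite /s expr2 -expRD -splitr.
  rewrite -mulrA; apply: le_trans (ler_wpM2l SP0 decay).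
  rewrite -integZ //; last exact: spread_integrand.
  apply: integ_le => //; [exact: integrandX|by apply: integrandZ; exact: spread_integrand|].
  by move=> x Ox; exact: sqr_diff_le_spread.
have -> : s `^ p^-1 = expR (- (lam / (2 * p)) * t).
  rewrite /s -expRM; congr expR; have n0 : p != 0 by rewrite gt_eqF.
  by field.
by rewrite lee_fin ler_wpM2r ?expR_ge0 // lerDl.
Qed.
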